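(* Consider the original IMEX-RK scheme (O) and the auxiliary IMEX-RK scheme (A) for the phase field crystal model, defined in the context, with $s$ stages, time step $\tau>0$, final time $T$, initial data $\phi^0$, Butcher matrices $A,\hat A\in\mathbb{R}^{s\times s}$, and stabilizers $a>0$, $\alpha,\beta\in\mathbb{R}$. Let $L$ be the Lipschitz constant of the truncated nonlinearity $\tilde f$. Let $E\in\mathbb{R}^{s\times s}$ be the matrix with all entries $1$, $E_L\in\mathbb{R}^{s\times s}$ the lower triangular matrix with all entries on and below the diagonal equal to $1$ and the other entries $0$, $I$ the identity matrix, and define $$H_0=\hat A^{-1}E_L,\qquad Q=(\hat A^{-1}A-I)E_L+I,$$ $$H_1(\beta)=\beta Q-\tfrac{L}{2}I,\qquad H_2(\alpha)=\alpha Q-\tfrac12E+\hat A^{-1}AE_L .$$ For a square matrix $M$ write $\bar M=\frac12(M+M^{\mathrm T})$, and let $\lambda_{\min}(\bar M)$ be the smallest eigenvalue of $\bar M$. Suppose that the Butcher tableaux are such that $\bar Q$ and $\bar H_0$ are positive-definite, and that $$\alpha\ge\frac{1}{2\lambda_{\min}(\bar Q)}-1,\qquad \beta\ge\frac{L}{2\lambda_{\min}(\bar Q)} .$$ Then $\bar H_1(\beta)$ and $\bar H_2(\alpha)$ are both positive-definite, and the following hold. (i) Scheme (A) satisfies the unconditional energy dissipation law: for every $\tau>0$ and every $n$, $$\mathcal{E}(\tilde\phi^{n+1})-\mathcal{E}(\tilde\phi^n)\le 0 .$$ (ii) Scheme (A) satisfies the uniform bound $$\|\tilde u^n_i\|_{L^\infty}\le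 M_0,\qquad i=0,1,\dots,s,\quad n=0,1,\dots,\tfrac{T}{\tau}.$$ (iii) Schemes (O) and (A) share the same numerical solution.
   Context: **Model and energy.** $\Omega\subset\mathbb{R}^d$ ($d=2,3$) is a bounded domain. $C_\Omega$ and $C_p$ denote constants depending only on $\Omega$ for which, for functions with the boundary conditions considered, $\|u\|_{L^\infty}\le C_\Omega\sqrt{\|u\|_{L^2}^2+\|\nabla u\|_{L^2}^2+\|\Delta u\|_{L^2}^2}$ and $\|u-\bar u\|_{L^2}\le C_p\|\nabla u\|_{L^2}$, where $\bar u=\frac1{|\Omega|}\int_\Omega u\,dx$ for a function $u$. $\varepsilon\in(0,1)$ is fixed. The phase field crystal (PFC) equation is $\phi_t=\Delta\mu$, $\mu=(I+\Delta)^2\phi+\phi^3-\varepsilon\phi$ on $\Omega\times(0,T]$, $\phi(\cdot,0)=\phi^0$, with periodic boundary conditions or homogeneous Neumann conditions $\frac{\partial\phi}{\partial n}=\frac{\partial\Delta\phi}{\partial n}=\frac{\partial\mu}{\partial n}=0$. All functions are assumed regular enough in space for the expressions below to make sense. The energy is $$\mathcal{E}(\phi)=\int_\Omega\Big(\tfrac14\phi^4-\tfrac{\varepsilon}{2}\phi^2+\tfrac12\phi(I+\Delta)^2\phi\Big)dx .$$ **Stabilized splitting.** With $f(\phi)=\phi^3-(\varepsilon+a)\phi$ and $P_a=(\Delta+I)^2+aI$, the equation is rewritten as $\phi_t=\mathcal{L}\phi+N(\phi)$ with $$\mathcal{L}=\Delta\big((1+\alpha)P_a+\beta I\big),\qquad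 N(\phi)=-\Delta\big(-f(\phi)+\alpha P_a\phi+\beta\phi\big).$$ **Butcher coefficients.** $A=(a_{ij})$ and $\hat A=(\hat a_{ij})$ are lower triangular $s\times s$ real matrices (diagonal allowed to be nonzero), with $c_i=\sum_{j=1}^s a_{ij}=\hat c_i=\sum_{j=1}^s\hat a_{ij}$, weights $b_j=a_{sj}$, $\hat b_j=\hat a_{sj}$ (so the implicit method is stiffly accurate), and $\hat A$ invertible. **Scheme (O)** (original): given $\phi^n$ (with $\phi^0$ the initial data), $$u^n_0=\phi^n,\qquad u^n_i=u^n_0+\tau\Big(\sum_{j=1}^i a_{ij}\mathcal{L}u^n_j+\sum_{j=1}^i\hat a_{ij}N(u^n_{j-1})\Big)\ (1\le i\le s),\qquad \phi^{n+1}=u^n_s .$$ **The constant $M_0$.** For a function $v$ on $\Omega$ define $M(v,\Omega)=C_\Omega\sqrt{M_1^2+M_2^2+M_3^2}$, where $\delta>0$ is a fixed number with $\frac{\delta}{2}C_p\le\frac12$ and $$M_1=2(\mathcal{E}(v)+|\Omega|)^{1/2},\quad M_2=\tfrac{C_p}{\delta}M_1+2\|\bar v\|_{L^2},\quad M_3=\delta\|\bar v\|_{L^2}+\Big(\tfrac{C_p}{2}+\tfrac1{2\delta}\Big)M_1 .$$ Set $M_0=M(\phi^0,\Omega)$. **Truncated nonlinearity.** $$\tilde f(\phi)=\begin{cases}(3M_0^2-(\varepsilon+a))\phi-2M_0^3,&\phi>M_0,\\ \phi^3-(\varepsilon+a)\phi,&\phi\in[-M_0,M_0],\\ (3M_0^2-(\varepsilon+a))\phi+2M_0^3,&\phi<-M_0,\end{cases}$$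 which is globally Lipschitz with constant $L$. **Scheme (A)** (auxiliary): $\tilde\phi^0=\phi^0$, $\tilde N(\phi)=-\Delta(-\tilde f(\phi)+\alpha P_a\phi+\beta\phi)$, and $$\tilde u^n_0=\tilde\phi^n,\qquad \tilde u^n_i=\tilde u^n_0+\tau\Big(\sum_{j=1}^i a_{ij}\mathcal{L}\tilde u^n_j+\sum_{j=1}^i\hat a_{ij}\tilde N(\tilde u^n_{j-1})\Big)\ (1\le i\le s),\qquad \tilde\phi^{n+1}=\tilde u^n_s .$$ Sharing the same numerical solution means $u^n_i=\tilde u^n_i$ for all $i,n$.
   Formalization: At equality in the bound on α or β, the symmetric part of H_2(α) or H_1(β) is only positive-semidefinite (s=1, A=Â=1, β=L/2 gives H_1=0), so positive-definiteness is stated for strict inequality and semidefiniteness otherwise; (i)–(iii) keep the non-strict bounds. *)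

(* Defs.v *)
From HB Require Import structures.
From mathcomp Require Import all_boot all_order all_algebra.
From mathcomp Require Import all_classical all_reals all_analysis.

Set Implicit Arguments.
Unset Strict Implicit.
Unset Printing Implicit Defensive.
Import Order.TTheory GRing.Theory Num.Theory.
Import numFieldNormedType.Exports.
Local Open Scope classical_set_scope.
Local Open Scope ring_scope.

(* A product of sigma-finite measures, transported along a bimeasurable map. *)
Section image_product.
Context d1 d2 d3 (T1 : measurableType d1) (T2 : measurableType d2)
  (T3 : measurableType d3) (R : realType).
Variables (f : T1 * T2 -> T3) (g : T3 -> T1 * T2).
Hypotheses (mf : measurable_fun setT f) (mg : measurable_fun setT g)
  (fK : cancel f g).
Variables (m1 : {sigma_finite_measure set T1 -> \bar R})
  (m2 : {sigma_finite_measure set T2 -> \bar R}).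

Let mu := pushforward (m1 \x m2)%E f.

Let mu0 : mu set0 = 0%E. Proof. exact: measure0. Qed.

Let mu_ge0 A : (0 <= mu A)%E. Proof. exact: measure_ge0. Qed.

Let mu_sigma_additive : semi_sigma_additive mu.
Proof. exact: measure_semi_sigma_additive. Qed.

HB.instance Definition _ := isMeasure.Build _ _ _ mu mu0 mu_ge0 mu_sigma_additive.

Let mu_sigma_finite : sigma_finite setT mu.
Proof.
have /sigma_finiteP[F [TF ndF Foo]] := sigma_finiteT m1.
have /sigma_finiteP[G [TG ndG Goo]] := sigma_finiteT m2.
exists (fun k => g @^-1` (F k `*` G k)).
  apply/esym; rewrite -subTset => t _; case E : (g t) => [x y].
  have [n _ Fnx] : (\bigcup_n F n) x by rewrite -TF.
  have [k _ Gky] : (\bigcup_n G n) y by rewrite -TG.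
  exists (maxn n k) => //=; rewrite E; split => /=.
  - by move: x Fnx {E}; exact/subsetPset/ndF/leq_maxl.
  - by move: y Gky {E}; exact/subsetPset/ndG/leq_maxr.
move=> k; have [? ?] := Foo k; have [? ?] := Goo k; split.
  by rewrite -[X in measurable X]setTI; apply: mg => //; exact: measurableX.
rewrite /mu /pushforward (_ : _ @^-1` _ = F k `*` G k).
  by rewrite product_measure1E// lte_mul_pinfty// ge0_fin_numE.
by apply/seteqP; split => p /=; rewrite fK.
Qed.

HB.instance Definition _ := Measure_isSigmaFinite.Build _ _ _ mu mu_sigma_finite.

Definition image_product : {sigma_finite_measure set T3 -> \bar R} := mu.

End image_product.

Section lebesgue_tuple.
Variable R : realType.
Local Notation RT := (measurableTypeR R).

Definition tuple_cons n (p : RT * n.-tuple RT) : n.+1.-tuple RT :=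
  [tuple of p.1 :: p.2].

Definition tuple_uncons n (t : n.+1.-tuple RT) : RT * n.-tuple RT :=
  (tnth t ord0, [tuple of behead t]).

Lemma measurable_tuple_cons n : measurable_fun [set: RT * n.-tuple RT] (@tuple_cons n).
Proof.
exact: (@measurable_cons _ _ (RT * n.-tuple RT)%type RT fst n snd
  measurable_fst measurable_snd).
Qed.

Lemma measurable_tuple_uncons n : measurable_fun setT (@tuple_uncons n).
Proof.
apply/measurable_fun_pairP; split.
  exact: (@measurable_tnth _ RT n.+1 ord0).
exact: (@measurable_behead _ RT n).
Qed.

Lemma tuple_consK n : cancel (@tuple_cons n) (@tuple_uncons n).
Proof. by case=> x t; congr (_, _); apply: val_inj. Qed.

(* Lebesgue measure on R^d, by iterated products; the library has it for d = 1
   only. *)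
Fixpoint lebesgue_tuple d : {sigma_finite_measure set (d.-tuple RT) -> \bar R} :=
  match d with
  | 0 => dirac ([tuple] : 0.-tuple RT)
  | n.+1 => image_product (@measurable_tuple_cons n) (@measurable_tuple_uncons n)
              (@tuple_consK n) (@lebesgue_measure R) (lebesgue_tuple n)
  end.

End lebesgue_tuple.

Section fields.
Variables (R : realType) (d : nat).
Local Notation V := 'rV[R]_d.
Local Notation pt := (d.-tuple (measurableTypeR R)).
Implicit Types (Omega : set V) (u v w : V -> R).

Definition point_of (t : pt) : V := \row_i tnth t i.

Definition integral Omega (f : V -> R) : R :=
  \int[lebesgue_tuple R d]_(t in point_of @^-1` Omega) f (point_of t).

Definition basis_vec (i : 'I_d) : V := delta_mx 0 i.

Definition partial (i : 'I_d) u : V -> R := fun x => 'D_(basis_vec i) u x.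

Definition lap u : V -> R := fun x => \sum_i partial i (partial i u) x.

Fixpoint Ck (k : nat) u : Prop :=
  continuous u /\
  match k with
  | 0 => True
  | k'.+1 => forall i, (forall x, derivable u x (basis_vec i)) /\ Ck k' (partial i u)
  end.

Definition volume Omega : R := integral Omega (fun=> 1).

Definition mean Omega u : R := integral Omega u / volume Omega.

Definition L2norm Omega u : R := Num.sqrt (integral Omega (fun x => u x ^+ 2)).

Definition L2norm_grad Omega u : R :=
  Num.sqrt (integral Omega (fun x => \sum_i partial i u x ^+ 2)).

(* Only used for functions that are continuous up to the boundary, for which
   the essential supremum is the supremum. *)
Definition Linfnorm Omega u : R := sup [set `|u x| | x in Omega].

(* Periodic lo hi: Omega is the cell with corners lo and hi.
   Neumann sigma nu: sigma is the surface measure and nu the exterior unit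
   normal of the boundary of Omega. *)
Inductive boundary_type :=
| Periodic of V & V
| Neumann of {measure set pt -> \bar R} & (V -> V).

Definition frontier Omega : set V := closure Omega `\` interior Omega.

(* De Giorgi's definition: (sigma, nu) represents the distributional gradient
   of the indicator function of Omega, i.e. it is the pair for which the
   Gauss-Green formula holds. On a bounded Lipschitz domain this is the usual
   surface measure with the usual normal. *)
Definition exterior_normal Omega (sigma : {measure set pt -> \bar R})
    (nu : V -> V) : Prop :=
  [/\ (sigma (point_of @^-1` frontier Omega) < +oo)%E,
      forall i, measurable_fun (point_of @^-1` frontier Omega)
                  (fun t => nu (point_of t) 0 i),
      forall x, frontier Omega x -> \sum_i nu x 0 i ^+ 2 = 1
    & forall F : 'I_d -> V -> R, (forall i, Ck 1 (F i)) ->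
        integral Omega (fun x => \sum_i partial i (F i) x) =
        \int[sigma]_(t in point_of @^-1` frontier Omega)
          (\sum_i F i (point_of t) * nu (point_of t) 0 i)].

Definition boundary_ok Omega (b : boundary_type) : Prop :=
  match b with
  | Periodic lo hi =>
      (forall i, lo 0 i < hi 0 i) /\
      Omega = [set x | forall i, lo 0 i < x 0 i < hi 0 i]
  | Neumann sigma nu => exterior_normal Omega sigma nu
  end.

(* The boundary condition for a function that is smooth on the whole space:
   periodicity, resp. a vanishing normal derivative at sigma-almost every
   boundary point. *)
Definition bc Omega (b : boundary_type) w : Prop :=
  match b with
  | Periodic lo hi =>
      forall x i, w (x + (hi 0 i - lo 0 i) *: basis_vec i) = w x
  | Neumann sigma nu =>
      {ae sigma, forall t, frontier Omega (point_of t) ->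
        \sum_i partial i w (point_of t) * nu (point_of t) 0 i = 0}
  end.

(* u is C^k up to the boundary (it has a C^k extension) and satisfies the
   boundary condition. Values of u outside Omega are irrelevant. *)
Definition Ck_bc Omega b k u : Prop :=
  exists w, [/\ Ck k w, forall x, Omega x -> u x = w x & bc Omega b w].

Section model.
Variables (eps a alpha beta : R).

Definition shift u : V -> R := fun x => u x + lap u x.

Definition Pa u : V -> R := fun x => shift (shift u) x + a * u x.

Definition energy Omega u : R :=
  integral Omega (fun x =>
    4^-1 * u x ^+ 4 - eps / 2 * u x ^+ 2 + 2^-1 * u x * shift (shift u) x).

Definition f_pfc (y : R) : R := y ^+ 3 - (eps + a) * y.

Definition f_trunc (M y : R) : R :=
  if M < y then (3 * M ^+ 2 - (eps + a)) * y - 2 * M ^+ 3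
  else if y < - M then (3 * M ^+ 2 - (eps + a)) * y + 2 * M ^+ 3
  else y ^+ 3 - (eps + a) * y.

Definition Mbound Omega (COm Cp delta : R) u : R :=
  let nbar := L2norm Omega (fun=> mean Omega u) in
  let M1 := 2 * Num.sqrt (energy Omega u + volume Omega) in
  let M2 := Cp / delta * M1 + 2 * nbar in
  let M3 := delta * nbar + (Cp / 2 + (2 * delta)^-1) * M1 in
  COm * Num.sqrt (M1 ^+ 2 + M2 ^+ 2 + M3 ^+ 2).

Definition Lop u : V -> R := lap (fun x => (1 + alpha) * Pa u x + beta * u x).

(* The nonlinear part N built on a scalar nonlinearity g. *)
Definition Nop (g : R -> R) u : V -> R :=
  fun x => - lap (fun y => - g (u y) + alpha * Pa u y + beta * u y) x.

(* For g = f_pfc this is (I + lap)^2 u + u^3 - eps u. *)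
Definition chem (g : R -> R) u : V -> R := fun x => Pa u x + g (u x).

(* The boundary conditions on u, lap u and the chemical potential, with the
   smoothness up to the boundary that makes Lop u and Nop g u classical. *)
Definition admissible Omega b (g : R -> R) u : Prop :=
  [/\ Ck_bc Omega b 6 u, Ck_bc Omega b 4 (lap u) & Ck_bc Omega b 2 (chem g u)].

(* u n i is the stage u^n_i for 0 <= i <= s. Matrix indices start at 0: row i of
   A and Ahat defines stage i.+1. The time levels are those with n <= T / tau. *)
Definition imex_rk Omega b s (A Ahat : 'M[R]_s) (tau T : R) (g : R -> R)
    (phi0 : V -> R) (phi : nat -> V -> R) (u : nat -> nat -> V -> R) : Prop :=
  (forall x, Omega x -> phi 0 x = phi0 x) /\
  forall n : nat, n%:R <= T / tau ->
    [/\ forall i, (i <= s)%N -> admissible Omega b g (u n i),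
        forall x, Omega x -> u n 0 x = phi n x,
        forall (i : 'I_s) x, Omega x ->
          u n i.+1 x = u n 0 x +
            tau * (\sum_(j < s | (j <= i)%N) A i j * Lop (u n j.+1) x +
                   \sum_(j < s | (j <= i)%N) Ahat i j * Nop g (u n j) x)
      & forall x, Omega x -> phi n.+1 x = u n s x].

End model.
End fields.

Section matrices.
Variables (R : realType) (s : nat).
Implicit Types M : 'M[R]_s.

Definition sym_part M : 'M[R]_s := 2^-1 *: (M + M^T).

Definition pos_def M : Prop :=
  forall v : 'cV[R]_s, v != 0 -> 0 < (v^T *m M *m v) 0 0.

Definition pos_semidef M : Prop :=
  forall v : 'cV[R]_s, 0 <= (v^T *m M *m v) 0 0.

(* Used for symmetric M of positive size, whose set of eigenvalues is finite
   and nonempty, so that the infimum is a minimum. *)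
Definition lambda_min M : R := inf [set l : R | eigenvalue M l].

Definition ones_mx : 'M[R]_s := const_mx 1.

Definition lower_ones_mx : 'M[R]_s := \matrix_(i, j) (j <= i)%N%:R.

Variables A Ahat : 'M[R]_s.

Definition H0_mx : 'M[R]_s := invmx Ahat *m lower_ones_mx.

Definition Q_mx : 'M[R]_s := (invmx Ahat *m A - 1%:M) *m lower_ones_mx + 1%:M.

Definition H1_mx (L beta : R) : 'M[R]_s := beta *: Q_mx - (L / 2)%:M.

Definition H2_mx (alpha : R) : 'M[R]_s :=
  alpha *: Q_mx - 2^-1 *: ones_mx + invmx Ahat *m A *m lower_ones_mx.

End matrices.

(* Main.v *)
Require Import Defs.
From HB Require Import structures.
From mathcomp Require Import all_boot all_order all_algebra.
From mathcomp Require Import all_classical all_reals all_analysis.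
From mathcomp Require Import measurable_realfun.
From mathcomp Require Import ring lra.
Import Defs.
Set Implicit Arguments.
Unset Strict Implicit.
Unset Printing Implicit Defensive.
Import Order.TTheory GRing.Theory Num.Theory.
Import numFieldNormedType.Exports.
Local Open Scope classical_set_scope.
Local Open Scope ring_scope.

(** Why the theorem holds.

    Let D_j be the increments between successive stages, stacked in a vector D.
    Multiplying the stage equations by the inverse of Ahat and using that A and
    Ahat have equal row sums, the auxiliary scheme becomes
      H0 D = tau Delta mu,
      mu = P u_0 + (K + alpha Q) P D + beta Q D + ftilde(u_{j-1}),
    where K = Ahat^-1 A E_L (scheme_increments). The potential of ftilde is a
    parabola minus a convex function, so that each increment changes it by at
    most ftilde(u_{j-1}) D_j + L/2 D_j^2 (F_trunc_taylor). Hence the increase of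
    the truncated energy is at most (D, mu) minus the forms of H1(beta) in D and
    of H2(alpha) in the operator P (energy_density_increment, step_dissipation).
    These forms are nonnegative since the symmetric part of H2(alpha) is
    (1 + alpha) Qbar - I/2 (qform_H2), and (D, mu) = - tau (H0^-1 grad mu, grad mu)
    is nonpositive. All matrices are lower triangular, so the same computation
    on the first i entries shows that the truncated energy at every single
    stage, and not just at the end of the step, is below the initial one.

    The truncated energy bounds the Laplacian of a stage in L^2, because the
    truncation level satisfies M0^2 >= 3; the mean value is conserved, and the
    Poincare and Sobolev inequalities give the bound by M0 in L^infinity
    (Linfnorm_bound). The truncation is therefore never active: this yields the
    dissipation of the original energy and shows that the solution also solves
    the original scheme. The original scheme has at most one solution because
    the diagonal of A is positive, which makes each implicit stage equation
    injective (implicit_stage_unique, stages_unique).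

    The analytic tool is Green's formula (green) for functions that satisfy the
    boundary condition. In the Neumann case it is the divergence theorem that
    defines the exterior normal; in the periodic case it follows from Fubini and
    the fundamental theorem of calculus (tbox_integral_derivative_eq0). The
    chemical potentials satisfy the boundary condition by a chain rule up to the
    boundary (chain_rule_closure, admissible_extends). *)

(** * Quadratic forms, triangular matrices and Butcher tableaux *)

Section quadratic_forms.
Variable R : realType.

Definition qform n (M : 'M[R]_n) (v : 'cV[R]_n) : R := (v^T *m M *m v) 0 0.

Lemma qformE n (M : 'M[R]_n) v :
  qform M v = \sum_i \sum_j v i 0 * M i j * v j 0.
Proof.
rewrite /qform mxE exchange_big; apply: eq_bigr => j _ /=.
by rewrite mxE big_distrl; apply: eq_bigr => i _ /=; rewrite mxE.
Qed.

Lemma qformD n (M N : 'M[R]_n) v : qform (M + N) v = qform M v + qform N v.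
Proof. by rewrite /qform mulmxDr mulmxDl mxE. Qed.

Lemma qformZ n (M : 'M[R]_n) k v : qform (k *: M) v = k * qform M v.
Proof. by rewrite /qform -scalemxAr -scalemxAl mxE. Qed.

Lemma qform1 n (v : 'cV[R]_n) : qform 1%:M v = \sum_i v i 0 ^+ 2.
Proof. by rewrite /qform mulmx1 mxE; apply: eq_bigr => i _; rewrite mxE expr2. Qed.

Lemma qform_tr n (M : 'M[R]_n) v : qform M^T v = qform M v.
Proof.
rewrite !qformE exchange_big; apply: eq_bigr => i _; apply: eq_bigr => j _ /=.
by rewrite mxE; ring.
Qed.

Lemma qform_sym_part n (M : 'M[R]_n) v : qform (sym_part M) v = qform M v.
Proof. by rewrite /sym_part qformZ qformD qform_tr; field. Qed.

Lemma qform1_gt0 n (v : 'cV[R]_n) : v != 0 -> 0 < qform 1%:M v.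
Proof.
move=> v0; rewrite qform1 lt_neqAle sumr_ge0 ?andbT => [|i _]; last exact: sqr_ge0.
apply: contra v0; rewrite eq_sym psumr_eq0 => [/allP h|i _]; last exact: sqr_ge0.
apply/eqP/matrixP => i j; rewrite ord1 mxE; apply/eqP.
by rewrite -sqrf_eq0; apply: (h i); rewrite mem_index_enum.
Qed.

Lemma trmx11 (M : 'M[R]_1) : M^T = M.
Proof. by rewrite [M]mx11_scalar tr_scalar_mx. Qed.

Lemma continuous_sum (T : topologicalType) (I : Type) (r : seq I)
    (F : I -> T -> R) :
  (forall i, continuous (F i)) -> continuous (fun x => \sum_(i <- r) F i x).
Proof.
move=> cF x; elim: r => [|i r ih].
  by under eq_fun do rewrite big_nil; apply: cvg_cst.
under eq_fun do rewrite big_cons.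
by apply: continuousD => //; apply: cF.
Qed.

Lemma continuous_mul (T : topologicalType) (F G : T -> R) :
  continuous F -> continuous G -> continuous (fun x => F x * G x).
Proof. by move=> cF cG x; apply: cvgM; [apply: cF|apply: cG]. Qed.

Lemma continuous_add (T : topologicalType) (F G : T -> R) :
  continuous F -> continuous G -> continuous (fun x => F x + G x).
Proof. by move=> cF cG x; apply: cvgD; [apply: cF|apply: cG]. Qed.

Lemma continuous_sub (T : topologicalType) (F G : T -> R) :
  continuous F -> continuous G -> continuous (fun x => F x - G x).
Proof. by move=> cF cG x; apply: cvgB; [apply: cF|apply: cG]. Qed.

(** The minimum of the quadratic form over the unit sphere, which exists by
    compactness, is attained at an eigenvector, since there the first variation
    of the form vanishes. *)
Lemma lambda_min_attained n (S : 'M[R]_n) : (0 < n)%N -> S^T = S ->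
  (forall v, lambda_min S * qform 1%:M v <= qform S v) /\
  (exists2 v, v != 0 & qform S v = lambda_min S * qform 1%:M v).
Proof.
move=> n_gt0 Ssym.
pose sph := [set x : 'rV[R]_n | qform 1%:M x^T = 1].
have cq (M : 'M[R]_n) : continuous (fun x : 'rV[R]_n => qform M x^T).
  under eq_fun do rewrite qformE.
  apply: continuous_sum => i; apply: continuous_sum => j.
  have ct k : continuous (fun x : 'rV[R]_n => x^T k 0).
    by under eq_fun do rewrite mxE; exact: coord_continuous.
  apply: continuous_mul => //; apply: continuous_mul => //; exact: cst_continuous.
have sph0 : sph !=set0.
  exists (delta_mx 0 (Ordinal n_gt0)); rewrite /sph /= qform1.
  rewrite (bigD1 (Ordinal n_gt0)) //= big1 => [|i /negbTE ni].
    by rewrite !mxE !eqxx expr1n addr0.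
  by rewrite !mxE ni expr0n.
have csph : compact sph.
  apply: bounded_closed_compact.
    exists 1; split => // M M1 x /= x1; apply: le_trans (ltW M1).
    rewrite [leLHS]/Num.Def.normr /= mx_normrE; apply/bigmax_leP; split => //= -[i j] _ /=.
    rewrite (ord1 i) -(@expr_le1 _ 2) // real_normK ?num_real //.
    have : x 0 j ^+ 2 <= qform 1%:M x^T.
      rewrite qform1 (bigD1 j) //= mxE lerDl sumr_ge0 // => k _; exact: sqr_ge0.
    by rewrite x1.
  have := @closed_comp _ _ (fun x : 'rV[R]_n => qform 1%:M x^T) [set 1].
  apply; last exact: closed_eq.
  by move=> x _; apply: cq.
have [x0 /set_mem x0s minx0] :=
  @EVT_min_rV R n (fun x => qform S x^T) sph sph0 csph (continuous_subspaceT (cq S)).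
set m := qform S x0^T in minx0.
have [N NE] : {N | N = S - m%:M} by exists (S - m%:M).
have qN v : qform N v = qform S v - m * qform 1%:M v.
  by rewrite NE qformD -[m%:M]scalemx1 -scaleNr qformZ mulNr.
have N_ge0 v : 0 <= qform N v.
  have [->|v0] := eqVneq v 0.
    by rewrite /qform mulmx0 mxE.
  have p := qform1_gt0 v0; set c := qform 1%:M v in p.
  pose k := (Num.sqrt c)^-1.
  have kk : k ^+ 2 * c = 1.
    by rewrite exprVn sqr_sqrtr ?ltW // mulVf ?gt_eqF.
  have qk M : qform M (k *: v) = k ^+ 2 * qform M v.
    by rewrite /qform [(k *: v)^T]linearZ /= -!scalemxAr -!scalemxAl !mxE expr2 mulrA.
  have := minx0 (k *: v)^T.
  rewrite trmxK inE /sph /= trmxK qk kk => /(_ erefl).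
  rewrite qk qN subr_ge0 -/c => h.
  rewrite -(ler_pM2l (_ : 0 < k ^+ 2)); last first.
    by rewrite exprn_gt0 // invr_gt0 sqrtr_gt0.
  by rewrite mulrCA kk mulr1.
have Nx0 : qform N x0^T = 0 by rewrite qN x0s mulr1 subrr.
have Nsym : N^T = N by rewrite NE linearB /= Ssym tr_scalar_mx.
have eigx0 : N *m x0^T = 0.
  apply/matrixP => i j; rewrite (ord1 j) [RHS]mxE.
  set y := N *m x0^T; pose c := qform N y; pose b := qform 1%:M y.
  (* the form at x0 + t y, where y = N x0, is 2 t |y|^2 + t^2 c *)
  have ht t : 0 <= t * (2 * b + t * c).
    suff -> : t * (2 * b + t * c) = qform N (x0^T + t *: y) by [].
    rewrite {1}/qform [(_ + _)^T]linearD /= [(t *: y)^T]linearZ /= mulmxDl !mulmxDr !mulmxDl.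
    have e1 : (x0^T)^T *m N = y^T by rewrite /y trmx_mul Nsym.
    rewrite e1 -!scalemxAl -!scalemxAr scalerA.
    have -> : y^T *m x0^T = (x0^T)^T *m y by rewrite -[LHS]trmx11 trmx_mul !trmxK.
    have e2 : (x0^T)^T *m y = 0.
      apply/matrixP => p q; rewrite !ord1 /y. rewrite mulmxA. rewrite [RHS]mxE; exact: Nx0.
    rewrite e2 add0r -mulmxA -/y.
    by rewrite !mxE; rewrite /b /c /qform mulmx1 !mxE; ring.
  have b_ge0 : 0 <= b by rewrite /b qform1 sumr_ge0 // => k _; exact: sqr_ge0.
  have c_ge0 : 0 <= c by exact: N_ge0.
  have b0 : b = 0.
    apply/eqP; rewrite eq_le b_ge0 andbT.
    have := ht (- (b / (c + 1))); have c1 : 0 < c + 1 by lra.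
    rewrite mulNr oppr_ge0 => h.
    rewrite leNgt; apply/negP => bp; move: h; apply/negP; rewrite -ltNge.
    apply: mulr_gt0; first exact: divr_gt0.
    have : b / (c + 1) * c <= b by rewrite mulrAC ler_pdivrMr // ; nra.
    by lra.
  move: b0; rewrite /b qform1 => /eqP; rewrite psumr_eq0 => [/allP h|k _]; last exact: sqr_ge0.
  have := h i; rewrite mem_index_enum sqrf_eq0 => /(_ isT) /eqP; exact.
have x0n0 : x0 != 0.
  apply/eqP => e; move: x0s; rewrite /sph /= e linear0 /qform mulmx0 mxE.
  by move/eqP; rewrite eq_sym oner_eq0.
have eS : qform S x0^T = m by [].
have meig : eigenvalue S m.
  apply/eigenvalueP; exists x0 => //; apply: trmx_inj.
  rewrite trmx_mul Ssym linearZ /=; apply/eqP; rewrite -subr_eq0 -mul_scalar_mx.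
  by rewrite -mulmxBl -NE eigx0.
have lb l : eigenvalue S l -> m <= l.
  move=> /eigenvalueP[v vS v0].
  have v0' : v^T != 0 by rewrite trmx_eq0.
  have := N_ge0 v^T; rewrite qN subr_ge0 => h.
  have e : qform S v^T = l * qform 1%:M v^T.
    by rewrite /qform trmxK vS mulmx1 -scalemxAl mxE.
  by move: h; rewrite e ler_pM2r // qform1_gt0.
have lamE : lambda_min S = m.
  apply/eqP; rewrite eq_le; apply/andP; split.
    by apply: ge_inf => //; exists m => l; exact: lb.
  by apply: lb_le_inf; [exists m | move=> l; exact: lb].
rewrite lamE; split=> [v|]; first by rewrite -subr_ge0 -qN.
by exists x0^T; rewrite ?trmx_eq0 // x0s mulr1.
Qed.

End quadratic_forms.

Section triangular.
Variable R : realType.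

Lemma trig_mulmx n (M N : 'M[R]_n) :
  is_trig_mx M -> is_trig_mx N -> is_trig_mx (M *m N).
Proof.
move=> /is_trig_mxP tM /is_trig_mxP tN; apply/is_trig_mxP => i j ij.
rewrite mxE big1 // => k _; have [ik|ki] := ltnP i k; first by rewrite tM // mul0r.
by rewrite tN ?mulr0 // (leq_ltn_trans ki).
Qed.

Lemma trig_addmx n (M N : 'M[R]_n) :
  is_trig_mx M -> is_trig_mx N -> is_trig_mx (M + N).
Proof.
move=> /is_trig_mxP tM /is_trig_mxP tN; apply/is_trig_mxP => i j ij.
by rewrite mxE tM // tN // addr0.
Qed.

Lemma trig_scalemx n c (M : 'M[R]_n) : is_trig_mx M -> is_trig_mx (c *: M).
Proof.
by move=> /is_trig_mxP tM; apply/is_trig_mxP => i j ij; rewrite mxE tM // mulr0.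
Qed.

Lemma trig_lower_ones n : is_trig_mx (lower_ones_mx R n).
Proof. by apply/is_trig_mxP => i j ij; rewrite mxE leqNgt ij. Qed.

Lemma trig_mulmx_diag n (M N : 'M[R]_n) i :
  is_trig_mx M -> is_trig_mx N -> (M *m N) i i = M i i * N i i.
Proof.
move=> /is_trig_mxP tM /is_trig_mxP tN.
rewrite mxE (bigD1 i) //= big1 ?addr0 // => k ki.
have [ik|] := ltnP i k; first by rewrite tM // mul0r.
by rewrite leq_eqVlt val_eqE (negbTE ki) /= => h; rewrite tN // mulr0.
Qed.

Lemma trig_unitmx_diag n (M : 'M[R]_n) i :
  is_trig_mx M -> M \in unitmx -> M i i != 0.
Proof.
move=> tM; rewrite unitmxE det_trig // unitfE; apply: contraNneq => h.
by apply/eqP; rewrite (bigD1 i) //= h mul0r.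
Qed.

Lemma trig_invmx n (M : 'M[R]_n) :
  is_trig_mx M -> M \in unitmx -> is_trig_mx (invmx M).
Proof.
move=> tM uM; apply/is_trig_mxP => i j.
(* row by row: the entries above the diagonal in column j are found by forward
   substitution, starting from zero right-hand sides *)
elim: {i}_.+1 {-2}i (ltnSn i) => // m ih i im ij.
have := mulmxV uM; move/matrixP => /(_ i j).
rewrite [X in X = _]mxE [in RHS]mxE -val_eqE /= (ltn_eqF ij).
rewrite (bigD1 i) //= big1 ?addr0 => [|k ki].
  by move/eqP; rewrite mulf_eq0 (negbTE (trig_unitmx_diag _ tM uM)) => /eqP.
have [ik|] := ltnP i k; first by rewrite (is_trig_mxP tM _ _ ik) mul0r.
rewrite leq_eqVlt val_eqE (negbTE ki) /= => h.
have km : (k < m)%N by rewrite -ltnS (leq_ltn_trans h).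
by rewrite ih ?mulr0 // (ltn_trans h).
Qed.

Definition trunc n k (v : 'cV[R]_n) : 'cV[R]_n :=
  \col_j (if (j < k)%N then v j 0 else 0).

(** A lower triangular matrix does not let the entries of index at least k act
    on the first k ones, so partial sums of a triangular quadratic form are
    again values of that form. *)
Lemma qform_trunc n k (M : 'M[R]_n) (v : 'cV[R]_n) : is_trig_mx M ->
  \sum_(j < n | (j < k)%N) v j 0 * (M *m v) j 0 = qform M (trunc k v).
Proof.
move=> /is_trig_mxP tM; rewrite qformE big_mkcond; apply: eq_bigr => i _ /=.
case: ifP => ik; last first.
  by rewrite big1 // => j _; rewrite mxE ik !mul0r.
rewrite mxE big_distrr; apply: eq_bigr => j _ /=; rewrite !mxE ik mulrA.
have [ij|ji] := ltnP i j; first by rewrite tM // !mulr0 !mul0r.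
by rewrite (leq_ltn_trans ji ik).
Qed.

Lemma qform_delta n (M : 'M[R]_n) i : qform M (delta_mx i 0) = M i i.
Proof.
by rewrite /qform trmx_delta -rowE -colE !mxE.
Qed.

End triangular.

Section tableau.
Variables (R : realType) (s : nat) (A Ahat : 'M[R]_s).
Hypotheses (s_gt0 : (0 < s)%N) (tA : is_trig_mx A) (tAhat : is_trig_mx Ahat)
  (uAhat : Ahat \in unitmx).

Local Notation EL := (lower_ones_mx R s).
Local Notation Q := (Q_mx A Ahat).
Local Notation H0 := (H0_mx Ahat).
Local Notation lamQ := (lambda_min (sym_part Q)).

Definition increments (w : nat -> R) : 'cV[R]_s := \col_j (w j.+1 - w j).
Local Notation dif := increments.

Definition K_mx : 'M[R]_s := invmx Ahat *m A *m EL.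
Local Notation K := K_mx.

Let tB : is_trig_mx (invmx Ahat). Proof. exact: trig_invmx. Qed.

Lemma trig_K : is_trig_mx K.
Proof. exact: (trig_mulmx (trig_mulmx tB tA) (trig_lower_ones R s)). Qed.

Lemma Q_mxE : Q = K - EL + 1%:M.
Proof. by rewrite /Q_mx mulmxBl mul1mx. Qed.

Lemma trig_Q : is_trig_mx Q.
Proof.
rewrite Q_mxE -scaleN1r; apply: trig_addmx; last exact: scalar_mx_is_trig.
by apply: trig_addmx; [exact: trig_K|apply: trig_scalemx; exact: trig_lower_ones].
Qed.

Lemma unitmx_lower_ones : EL \in unitmx.
Proof.
rewrite unitmxE det_trig ?trig_lower_ones // big1 ?unitr1 // => i _.
by rewrite mxE leqnn.
Qed.

Lemma unitmx_H0 : H0 \in unitmx.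
Proof. by rewrite unitmx_mul unitmx_inv uAhat unitmx_lower_ones. Qed.

Lemma trig_H0 : is_trig_mx H0.
Proof. by apply: trig_mulmx => //; exact: trig_lower_ones. Qed.

Lemma qform_lower_ones (v : 'cV[R]_s) :
  qform EL v = 2^-1 * (qform (ones_mx R s) v + qform 1%:M v).
Proof.
have e : EL + EL^T = ones_mx R s + 1%:M.
  apply/matrixP => i j; rewrite !mxE -val_eqE /=.
  by case: ltngtP => _; rewrite ?addr0 ?add0r.
by rewrite -qformD -e qformD qform_tr; field.
Qed.

Lemma qform_ones (v : 'cV[R]_s) : qform (ones_mx R s) v = (\sum_i v i 0) ^+ 2.
Proof.
rewrite qformE expr2 big_distrl; apply: eq_bigr => i _ /=.
by rewrite big_distrr; apply: eq_bigr => j _; rewrite mxE mulr1.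
Qed.

Lemma qform_H1 L beta v :
  qform (H1_mx A Ahat L beta) v = beta * qform Q v - L / 2 * qform 1%:M v.
Proof. by rewrite /H1_mx -scalemx1 -scaleNr qformD !qformZ mulNr. Qed.

(** The symmetric parts of the all-ones and of the lower triangular all-ones
    matrix combine, leaving only a multiple of Q and of the identity. *)
Lemma qform_H2 alpha v :
  qform (H2_mx A Ahat alpha) v = (1 + alpha) * qform Q v - 2^-1 * qform 1%:M v.
Proof.
have -> : H2_mx A Ahat alpha =
    (1 + alpha) *: Q + (EL + ((-1) *: 1%:M + (- 2^-1) *: ones_mx R s)).
  rewrite /H2_mx -/K -[K](addrNK EL) -[K - EL](addrK 1%:M) -Q_mxE.
  by rewrite !scaleNr scale1r scalerDl scale1r !addrA; apply/matrixP => i j; rewrite !mxE; ring.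
rewrite qformD [qform (EL + _) v]qformD [qform (_ *: _ + _) v]qformD !qformZ.
by rewrite qform_lower_ones; field.
Qed.

Lemma qform_H2K alpha v : qform (H2_mx A Ahat alpha) v =
  qform (K + alpha *: Q) v - 2^-1 * qform (ones_mx R s) v.
Proof.
have -> : H2_mx A Ahat alpha = (K + alpha *: Q) + (- 2^-1) *: ones_mx R s.
  by rewrite /H2_mx -/K scaleNr addrC addrA.
by rewrite qformD qformZ mulNr.
Qed.

Lemma sym_part_tr (M : 'M[R]_s) : (sym_part M)^T = sym_part M.
Proof. by rewrite /sym_part linearZ /= linearD /= trmxK addrC. Qed.

Section positivity.
Hypothesis Qpos : pos_def (sym_part Q).

Lemma lambda_Q_gt0 : 0 < lamQ.
Proof.
have [_ [v v0 e]] := lambda_min_attained s_gt0 (sym_part_tr Q).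
have := Qpos v0; rewrite -/(qform _ _) e pmulr_lgt0 //; exact: qform1_gt0.
Qed.

Lemma lambda_Q_le v : lamQ * qform 1%:M v <= qform Q v.
Proof.
have [h _] := lambda_min_attained s_gt0 (sym_part_tr Q).
by have := h v; rewrite qform_sym_part.
Qed.

Lemma H1_ge L beta v : 0 <= L -> L / (2 * lamQ) <= beta ->
  (beta * lamQ - L / 2) * qform 1%:M v <= qform (H1_mx A Ahat L beta) v.
Proof.
move=> L0 hb; rewrite qform_H1 mulrBl lerD2r -mulrA ler_wpM2l ?lambda_Q_le //.
by apply: le_trans hb; rewrite divr_ge0 // mulr_ge0 // ltW // lambda_Q_gt0.
Qed.

Lemma H2_ge alpha v : (2 * lamQ)^-1 - 1 <= alpha ->
  ((1 + alpha) * lamQ - 2^-1) * qform 1%:M v <= qform (H2_mx A Ahat alpha) v.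
Proof.
move=> hb; rewrite qform_H2 mulrBl lerD2r -mulrA ler_wpM2l ?lambda_Q_le //.
have : 0 <= (2 * lamQ)^-1 by rewrite invr_ge0 mulr_ge0 // ltW // lambda_Q_gt0.
lra.
Qed.

Lemma H1_coef_ge0 L beta : L / (2 * lamQ) <= beta -> 0 <= beta * lamQ - L / 2.
Proof.
have l0 := lambda_Q_gt0; rewrite ler_pdivrMr ?mulr_gt0 // => h; lra.
Qed.

Lemma H1_coef_gt0 L beta : L / (2 * lamQ) < beta -> 0 < beta * lamQ - L / 2.
Proof.
have l0 := lambda_Q_gt0; rewrite ltr_pdivrMr ?mulr_gt0 // => h; lra.
Qed.

Lemma H2_coef_ge0 alpha :
  (2 * lamQ)^-1 - 1 <= alpha -> 0 <= (1 + alpha) * lamQ - 2^-1.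
Proof.
have l0 := lambda_Q_gt0; rewrite lerBlDr -[_^-1]mul1r ler_pdivrMr ?mulr_gt0 //.
by move=> h; lra.
Qed.

Lemma H2_coef_gt0 alpha :
  (2 * lamQ)^-1 - 1 < alpha -> 0 < (1 + alpha) * lamQ - 2^-1.
Proof.
have l0 := lambda_Q_gt0; rewrite ltrBlDr -[_^-1]mul1r ltr_pdivrMr ?mulr_gt0 //.
by move=> h; lra.
Qed.

Lemma H1_semidef L beta v : 0 <= L -> L / (2 * lamQ) <= beta ->
  0 <= qform (H1_mx A Ahat L beta) v.
Proof.
move=> L0 hb; apply: le_trans (H1_ge v L0 hb); rewrite mulr_ge0 ?H1_coef_ge0 //.
by rewrite qform1 sumr_ge0 // => i _; exact: sqr_ge0.
Qed.

Lemma H2_semidef alpha v : (2 * lamQ)^-1 - 1 <= alpha ->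
  0 <= qform (H2_mx A Ahat alpha) v.
Proof.
move=> hb; apply: le_trans (H2_ge v hb); rewrite mulr_ge0 ?H2_coef_ge0 //.
by rewrite qform1 sumr_ge0 // => i _; exact: sqr_ge0.
Qed.

(** On the diagonal, lower triangular matrices multiply entrywise: the entries of
    H0 and Q are those of the inverse of Ahat and of Ahat^-1 A. *)
Lemma A_diag_gt0 i : pos_def (sym_part H0) -> 0 < A i i.
Proof.
move=> H0pos; have d0 : (delta_mx i 0 : 'cV[R]_s) != 0.
  apply/eqP => /matrixP /(_ i 0); rewrite !mxE !eqxx => /eqP.
  by rewrite oner_eq0.
have := H0pos _ d0; rewrite -/(qform _ _) qform_sym_part qform_delta.
rewrite trig_mulmx_diag ?trig_lower_ones // [X in _ * X]mxE leqnn mulr1 => B0.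
have := Qpos d0; rewrite -/(qform _ _) qform_sym_part qform_delta Q_mxE.
have -> : (K - EL + 1%:M) i i = K i i - EL i i + 1%:M i i.
  by move: K EL => X Y; rewrite !mxE.
rewrite /K_mx !trig_mulmx_diag ?trig_mulmx ?trig_lower_ones //.
have -> : EL i i = 1 by rewrite mxE leqnn.
by rewrite mulr1 [X in _ + X]mxE eqxx subrK pmulr_rgt0.
Qed.

End positivity.

(** The form of the inverse at v is the form of H0 at H0^-1 v. *)
Lemma qform_H0_inv_ge0 v : pos_def (sym_part H0) -> 0 <= qform (invmx H0) v.
Proof.
move=> H0pos; have [->|v0] := eqVneq v 0.
  by rewrite /qform mulmx0 mxE.
pose y := invmx H0 *m v.
have vE : v = H0 *m y by rewrite mulmxA mulmxV ?mul1mx // unitmx_H0.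
have y0 : y != 0 by apply: contra_neq v0 => y0; rewrite vE y0 mulmx0.
have -> : qform (invmx H0) v = qform H0 y.
  rewrite -[RHS]qform_tr {1}/qform -mulmxA -/y vE trmx_mul.
  by rewrite /qform.
by have := H0pos _ y0; rewrite -/(qform _ _) qform_sym_part => /ltW.
Qed.

Hypothesis row_sums : forall i, \sum_j A i j = \sum_j Ahat i j.

(** One step of the scheme, solved for the increments between successive
    stages. Equal row sums are what removes the contribution of the initial
    stage from the implicit part, except for the term with P. *)
Lemma scheme_increments (alpha beta tau : R) (y P W g : nat -> R) :
  (forall i : 'I_s, y i.+1 - y 0 = tau *
     (\sum_j A i j * ((1 + alpha) * P j.+1 + beta * W j.+1) +
      \sum_j Ahat i j * (g j - alpha * P j - beta * W j))) ->
  dif y = tau *: (invmx H0 *m (const_mx (P 0) + (K + alpha *: Q) *m dif P +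
                               beta *: (Q *m dif W) + \col_j g j)).
Proof.
move=> hy.
have tel (z : nat -> R) : \col_j z j.+1 = const_mx (z 0) + EL *m dif z.
  apply/matrixP => i j; rewrite !mxE.
  have -> : \sum_k EL i k * dif z k j = \sum_(k < i.+1) (z k.+1 - z k).
    rewrite (big_ord_widen s (fun k => z k.+1 - z k)) //.
    rewrite [RHS]big_mkcond; apply: eq_bigr => k _; rewrite !mxE ltnS.
    by case: leqP; rewrite ?mul1r ?mul0r.
  elim: {i}(nat_of_ord i) => [|m ih]; first by rewrite big_ord1; ring.
  by rewrite big_ord_recr /= addrA -ih; ring.
have tel0 (z : nat -> R) : (\col_j z j : 'cV[R]_s) = const_mx (z 0) + (EL - 1%:M) *m dif z.
  rewrite mulmxBl mul1mx addrA -tel; apply/matrixP => i j; rewrite !mxE; ring.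
have A1 c : invmx Ahat *m A *m const_mx c = const_mx c :> 'cV[R]_s.
  rewrite -mulmxA; apply: (can_inj (mulKmx uAhat)); rewrite mulKVmx //.
  apply/matrixP => i j; rewrite !mxE.
  under eq_bigr do rewrite mxE; under [RHS]eq_bigr do rewrite mxE.
  by rewrite -!big_distrl /= row_sums.
have e1 : EL *m dif y = tau *: (A *m (\col_j ((1 + alpha) * P j.+1 + beta * W j.+1)) +
   Ahat *m (\col_j (g j - alpha * P j - beta * W j))).
  have -> : EL *m dif y = \col_j (y j.+1 - y 0).
    transitivity (\col_j y j.+1 - const_mx (y 0) : 'cV[R]_s).
      by rewrite tel addrC addKr.
    by apply/matrixP => i j; rewrite !mxE.
  apply/matrixP => i j; rewrite !mxE hy; congr (_ * (_ + _));
    by apply: eq_bigr => k _; rewrite !mxE.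
apply: (can_inj (mulKmx unitmx_H0)).
rewrite -scalemxAr mulKVmx ?unitmx_H0 // {1}/H0_mx -mulmxA e1 -scalemxAr.
rewrite mulmxDr mulKmx // mulmxA; congr (_ *: _).
have -> : \col_j ((1 + alpha) * P j.+1 + beta * W j.+1) =
  (1 + alpha) *: \col_j P j.+1 + beta *: \col_j W j.+1 :> 'cV[R]_s.
  by apply/matrixP => i j; rewrite !mxE.
have -> : \col_j (g j - alpha * P j - beta * W j) =
  \col_j g j - alpha *: \col_j P j - beta *: \col_j W j :> 'cV[R]_s.
  by apply/matrixP => i j; rewrite !mxE.
rewrite (tel P) (tel W) (tel0 P) (tel0 W) !(mulmxDr, =^~ scalemxAr) !A1 !mulmxA -/K Q_mxE.
rewrite !(mulmxDl, mulNmx, mul1mx, =^~ scalemxAl).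
apply/matrixP => i j; rewrite !mxE; ring.
Qed.

Section pointwise_dissipation.
Variables (alpha beta L a : R) (F f : R -> R).
Hypotheses (FL : forall x y, F y - F x <= f x * (y - x) + L / 2 * (y - x) ^+ 2)
  (H1_ge0 : forall v, 0 <= qform (H1_mx A Ahat L beta) v)
  (H2_ge0 : forall v, 0 <= qform (H2_mx A Ahat alpha) v)
  (a_ge0 : 0 <= a).

(** Here y are the values of the stages at a point and z those of their images
    under I + Delta. The quadratic Taylor terms of F are absorbed by H1, and the
    square of the total increment, from the quadratic part of the energy, by H2;
    what remains is the pairing of the increments with the discrete chemical
    potentials, written after integration by parts. *)
Lemma energy_density_increment k (y z : nat -> R) : (k <= s)%N ->
  F (y k) + 2^-1 * (z k ^+ 2 + a * y k ^+ 2) -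
    (F (y 0) + 2^-1 * (z 0 ^+ 2 + a * y 0 ^+ 2)) <=
  \sum_(j < s | (j < k)%N)
    ((y j.+1 - y j) * f (y j) + beta * ((y j.+1 - y j) * (Q *m dif y) j 0) +
     ((z j.+1 - z j) * z 0 + a * ((y j.+1 - y j) * y 0)) +
     ((z j.+1 - z j) * ((K + alpha *: Q) *m dif z) j 0 +
      a * ((y j.+1 - y j) * ((K + alpha *: Q) *m dif y) j 0))).
Proof.
move=> ks.
have tel (w : nat -> R) : \sum_(j < s | (j < k)%N) (w j.+1 - w j) = w k - w 0.
  rewrite -(big_ord_widen s (fun j => w j.+1 - w j)) //.
  rewrite -(big_mkord xpredT (fun j => w j.+1 - w j)) telescope_sumr //.
have tKQ : is_trig_mx (K + alpha *: Q).
  by apply: trig_addmx; [exact: trig_K|apply: trig_scalemx; exact: trig_Q].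
have difE w (j : 'I_s) : w j.+1 - w j = dif w j 0 by rewrite mxE.
have step1 : F (y k) - F (y 0) <= \sum_(j < s | (j < k)%N)
    ((y j.+1 - y j) * f (y j) + L / 2 * (y j.+1 - y j) ^+ 2).
  rewrite -(tel (F \o y)); apply: ler_sum => j _ /=.
  by rewrite (mulrC _ (f _)); exact: FL.
have sq : \sum_(j < s | (j < k)%N) (y j.+1 - y j) ^+ 2 = qform 1%:M (trunc k (dif y)).
  rewrite -qform_trunc ?scalar_mx_is_trig //; apply: eq_bigr => j _.
  by rewrite mul1mx difE.
have Qy : \sum_(j < s | (j < k)%N) (y j.+1 - y j) * (Q *m dif y) j 0 =
    qform Q (trunc k (dif y)).
  by rewrite -qform_trunc ?trig_Q //; apply: eq_bigr => j _; rewrite difE.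
have KQ w : \sum_(j < s | (j < k)%N) (w j.+1 - w j) * ((K + alpha *: Q) *m dif w) j 0 =
    qform (K + alpha *: Q) (trunc k (dif w)).
  by rewrite -qform_trunc //; apply: eq_bigr => j _; rewrite difE.
have H1y := H1_ge0 (trunc k (dif y)); rewrite qform_H1 in H1y.
have S w : \sum_j trunc k (dif w) j 0 = w k - w 0.
  rewrite -tel [RHS]big_mkcond; apply: eq_bigr => j _.
  by rewrite !mxE.
have H2w w : 2^-1 * (w k - w 0) ^+ 2 <= qform (K + alpha *: Q) (trunc k (dif w)).
  have := H2_ge0 (trunc k (dif w)).
  rewrite qform_H2K qform_ones S; lra.
rewrite !big_split /= -!mulr_sumr !KQ Qy -!mulr_suml !tel.
rewrite big_split /= -mulr_sumr sq in step1.
have := H2w z; have := ler_wpM2l a_ge0 (H2w y).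
set qz := qform _ (trunc k (dif z)); set qy := qform (K + _) (trunc k (dif y)).
move=> h1 h2.
have -> : F (y k) + 2^-1 * (z k ^+ 2 + a * y k ^+ 2) -
    (F (y 0) + 2^-1 * (z 0 ^+ 2 + a * y 0 ^+ 2)) = (F (y k) - F (y 0)) +
    ((z k - z 0) * z 0 + a * ((y k - y 0) * y 0)) +
    (2^-1 * (z k - z 0) ^+ 2 + a * (2^-1 * (y k - y 0) ^+ 2)) by field.
lra.
Qed.

End pointwise_dissipation.
End tableau.

(** * The truncated nonlinearity and its potential *)

Section truncated_potential.
Variables (R : realType) (eps a M : R).
Hypothesis M_gt0 : 0 < M.

Local Notation k := (3 * M ^+ 2 - (eps + a)).

(** Subtracting this function from the parabola of curvature k, the maximal slope
    of the truncated nonlinearity, yields the truncated potential. It is affine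
    beyond M, and its convexity is a matter of tangent lines. *)
Definition trunc_convex_part (y : R) : R :=
  if M < y then 2 * M ^+ 3 * y - 3 / 4 * M ^+ 4
  else if y < - M then - 2 * M ^+ 3 * y - 3 / 4 * M ^+ 4
  else 3 / 2 * M ^+ 2 * y ^+ 2 - y ^+ 4 / 4.

Definition trunc_convex_slope (y : R) : R :=
  if M < y then 2 * M ^+ 3
  else if y < - M then - 2 * M ^+ 3
  else 3 * M ^+ 2 * y - y ^+ 3.

Definition F_trunc (y : R) : R := k / 2 * y ^+ 2 - trunc_convex_part y.

Variant trunc_spec (y : R) : bool -> bool -> Type :=
| TruncHigh of M < y : trunc_spec y true false
| TruncLow of y < - M : trunc_spec y false true
| TruncMid of - M <= y & y <= M : trunc_spec y false false.

Lemma truncP y : trunc_spec y (M < y) (y < - M).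
Proof.
case: (ltP M y) => h1; case: (ltP y (- M)) => h2; try by constructor.
by exfalso; move: M_gt0; lra.
Qed.

Lemma f_truncE y : f_trunc eps a M y = k * y - trunc_convex_slope y.
Proof.
by rewrite /f_trunc /trunc_convex_slope; case: (truncP y) => *; ring.
Qed.

Lemma trunc_convex_tangent x y : trunc_convex_part x +
  trunc_convex_slope x * (y - x) <= trunc_convex_part y.
Proof.
have mid x' y' : - M <= x' -> x' <= M -> - M <= y' -> y' <= M ->
   3 / 2 * M ^+ 2 * x' ^+ 2 - x' ^+ 4 / 4 + (3 * M ^+ 2 * x' - x' ^+ 3) * (y' - x') <=
   3 / 2 * M ^+ 2 * y' ^+ 2 - y' ^+ 4 / 4.
  move=> x1 x2 y1 y2; rewrite -subr_ge0.
  suff : 0 <= (y' - x') ^+ 2 * (6 * M ^+ 2 - (y' + x') ^+ 2 - 2 * x' ^+ 2) by lra.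
  apply: mulr_ge0; first exact: sqr_ge0.
  by nra.
have slope x' : - M <= x' -> x' <= M ->
    - 2 * M ^+ 3 <= 3 * M ^+ 2 * x' - x' ^+ 3 <= 2 * M ^+ 3.
  move=> x1 x2; apply/andP; split; rewrite -subr_ge0.
    suff : 0 <= (M + x') ^+ 2 * (2 * M - x') by lra.
    by apply: mulr_ge0; [exact: sqr_ge0|lra].
  suff : 0 <= (M - x') ^+ 2 * (2 * M + x') by lra.
  by apply: mulr_ge0; [exact: sqr_ge0|lra].
have M3 : 0 < M ^+ 3 by rewrite exprn_gt0.
rewrite /trunc_convex_part /trunc_convex_slope.
have MM : - M <= M by move: M_gt0; lra.
have M0 := M_gt0.
case: (truncP x) => x1; case: (truncP y) => y1.
- by lra.
- have : 0 <= M ^+ 3 * - y by apply: mulr_ge0; lra.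
  by lra.
- by move=> y2; have := mid _ _ MM (lexx M) y1 y2; lra.
- have : 0 <= M ^+ 3 * y by apply: mulr_ge0; lra.
  by lra.
- by lra.
- by move=> y2; have := mid _ _ (lexx (- M)) MM y1 y2; lra.
- move=> x2; have /andP[s1 s2] := slope _ x1 x2.
  have := mid _ _ x1 x2 MM (lexx M).
  have : 0 <= (2 * M ^+ 3 - (3 * M ^+ 2 * x - x ^+ 3)) * (y - M).
    by apply: mulr_ge0; lra.
  by lra.
- move=> x2; have /andP[s1 s2] := slope _ x1 x2.
  have := mid _ _ x1 x2 (lexx (- M)) MM.
  have : 0 <= (3 * M ^+ 2 * x - x ^+ 3 - - 2 * M ^+ 3) * (- M - y).
    by apply: mulr_ge0; lra.
  by lra.
- by move=> x2 y2; apply: mid.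
Qed.

(** The parabola contributes its exact second-order term, with k <= L, and the
    convex part, which enters with a minus sign, only helps. *)
Lemma F_trunc_taylor L x y : k <= L ->
  F_trunc y - F_trunc x <= f_trunc eps a M x * (y - x) + L / 2 * (y - x) ^+ 2.
Proof.
move=> kL; have := trunc_convex_tangent x y.
have : (k - L) * (y - x) ^+ 2 <= 0 by rewrite mulr_le0_ge0 ?sqr_ge0 // subr_le0.
rewrite f_truncE /F_trunc; lra.
Qed.

Lemma f_trunc_lipschitz_ge L :
  (forall x y, `|f_trunc eps a M x - f_trunc eps a M y| <= L * `|x - y|) -> k <= L.
Proof.
move=> /(_ (M + 1) M); have M0 := M_gt0.
rewrite [M + 1]addrC addrK normr1 mulr1 => h; apply: le_trans h.
apply: le_trans (ler_norm _); rewrite /f_trunc.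
have -> : M < 1 + M by lra.
have -> : (M < M) = false by rewrite ltxx.
have -> : (M < - M) = false by lra.
lra.
Qed.

Lemma f_trunc_id y : `|y| <= M -> f_trunc eps a M y = f_pfc eps a y.
Proof.
by rewrite ler_norml => /andP[y1 y2]; rewrite /f_trunc !ltNge y1 y2.
Qed.

Lemma F_trunc_id y : `|y| <= M ->
  F_trunc y = 4^-1 * y ^+ 4 - (eps + a) / 2 * y ^+ 2.
Proof.
rewrite ler_norml => /andP[y1 y2].
by rewrite /F_trunc /trunc_convex_part !ltNge y1 y2 /=; field.
Qed.

Lemma F_trunc_le y : F_trunc y <= 4^-1 * y ^+ 4 - (eps + a) / 2 * y ^+ 2.
Proof.
have M0 := M_gt0.
rewrite /F_trunc /trunc_convex_part; case: truncP => y1.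
- rewrite -subr_ge0.
  suff : 0 <= (y - M) ^+ 3 * (y - M + 4 * M) by lra.
  by apply: mulr_ge0; [apply: exprn_ge0|]; lra.
- rewrite -subr_ge0.
  suff : 0 <= (- M - y) ^+ 3 * (- M - y + 4 * M) by lra.
  by apply: mulr_ge0; [apply: exprn_ge0|]; lra.
- by move=> _; lra.
Qed.

(** Inside [-M, M] this is the identity
    y^4/4 - y^2 + 1 = (y^2/2 - 1)^2; beyond M the truncated potential is still
    convex enough once M^2 >= 2. *)
Lemma F_trunc_coercive y : 2 <= M ^+ 2 -> eps <= 1 ->
  2^-1 * y ^+ 2 <= F_trunc y + a / 2 * y ^+ 2 + 1.
Proof.
move=> M2 e1.
have ey : (eps - 1) * y ^+ 2 <= 0 by rewrite mulr_le0_ge0 ?sqr_ge0 // subr_le0.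
have high z : 0 <= z -> 0 <= 3 / 2 * M ^+ 2 * (z + M) ^+ 2 - 2 * M ^+ 3 * (z + M) +
    3 / 4 * M ^+ 4 - (z + M) ^+ 2 + 1.
  move=> z0.
  have : 0 <= (M ^+ 2 / 2 - 1) ^+ 2 by exact: sqr_ge0.
  have : 0 <= z * M * (M ^+ 2 - 2).
    by apply: mulr_ge0; [apply: mulr_ge0 => //; exact: ltW|lra].
  have : 0 <= z ^+ 2 * (3 / 2 * M ^+ 2 - 1).
    by apply: mulr_ge0; [exact: sqr_ge0|lra].
  by lra.
have M0 := M_gt0.
rewrite /F_trunc /trunc_convex_part; case: truncP => y1.
- by have := high (y - M); rewrite subrK; lra.
- by have := high (- y - M); rewrite subrK; lra.
- by move=> _; have : 0 <= (y ^+ 2 / 2 - 1) ^+ 2 := sqr_ge0 _; lra.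
Qed.

Definition f_trunc_slope (y : R) : R :=
  if M < y then k else if y < - M then k else 3 * y ^+ 2 - (eps + a).

(** At M and - M only the second derivative jumps, so the remainder is quadratic
    there as well: the truncated nonlinearity is continuously differentiable. *)
Lemma f_trunc_remainder x y :
  `|f_trunc eps a M y - f_trunc eps a M x - f_trunc_slope x * (y - x)| <=
  9 * M * (y - x) ^+ 2.
Proof.
rewrite ler_norml !f_truncE /f_trunc_slope /trunc_convex_slope.
have M0 := M_gt0.
have sq : 0 <= M * (y - x) ^+ 2 by rewrite mulr_ge0 ?sqr_ge0 // ltW.
have pr (p q r : R) : 0 <= p -> 0 <= q -> 0 <= r -> 0 <= p * q * r.
  by move=> *; rewrite !mulr_ge0.
case: (truncP x) => x1; case: (truncP y) => y1.
- by apply/andP; split; lra.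
- have : 0 <= M * (x - y - 2 * M) * (x - y + 2 * M) by apply: pr; lra.
  have M3 : 0 < M ^+ 3 by rewrite exprn_gt0.
  by move=> ?; apply/andP; split; lra.
- move=> y2.
  have : 0 <= (M - y) * (M - y) * (2 * M + y) by apply: pr; lra.
  have : 0 <= (M - y) * (M - y) * (M - y) by apply: pr; lra.
  have : 0 <= M * (x - M) * (x - y + (M - y)) by apply: pr; lra.
  by move=> *; apply/andP; split; lra.
- have : 0 <= M * (y - x - 2 * M) * (y - x + 2 * M) by apply: pr; lra.
  have M3 : 0 < M ^+ 3 by rewrite exprn_gt0.
  by move=> ?; apply/andP; split; lra.
- by apply/andP; split; lra.
- move=> y2.
  have : 0 <= (M + y) * (M + y) * (2 * M - y) by apply: pr; lra.
  have : 0 <= (M + y) * (M + y) * (M + y) by apply: pr; lra.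
  have : 0 <= M * (- M - x) * (y - x + (M + y)) by apply: pr; lra.
  by move=> *; apply/andP; split; lra.
- move=> x2.
  have : 0 <= (M - x) * (M - x) * (2 * M + x) by apply: pr; lra.
  have : 0 <= (M - x) * (M - x) * (M - x) by apply: pr; lra.
  have : 0 <= M * (y - M) * (y - x + (M - x)) by apply: pr; lra.
  have : 0 <= (M - x) * (M + x) * (y - x) by apply: pr; lra.
  have : 0 <= (M - x) * (M - x) * (y - x) by apply: pr; lra.
  have : 0 <= M * (y - M) * (y - x) by apply: pr; lra.
  by move=> *; apply/andP; split; lra.
- move=> x2.
  have : 0 <= (M + x) * (M + x) * (2 * M - x) by apply: pr; lra.
  have : 0 <= (M + x) * (M + x) * (M + x) by apply: pr; lra.
  have : 0 <= M * (- M - y) * (x - y + (M + x)) by apply: pr; lra.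
  have : 0 <= (M - x) * (M + x) * (x - y) by apply: pr; lra.
  have : 0 <= (M + x) * (M + x) * (x - y) by apply: pr; lra.
  have : 0 <= M * (- M - y) * (x - y) by apply: pr; lra.
  by move=> *; apply/andP; split; lra.
- move=> x2 y2.
  have : 0 <= (y - x) ^+ 2 * (3 * M - (y + 2 * x)).
    by apply: mulr_ge0; [exact: sqr_ge0|lra].
  have : 0 <= (y - x) ^+ 2 * (3 * M + (y + 2 * x)).
    by apply: mulr_ge0; [exact: sqr_ge0|lra].
  by move=> *; apply/andP; split; lra.
Qed.

Definition clamp (y : R) : R := Num.max (- M) (Num.min M y).

Lemma continuous_clamp : continuous clamp.
Proof.
move=> y; apply: (@continuous_max R R (fun=> - M) (Num.min M)).
  exact: cvg_cst.
by apply: (@continuous_min R R (fun=> M) id); [exact: cvg_cst|exact: cvg_id].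
Qed.

Variant clamp_spec (y : R) : R -> bool -> bool -> Type :=
| ClampHigh of M < y : clamp_spec y M true false
| ClampLow of y < - M : clamp_spec y (- M) false true
| ClampMid of - M <= y & y <= M : clamp_spec y y false false.

Lemma clampP y : clamp_spec y (clamp y) (M < y) (y < - M).
Proof.
have M0 := M_gt0; have MM : - M < M by lra.
rewrite /clamp /Num.max /Num.min; case: (truncP y) => y1.
- by rewrite MM; constructor.
- by have -> : (- M < y) = false by [lra]; constructor.
- move=> y2; case: (ltP (- M) y) => // y3; first by constructor.
  by have -> : y = - M by [lra]; constructor => //; lra.
Qed.

Lemma continuous_f_trunc_slope : continuous f_trunc_slope.
Proof.
have -> : f_trunc_slope = fun y => 3 * (clamp y * clamp y) - (eps + a).
  by apply/funext => y; rewrite /f_trunc_slope; case: clampP => *; ring.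
apply: continuous_sub; last exact: cst_continuous.
apply: continuous_mul; first exact: cst_continuous.
exact: (continuous_mul continuous_clamp continuous_clamp).
Qed.

Lemma continuous_F_trunc : continuous F_trunc.
Proof.
have -> : F_trunc = fun y => k / 2 * (y * y) -
    (3 / 2 * M ^+ 2 * (clamp y * clamp y) -
      4^-1 * (clamp y * clamp y) * (clamp y * clamp y) +
     (3 * M ^+ 2 * clamp y - clamp y * (clamp y * clamp y)) * (y - clamp y)).
  apply/funext => y; rewrite /F_trunc /trunc_convex_part.
  by case: clampP => *; field.
have cc := continuous_clamp; have c2 := continuous_mul cc cc.
have ci : continuous (fun y : R => y) by move=> y; exact: cvg_id.
have cs c := @cst_continuous R R c.
apply: continuous_sub; first exact: (continuous_mul (cs _) (continuous_mul ci ci)).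
apply: continuous_add.
  apply: continuous_sub; first exact: (continuous_mul (cs _) c2).
  exact: (continuous_mul (continuous_mul (cs _) c2) c2).
apply: continuous_mul; last exact: (continuous_sub ci cc).
apply: continuous_sub; first exact: (continuous_mul (cs _) cc).
exact: (continuous_mul cc c2).
Qed.

End truncated_potential.

Lemma is_derive_remainder (R : realType) (g : R -> R) (x l K : R) :
  (forall y, `|g y - g x - l * (y - x)| <= K * (y - x) ^+ 2) ->
  is_derive x 1 g l.
Proof.
move=> hK; have K0 : 0 <= K.
  have := hK (x + 1); rewrite [x + 1]addrC addrK expr1n !mulr1.
  by apply: le_trans; exact: normr_ge0.
suff h : h^-1 *: (g (h *: 1 + x) - g x) @[h --> 0^'] --> l.
  apply: DeriveDef; first by apply/cvg_ex; exists l.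
  exact/cvg_lim.
have K1 : 0 < K + 1 by lra.
apply/cvgrPdist_le => e e0; near=> t.
have t0 : t != 0 by near: t; exact: nbhs_dnbhs_neq.
rewrite -[t^-1 *: _]/(t^-1 * _) -[t *: 1]/(t * 1) mulr1.
have -> : l - t^-1 * (g (t + x) - g x) = - t^-1 * (g (t + x) - g x - l * t).
  by field.
rewrite normrM normrN normfV ler_pdivrMl ?normr_gt0 //.
have := hK (t + x); rewrite addrK => /le_trans; apply.
rewrite -real_normK ?num_real // expr2 mulrCA ler_wpM2l //.
suff : `|t| * (K + 1) <= e by have := normr_ge0 t; lra.
rewrite -ler_pdivlMr //; near: t; apply: dnbhs0_le; exact: divr_gt0.
Unshelve. all: by end_near. Qed.

Lemma is_derive_f_trunc (R : realType) (eps a M y : R) : 0 < M ->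
  is_derive y 1 (f_trunc eps a M) (f_trunc_slope eps a M y).
Proof.
by move=> M0; apply: (@is_derive_remainder _ _ _ _ (9 * M)) => z;
  exact: f_trunc_remainder.
Qed.

Lemma is_derive_f_pfc (R : realType) (eps a y : R) :
  is_derive y 1 (f_pfc eps a) (3 * y ^+ 2 - (eps + a)).
Proof.
have h : is_derive y 1 ((id ^+ 3 : R -> R) - (eps + a) \*: (id : R -> R))
    (3 * y ^+ 2 - (eps + a)).
  apply: is_derive_eq; rewrite /GRing.scale /= !mulr1; ring.
have -> : f_pfc eps a = (id ^+ 3 : R -> R) - (eps + a) \*: (id : R -> R).
  by apply/funext => z; rewrite /f_pfc.
exact: h.
Qed.

Lemma continuous_quartic (R : realType) (c1 c2 : R) :
  continuous (fun y : R => c1 * y ^+ 4 - c2 * y ^+ 2).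
Proof.
have cX n : continuous (fun y : R => y ^+ n) by exact: exprn_continuous.
have cs c := @cst_continuous R R c.
exact: (continuous_sub (continuous_mul (cs _) (cX 4)) (continuous_mul (cs _) (cX 2))).
Qed.

Lemma continuous_f_pfc_slope (R : realType) (c : R) :
  continuous (fun y : R => 3 * y ^+ 2 - c).
Proof.
have cX : continuous (fun y : R => y ^+ 2) by exact: exprn_continuous.
have cs e := @cst_continuous R R e.
exact: (continuous_sub (continuous_mul (cs _) cX) (cs _)).
Qed.

(** * Differential calculus on the space *)

Section directional_derivatives.
Variables (R : realType) (d : nat).
Local Notation V := 'rV[R]_d.
Implicit Types (u v w : V -> R) (x : V).

Lemma difference_quotient_line u (e : V) x r :
  (fun h : R => h^-1 *: (u ((h *: 1 + r) *: e + x) - u (r *: e + x))) =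
  (fun h : R => h^-1 *: (u (h *: e + (r *: e + x)) - u (r *: e + x))).
Proof.
by apply/funext => h; rewrite scalerDl addrA -[h *: 1]/(h * 1) mulr1.
Qed.

Lemma is_derive_line u (e : V) x r l : is_derive (r *: e + x) e u l <->
  is_derive r 1 (fun h => u (h *: e + x)) l.
Proof.
by split => -[h1 h2]; split; move: h1 h2; rewrite /derivable /derive /=
  difference_quotient_line.
Qed.

(** A directional derivative is an ordinary one along a line, which reduces this
    chain rule to the one in one variable. *)
Lemma is_derive_comp_scalar (g : R -> R) u (e x : V) a b :
  is_derive (u x) 1 g a -> is_derive x e u b -> is_derive x e (g \o u) (a * b).
Proof.
move=> dg du; have e0 : x = 0 *: e + x by rewrite scale0r add0r.
rewrite e0; apply/is_derive_line; rewrite e0 in du.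
move/is_derive_line in du.
by apply: (@is_derive1_comp R g (fun h => u (h *: e + x)));
  rewrite /= scale0r add0r.
Qed.

Lemma Ck_continuous k u : Ck k u -> continuous u.
Proof. by case: k => [|k] []. Qed.

Lemma Ck_derivable k u i x : Ck k.+1 u -> derivable u x (basis_vec R i).
Proof. by case=> _ /(_ i) []. Qed.

Lemma Ck_is_derive k u i x : Ck k.+1 u ->
  is_derive x (basis_vec R i) u (partial i u x).
Proof. by move=> cu; split; [exact: Ck_derivable cu|]. Qed.

Lemma Ck_partial k u i : Ck k.+1 u -> Ck k (partial i u).
Proof. by case=> _ /(_ i) []. Qed.

Lemma CkW k u : Ck k.+1 u -> Ck k u.
Proof.
elim: k u => [|k ih] u cu; first by split => //; exact: Ck_continuous cu.
split; first exact: Ck_continuous cu.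
by move=> i; split=> [x|]; [exact: Ck_derivable cu|exact/ih/Ck_partial].
Qed.

Lemma Ck_le k m u : (k <= m)%N -> Ck m u -> Ck k u.
Proof.
elim: m => [|m ih]; first by rewrite leqn0 => /eqP ->.
by rewrite leq_eqVlt => /predU1P[-> //|]; rewrite ltnS => /ih h /CkW.
Qed.

Lemma partialD i u v x : Ck 1 u -> Ck 1 v ->
  partial i (fun y => u y + v y) x = partial i u x + partial i v x.
Proof. by move=> cu cv; apply: deriveD; apply: Ck_derivable; eassumption. Qed.

Lemma partialZ i c u x : Ck 1 u ->
  partial i (fun y => c * u y) x = c * partial i u x.
Proof. by move=> cu; apply: deriveZ; apply: Ck_derivable; eassumption. Qed.

Lemma partialM i u v x : Ck 1 u -> Ck 1 v ->
  partial i (fun y => u y * v y) x = u x * partial i v x + v x * partial i u x.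
Proof. by move=> cu cv; apply: deriveM; apply: Ck_derivable; eassumption. Qed.

Lemma partial_cst i c : partial i (fun _ : V => c) = fun=> 0 :> R.
Proof. by apply/funext => x; apply: derive_cst. Qed.

Lemma CkD k u v : Ck k u -> Ck k v -> Ck k (fun x => u x + v x).
Proof.
elim: k u v => [|k ih] u v cu cv; (split;
    first by apply: continuous_add; apply: Ck_continuous; eassumption) => //.
move=> i; split=> [x|].
  by apply: derivableD; [exact: Ck_derivable cu|exact: Ck_derivable cv].
have -> : partial i (fun x => u x + v x) = fun x => partial i u x + partial i v x.
  by apply/funext => x; apply: partialD; [apply: Ck_le cu|apply: Ck_le cv].
by apply: ih; exact: Ck_partial.
Qed.

Lemma CkZ k c u : Ck k u -> Ck k (fun x => c * u x).
Proof.
elim: k u => [|k ih] u cu; (split;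
    first by apply: continuous_mul; [exact: cst_continuous|exact: Ck_continuous cu]) => //.
move=> i; split=> [x|].
  by apply: derivableZ; exact: Ck_derivable cu.
have -> : partial i (fun x => c * u x) = fun x => c * partial i u x.
  by apply/funext => x; apply: partialZ; apply: Ck_le cu.
by apply: ih; exact: Ck_partial.
Qed.

Lemma Ck1M u v : Ck 1 u -> Ck 1 v -> Ck 1 (fun x => u x * v x).
Proof.
move=> cu cv; have c0u := Ck_continuous cu; have c0v := Ck_continuous cv.
split; first exact: continuous_mul.
move=> i; split=> [x|].
  by apply: derivableM; [exact: Ck_derivable cu|exact: Ck_derivable cv].
have -> : partial i (fun x => u x * v x) =
    fun x => u x * partial i v x + v x * partial i u x.
  by apply/funext => x; apply: partialM.
have dc w : Ck 1 w -> continuous (partial i w).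
  by move=> cw; apply: (@Ck_continuous 0); exact: Ck_partial.
by split => //; apply: continuous_add; apply: continuous_mul => //; exact: dc.
Qed.

Lemma Ck_cst k c : Ck k (fun _ : V => c).
Proof.
elim: k c => [|k ih] c; (split; first exact: cst_continuous) => //.
by move=> i; split=> [x|]; [exact: derivable_cst|rewrite partial_cst].
Qed.

Lemma Ck_sum k (I : Type) (r : seq I) (P : pred I) (F : I -> V -> R) :
  (forall i, Ck k (F i)) -> Ck k (fun x => \sum_(i <- r | P i) F i x).
Proof.
move=> cF; elim: r => [|i r ih].
  by under eq_fun do rewrite big_nil; exact: Ck_cst.
under eq_fun do rewrite big_cons.
by case: (P i) => //; apply: CkD.
Qed.

Lemma Ck_lap k u : Ck k.+2 u -> Ck k (lap u).
Proof. by move=> cu; apply: Ck_sum => i; apply/Ck_partial/Ck_partial. Qed.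

Lemma lapD u v x : Ck 2 u -> Ck 2 v ->
  lap (fun y => u y + v y) x = lap u x + lap v x.
Proof.
move=> cu cv; rewrite -big_split; apply: eq_bigr => i _ /=.
have -> : partial i (fun x => u x + v x) = fun x => partial i u x + partial i v x.
  by apply/funext => y; apply: partialD; exact: CkW.
by rewrite partialD //; exact: Ck_partial.
Qed.

Lemma lapZ c u x : Ck 2 u -> lap (fun y => c * u y) x = c * lap u x.
Proof.
move=> cu; rewrite /lap big_distrr; apply: eq_bigr => i _ /=.
have -> : partial i (fun x => c * u x) = fun x => c * partial i u x.
  by apply/funext => y; apply: partialZ; exact: CkW.
by rewrite partialZ //; exact: Ck_partial.
Qed.

Lemma lap_sum (I : Type) (r : seq I) (F : I -> V -> R) x :
  (forall i, Ck 2 (F i)) ->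
  lap (fun y => \sum_(i <- r) F i y) x = \sum_(i <- r) lap (F i) x.
Proof.
move=> cF; elim: r => [|i r ih].
  under eq_fun do rewrite big_nil.
  by rewrite big_nil /lap big1 // => i _; rewrite !partial_cst.
under eq_fun do rewrite big_cons.
by rewrite big_cons lapD ?ih //; exact: Ck_sum.
Qed.

Lemma Ck_shift k u : Ck k.+2 u -> Ck k (shift u).
Proof. by move=> cu; apply: CkD; [exact/CkW/CkW|exact: Ck_lap]. Qed.

Lemma Ck_Pa a k u : Ck k.+4 u -> Ck k (Pa a u).
Proof.
move=> cu; apply: CkD; first exact/Ck_shift/Ck_shift.
by apply: CkZ; apply: Ck_le cu; rewrite !(leqW, leqnn).
Qed.

Section locality.
Variable Omega : set V.
Hypothesis Omega_open : open Omega.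

Definition eq_on u v := forall x, Omega x -> u x = v x.

Lemma eq_on_partial i u v : eq_on u v -> eq_on (partial i u) (partial i v).
Proof.
move=> uv x Ox; apply: near_eq_derive.
by move: (open_nbhs_nbhs (conj Omega_open Ox)); apply: filterS.
Qed.

Lemma eq_on_lap u v : eq_on u v -> eq_on (lap u) (lap v).
Proof.
move=> uv x Ox; apply: eq_bigr => i _.
by apply: eq_on_partial Ox; apply: eq_on_partial.
Qed.

Lemma eq_on_shift u v : eq_on u v -> eq_on (shift u) (shift v).
Proof.
by move=> uv x Ox; exact: (congr2 (fun p q => p + q) (uv x Ox) (eq_on_lap uv Ox)).
Qed.

Lemma eq_on_Pa a u v : eq_on u v -> eq_on (Pa a u) (Pa a v).
Proof.
move=> uv x Ox; have h := eq_on_shift (eq_on_shift uv) Ox.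
exact: (congr2 (fun p q => p + a * q) h (uv x Ox)).
Qed.

Lemma eq_on_closure u v : continuous u -> continuous v -> eq_on u v ->
  forall x, closure Omega x -> u x = v x.
Proof.
move=> cu cv uv x; pose D := [set y | u y - v y = 0].
have cD : closed D.
  apply: (@closed_comp _ _ (fun y => u y - v y) [set 0]); last exact: closed_eq.
  by move=> y _; exact: (continuous_sub cu cv).
have OD : Omega `<=` D by move=> y Oy; rewrite /D /= uv // subrr.
move=> /(closure_subset OD); rewrite -(closure_id _).1 // => /eqP.
by rewrite subr_eq0 => /eqP.
Qed.

Lemma eq_on_partial_closure i u v : Ck 1 u -> Ck 1 v -> eq_on u v ->
  forall x, closure Omega x -> partial i u x = partial i v x.
Proof.
move=> cu cv uv; apply: eq_on_closure; last exact: eq_on_partial.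
  by apply: (@Ck_continuous 0); exact: Ck_partial.
by apply: (@Ck_continuous 0); exact: Ck_partial.
Qed.

(** A C^1 function which coincides on Omega with a composition obeys the chain
    rule up to the boundary, although the inner function may only be known
    there through its extension. *)
Lemma chain_rule_closure (g g' : R -> R) u v i :
  (forall y : R, is_derive y 1 g (g' y)) -> continuous g' ->
  Ck 1 u -> Ck 1 v -> eq_on v (g \o u) ->
  forall x, closure Omega x -> partial i v x = g' (u x) * partial i u x.
Proof.
move=> dg cg' cu cv vgu.
apply: eq_on_closure.
- by apply: (@Ck_continuous 0); exact: Ck_partial.
- apply: continuous_mul; last by apply: (@Ck_continuous 0); exact: Ck_partial.
  have cu0 := Ck_continuous cu.
  by move=> x; apply: (@continuous_comp _ _ _ u g'); [exact: cu0|exact: cg'].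
- move=> x Ox; rewrite (eq_on_partial i vgu Ox).
  have [_ <-] := is_derive_comp_scalar (dg (u x)) (Ck_is_derive i x cu).
  by [].
Qed.

End locality.

Lemma partial_translate (h : V) i u x : (forall y, u (y + h) = u y) ->
  partial i u (x + h) = partial i u x.
Proof.
move=> uh; rewrite /partial /derive /=; set e := basis_vec R i.
suff -> : (fun r : R => r^-1 *: (u (r *: e + (x + h)) - u (x + h))) =
          (fun r : R => r^-1 *: (u (r *: e + x) - u x)) by [].
by apply/funext => r; rewrite addrA !uh.
Qed.

Lemma lap_translate (h : V) u x : (forall y, u (y + h) = u y) ->
  lap u (x + h) = lap u x.
Proof.
move=> uh; apply: eq_bigr => i _.
by apply: partial_translate => y; exact: partial_translate.
Qed.

End directional_derivatives.

(** * Lebesgue measure on tuples and on Euclidean space *)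

Section measurability.
Variables (R : realType) (d : nat).
Local Notation RT := (measurableTypeR R).
Local Notation V := 'rV[R]_d.
Local Notation pt := (d.-tuple RT).

(** An open set is the union of the countably many cubes with rational centre
    and side 2 / (n + 1) that it contains. *)
Lemma measurable_open_point (O : set V) :
  open O -> measurable (@point_of R d @^-1` O).
Proof.
move=> oO; set P := (X in measurable X).
pose B (p : {ffun 'I_d -> rat} * nat) : set pt :=
  [set t | forall i, `|tnth t i - ratr (p.1 i)| < p.2.+1%:R^-1].
have mB p : measurable (B p).
  have -> : B p = \bigcap_(i in [set: 'I_d]) ((fun t : pt => tnth t i) @^-1`
      [set r : RT | `|r - ratr (p.1 i)| < p.2.+1%:R^-1]).
    by apply/seteqP; split=> t h i; [move=> _; exact: h|exact: (h i I)].
  apply: fin_bigcap_measurable => // i _.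
  rewrite -[X in measurable X]setTI; apply: measurable_tnth => //.
  have -> : [set r : RT | `|r - ratr (p.1 i)| < p.2.+1%:R^-1] =
      ball (ratr (p.1 i) : R) p.2.+1%:R^-1.
    by apply/seteqP; split => r; rewrite /ball /= distrC.
  apply: open_measurable; exact: ball_open.
have -> : P = \bigcup_p (if `[< B p `<=` P >] then B p else set0).
  apply/seteqP; split => t; last by move=> [p _]; case: asboolP => // BP; exact: BP.
  move=> Pt; have /nbhs_ballP[e /= e0 eO] : nbhs (point_of t) O by apply: open_nbhs_nbhs.
  have [n n0] : exists n : nat, n.+1%:R^-1 < e / 2.
    have := @near_infty_natSinv_lt R (PosNum (divr_gt0 e0 (ltr0n R 2))).
    by case=> n _ /(_ n (leqnn n)) /=; exists n.
  have [q qt] : exists q : {ffun 'I_d -> rat}, forall i, `|tnth t i - ratr (q i)| < n.+1%:R^-1.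
    have qi i : exists q : rat, `|tnth t i - ratr q| < n.+1%:R^-1.
      have /rat_in_itvoo[q] : (tnth t i : R) - n.+1%:R^-1 < tnth t i + n.+1%:R^-1.
        by rewrite ltrD2l gtrN // invr_gt0.
      by rewrite in_itv /= => h; exists q; rewrite ltr_distlC.
    have [f hf] := choice qi.
    by exists (finfun f) => i; rewrite ffunE.
  exists (q, n) => //=; case: asboolP => // nB; exfalso; apply: nB => t' /= h.
  apply: eO; split => // i j; rewrite /ball /= !mxE.
  rewrite (_ : tnth t j - tnth t' j = (tnth t j - ratr (q j)) - (tnth t' j - ratr (q j)));
    last by ring.
  rewrite (le_lt_trans (ler_normB _ _)) //.
  by rewrite (splitr e) ltrD // (lt_trans _ n0).
apply: countable_bigcupT_measurable; first exact: countableP.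
by move=> p; case: asboolP.
Qed.

Lemma measurable_continuous_point (f : V -> R) :
  continuous f -> measurable_fun [set: pt] (f \o @point_of R d).
Proof.
move=> /continuousP cf.
apply: (measurability _ (RGenOpens.measurableE R)).
move=> _ [_ [a [b ->] <-]]; rewrite setTI comp_preimage.
apply: measurable_open_point; apply: cf; exact: interval_open.
Qed.

End measurability.

Section tuple_measure.
Variable R : realType.
Local Notation RT := (measurableTypeR R).
Local Notation mu := (lebesgue_tuple R).

Definition tbox n (lo hi : 'I_n -> R) : set (n.-tuple RT) :=
  [set t | forall i, lo i < tnth t i < hi i].

Definition shift_fun n (f : 'I_n.+1 -> R) (i : 'I_n) : R := f (lift ord0 i).

Lemma measurable_tbox n (lo hi : 'I_n -> R) : measurable (tbox lo hi).
Proof.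
have -> : tbox lo hi = \bigcap_(i in [set: 'I_n])
    ((fun t : n.-tuple RT => tnth t i) @^-1` (`]lo i, hi i[%classic : set RT)).
  apply/seteqP; split=> t /= h i; first by move=> _ /=; rewrite in_itv /=; apply: h.
  by have := h i I; rewrite /= in_itv.
apply: fin_bigcap_measurable => // i _.
by rewrite -[X in measurable X]setTI; apply: measurable_tnth => //; exact: measurable_itv.
Qed.

Lemma tuple_cons_tbox n (lo hi : 'I_n.+1 -> R) :
  @tuple_cons R n @^-1` tbox lo hi =
  `]lo ord0, hi ord0[%classic `*` tbox (shift_fun lo) (shift_fun hi).
Proof.
apply/seteqP; split=> -[x t] /= h.
  split; first by have := h ord0; rewrite in_itv.
  by move=> i; have := h (lift ord0 i); rewrite /tuple_cons tnthS.
move=> i; case: h => /=; rewrite in_itv /= => hx ht.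
case: (unliftP ord0 i) => [j|] ->; last by [].
by have := ht j; rewrite tnthS.
Qed.

Lemma lebesgue_tbox_lty n (lo hi : 'I_n -> R) : (mu n (tbox lo hi) < +oo)%E.
Proof.
elim: n lo hi => [|n ih] lo hi.
  by rewrite /= diracE ltry.
rewrite /= /image_product /= /pushforward tuple_cons_tbox product_measure1E //.
- apply: lte_mul_pinfty => //.
    rewrite -[X in X \is a _]/(@lebesgue_measure R `]lo ord0, hi ord0[%classic).
    by rewrite lebesgue_measure_itv /=; case: ifP => //; rewrite -EFinB.
- exact: measurable_tbox.
Qed.

Lemma lebesgue_tbox_gt0 n (lo hi : 'I_n -> R) : (forall i, lo i < hi i) ->
  (0 < mu n (tbox lo hi))%E.
Proof.
elim: n lo hi => [|n ih] lo hi lohi.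
  by rewrite /= diracE mem_set // => -[].
rewrite /= /image_product /= /pushforward tuple_cons_tbox product_measure1E //.
- apply: mule_gt0; last by apply: ih => i; exact: lohi.
  rewrite -[X in (_ < X)%E]/(@lebesgue_measure R `]lo ord0, hi ord0[%classic).
  by rewrite lebesgue_measure_itv /= lte_fin lohi -EFinB lte_fin subr_gt0.
- exact: measurable_tbox.
Qed.

(** Extending by zero outside A puts the integrand in the form to which Fubini's
    theorem for the whole product applies. *)
Lemma integral_tuple_cons n (A : set (n.+1.-tuple RT)) (f : n.+1.-tuple RT -> R) :
  measurable A -> (mu n.+1 A < +oo)%E -> measurable_fun setT f ->
  (exists C, forall t, A t -> `|f t| <= C) ->
  let g := ((EFin \o f) \_ A) \o @tuple_cons R n in
  (@lebesgue_measure R \x mu n)%E.-integrable setT g /\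
  (\int[mu n.+1]_(t in A) (f t)%:E = \int[(@lebesgue_measure R \x mu n)%E]_p g p)%E.
Proof.
move=> mA Aoo mf [C fC] g.
have mg : measurable_fun setT ((EFin \o f) \_ A).
  apply/(measurable_restrictT _ mA); apply: measurable_funTS.
  exact: measurableT_comp.
have ig : (@lebesgue_measure R \x mu n)%E.-integrable setT g.
  have -> : g = (EFin \o (f \o @tuple_cons R n)) \_ (@tuple_cons R n @^-1` A).
    by apply/funext => p; rewrite /g /= !patchE; congr (if _ then _ else _).
  apply/(integrable_mkcond _ _).1.
    rewrite -[X in measurable X]setTI; exact: measurable_tuple_cons.
  apply: measurable_bounded_integrable => //.
  - rewrite -[X in measurable X]setTI; exact: measurable_tuple_cons.
  - apply: measurable_funTS; apply: measurableT_comp => //.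
    exact: measurable_tuple_cons.
  - exists C; split; first exact: num_real.
    by move=> M CM p Ap /=; apply: le_trans (ltW CM); apply: fC.
split => //.
rewrite integral_mkcond /= integral_pushforward //.
exact: measurable_tuple_cons.
Qed.

End tuple_measure.

(** * Integrals of derivatives over boxes *)

Section box_integral.
Variable R : realType.
Local Notation RT := (measurableTypeR R).
Local Notation mu := (lebesgue_tuple R).

Lemma integral_derivative_itv (G H : R -> R) (a b : R) : a < b ->
  (forall r : R, is_derive r 1 G (H r)) -> continuous H ->
  (\int[@lebesgue_measure R]_(x in `]a, b[) (H x)%:E = (G b - G a)%:E)%E.
Proof.
move=> ab dG cH.
have cG : continuous G.
  move=> r; apply: differentiable_continuous; apply/derivable1_diffP.
  by have [] := dG r.
rewrite -(integral_itv_bndoo true false); last first.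
  apply/measurable_EFinP; apply: measurable_funTS.
  exact: continuous_measurable_fun.
rewrite (@continuous_FTC2 R H G) ?EFinB //.
- exact: continuous_subspaceT.
- split; first by move=> r _; have [] := dG r.
    by apply: cvg_at_right_filter; exact: cG.
  by apply: cvg_at_left_filter; exact: cG.
- by move=> r _; rewrite derive1E; have [] := dG r.
Qed.

Definition tset n (t : n.-tuple RT) (i : 'I_n) (r : R) : n.-tuple RT :=
  [tuple (if j == i then r else tnth t j) | j < n].

Lemma tset_cons0 n (t : n.-tuple RT) x r :
  tset (tuple_cons (x, t)) ord0 r = tuple_cons (r, t).
Proof.
apply: eq_from_tnth => j; rewrite tnth_mktuple.
case: (unliftP ord0 j) => [k|] -> //.
by rewrite /tuple_cons !tnthS.
Qed.

Lemma tset_consS n (t : n.-tuple RT) x j r :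
  tset (tuple_cons (x, t)) (lift ord0 j) r = tuple_cons (x, tset t j r).
Proof.
apply: eq_from_tnth => k; rewrite tnth_mktuple.
case: (unliftP ord0 k) => [l|] -> //.
by rewrite /tuple_cons !tnthS tnth_mktuple (inj_eq lift_inj).
Qed.

(** Integrating first along the direction of differentiation: by Fubini, this
    reduces to the fundamental theorem of calculus on that edge of the box. *)
Lemma tbox_integral_derivative_eq0 n (i : 'I_n) (lo hi : 'I_n -> R)
    (G H : n.-tuple RT -> R) :
  (forall j, lo j < hi j) -> measurable_fun setT H ->
  (exists C, forall t, tbox lo hi t -> `|H t| <= C) ->
  (forall t (r : R), is_derive r 1 (fun h : R => G (tset t i h)) (H (tset t i r))) ->
  (forall t, continuous (fun r : R => H (tset t i r))) ->
  (forall t, G (tset t i (lo i)) = G (tset t i (hi i))) ->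
  (\int[mu n]_(t in tbox lo hi) (H t)%:E = 0)%E.
Proof.
elim: n i lo hi G H => [[]//|n ih] i lo hi G H lohi mH [C HC] dG cH per.
have [ig ->] := integral_tuple_cons (measurable_tbox lo hi)
  (lebesgue_tbox_lty lo hi) mH (ex_intro _ C HC).
set g := _ \o _ in ig *.
have gE x t : g (x, t) = if (x \in `]lo ord0, hi ord0[) &&
    (t \in tbox (shift_fun lo) (shift_fun hi)) then (H (tuple_cons (x, t)))%:E else 0%E.
  rewrite /g /= patchE; congr (if _ then _ else _).
  apply/idP/andP => [/set_mem|[x1 /set_mem t1]].
    by rewrite -[tbox _ _ _]/((@tuple_cons R n @^-1` tbox lo hi) (x, t)) tuple_cons_tbox => -[? /mem_set].
  apply/mem_set.
  by rewrite -[tbox _ _ _]/((@tuple_cons R n @^-1` tbox lo hi) (x, t)) tuple_cons_tbox.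
case: (unliftP ord0 i) dG cH per => [j|] -> dG cH per.
  rewrite -integral12_prod_meas1 //; apply: integral0_eq => x _.
  rewrite /fubini_F; have [x1|x1] := boolP (x \in `]lo ord0, hi ord0[); last first.
    by apply: integral0_eq => t _; rewrite gE (negbTE x1).
  under eq_integral do rewrite gE x1 /=.
  have -> : (fun t => if t \in tbox (shift_fun lo) (shift_fun hi) then
     (H (tuple_cons (x, t)))%:E else 0%E) =
     (fun t => (H (tuple_cons (x, t)))%:E) \_ (tbox (shift_fun lo) (shift_fun hi)).
    by apply/funext => t; rewrite patchE.
  rewrite -integral_mkcond.
  apply: (ih j _ _ (fun t => G (tuple_cons (x, t)))) => //.
  - by move=> k; exact: lohi.
  - apply: (measurableT_comp mH).
    apply: (measurableT_comp (@measurable_tuple_cons R n)).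
    exact: measurable_pair1.
  - exists C => t ht; apply: HC.
    rewrite -[tbox _ _ _]/((@tuple_cons R n @^-1` tbox lo hi) (x, t)) tuple_cons_tbox.
    by split.
  - move=> t r; have := dG (tuple_cons (x, t)) r; rewrite tset_consS.
    by under eq_fun do rewrite tset_consS.
  - by move=> t; have := cH (tuple_cons (x, t)); under eq_fun do rewrite tset_consS.
  - by move=> t; have := per (tuple_cons (x, t)); rewrite !tset_consS.
rewrite -integral21_prod_meas1 //; apply: integral0_eq => t _.
rewrite /fubini_G; have [t1|t1] := boolP (t \in tbox (shift_fun lo) (shift_fun hi)); last first.
  by apply: integral0_eq => x _; rewrite gE (negbTE t1) andbF.
under eq_integral do rewrite gE t1 andbT /=.
have -> : (fun x => if x \in `]lo ord0, hi ord0[ then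
   (H (tuple_cons (x, t)))%:E else 0%E) =
   (fun x => (H (tuple_cons (x, t)))%:E) \_ (`]lo ord0, hi ord0[%classic : set RT).
  by apply/funext => x; rewrite patchE mem_setE.
rewrite -integral_mkcond.
have dG0 (r : R) : is_derive r 1 (fun x => G (tuple_cons (x, t))) (H (tuple_cons (r, t))).
  have := dG (tuple_cons (0, t)) r; rewrite tset_cons0.
  by under eq_fun do rewrite tset_cons0.
have cH0 : continuous (fun x : R => H (tuple_cons (x, t))).
  by have := cH (tuple_cons (0, t)); under eq_fun do rewrite tset_cons0.
have := integral_derivative_itv (lohi ord0) dG0 cH0.
have := per (tuple_cons (0, t)); rewrite !tset_cons0 => ->.
by rewrite subrr.
Qed.

End box_integral.

(** * Integration over a bounded open set *)

Section domain_integral.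
Variables (R : realType) (d : nat) (Omega : set 'rV[R]_d).
Hypotheses (Omega_open : open Omega) (Omega_bounded : bounded_set Omega).
Local Notation RT := (measurableTypeR R).
Local Notation V := 'rV[R]_d.
Local Notation mu := (lebesgue_tuple R d).
Local Notation pre := (@point_of R d @^-1` Omega).
Local Notation "\I f" := (Defs.integral Omega f) (at level 10, f at level 8).
Implicit Types (f g w : V -> R).

Lemma measurable_domain : measurable pre.
Proof. exact: measurable_open_point. Qed.
Let mpre := measurable_domain.

Lemma coord_le_norm (x : V) i : `|x 0 i| <= `|x|.
Proof.
rewrite [leRHS]/Num.Def.normr /= mx_normrE.
by apply/bigmax_geP; right => /=; exists (0, i).
Qed.

Lemma domain_bound : exists2 M, 0 < M & forall x, Omega x -> `|x| <= M.
Proof.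
have [M [_ hM]] := Omega_bounded; exists (`|M| + 1); first by rewrite ltr_wpDl.
by move=> x Ox; apply: hM => //; rewrite (le_lt_trans (ler_norm _)) // ltrDl.
Qed.

Lemma domain_measure_lty : (mu pre < +oo)%E.
Proof.
have [M M0 hM] := domain_bound.
have := lebesgue_tbox_lty (fun=> - (M + 1)) (fun _ : 'I_d => M + 1).
apply: le_lt_trans; apply: le_measure; rewrite ?inE //; first exact: measurable_tbox.
move=> t Ot i; have := coord_le_norm (point_of t) i; rewrite mxE => h.
rewrite -ltr_norml (le_lt_trans h) // (le_lt_trans (hM _ Ot)) //.
by rewrite ltrDl.
Qed.

Lemma bounded_on_domain w : continuous w ->
  exists C, forall x, Omega x -> `|w x| <= C.
Proof.
move=> cw; have [M M0 hM] := domain_bound.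
have cK : compact [set x : V | `|x| <= M].
  apply: bounded_closed_compact.
    exists M; split; first exact: num_real.
    by move=> N MN x /= xM; exact: le_trans xM (ltW MN).
  apply: (@closed_comp _ _ (fun x : V => `|x|) [set r | r <= M]); last exact: closed_le.
  by move=> x _; exact: norm_continuous.
have /compact_bounded[C [_ hC]] := continuous_compact (continuous_subspaceT cw) cK.
exists (`|C| + 1) => x Ox; apply: hC; first by rewrite (le_lt_trans (ler_norm _)) // ltrDl.
by exists x => //; exact: hM.
Qed.

(** Continuity up to the boundary, in the same sense as for Ck_bc. *)
Definition cont_ext f : Prop := exists2 w, continuous w & eq_on Omega f w.

Lemma cont_ext_continuous f : continuous f -> cont_ext f.
Proof. by exists f. Qed.

Lemma cont_extD f g : cont_ext f -> cont_ext g -> cont_ext (fun x => f x + g x).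
Proof.
move=> [w cw fw] [v cv gv]; exists (fun x => w x + v x).
  exact: continuous_add.
by move=> x Ox; rewrite (fw x Ox) (gv x Ox).
Qed.

Lemma cont_extM f g : cont_ext f -> cont_ext g -> cont_ext (fun x => f x * g x).
Proof.
move=> [w cw fw] [v cv gv]; exists (fun x => w x * v x).
  exact: continuous_mul.
by move=> x Ox; rewrite (fw x Ox) (gv x Ox).
Qed.

Lemma cont_ext_cst c : cont_ext (fun=> c).
Proof. by exists (fun=> c) => //; exact: cst_continuous. Qed.

Lemma cont_extZ c f : cont_ext f -> cont_ext (fun x => c * f x).
Proof. exact/cont_extM/cont_ext_cst. Qed.

Lemma cont_extX n f : cont_ext f -> cont_ext (fun x => f x ^+ n).
Proof.
move=> cf; elim: n => [|n ih].
  by under eq_fun do rewrite expr0; exact: cont_ext_cst.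
by under eq_fun do rewrite exprS; exact: cont_extM.
Qed.

Lemma cont_ext_sum (I : Type) (r : seq I) (P : pred I) (F : I -> V -> R) :
  (forall i, cont_ext (F i)) -> cont_ext (fun x => \sum_(i <- r | P i) F i x).
Proof.
move=> cF; elim: r => [|i r ih].
  by under eq_fun do rewrite big_nil; exact: cont_ext_cst.
under eq_fun do rewrite big_cons.
by case: (P i) => //; exact: cont_extD.
Qed.

Lemma cont_ext_comp (g : R -> R) f : continuous g -> cont_ext f ->
  cont_ext (g \o f).
Proof.
move=> cg [w cw fw]; exists (g \o w); last by move=> x Ox /=; rewrite (fw x Ox).
by move=> x; apply: continuous_comp; [exact: cw|exact: cg].
Qed.

Lemma integrable_cont_ext f : cont_ext f ->
  mu.-integrable pre (EFin \o (f \o @point_of R d)).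
Proof.
move=> [w cw fw]; apply: (@eq_integrable _ _ _ _ _ _ (EFin \o (w \o @point_of R d))) => //.
  by move=> t /set_mem Ot /=; rewrite (fw _ Ot).
apply: measurable_bounded_integrable => //; first exact: domain_measure_lty.
  by apply: measurable_funTS; exact: measurable_continuous_point.
have [C hC] := bounded_on_domain cw.
exists C; split; first exact: num_real.
by move=> M CM t Ot /=; rewrite (le_trans (hC _ Ot)) // ltW.
Qed.

Lemma int_eq_on f g : eq_on Omega f g -> \I f = \I g.
Proof.
by move=> fg; apply: eq_Rintegral => t /set_mem Ot; rewrite (fg _ Ot).
Qed.

Lemma int_add f g : cont_ext f -> cont_ext g ->
  \I (fun x => f x + g x) = \I f + \I g.
Proof. by move=> cf cg; apply: RintegralD => //; exact: integrable_cont_ext. Qed.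

Lemma int_scale c f : cont_ext f -> \I (fun x => c * f x) = c * \I f.
Proof. by move=> cf; apply: RintegralZl => //; exact: integrable_cont_ext. Qed.

Lemma int_sub f g : cont_ext f -> cont_ext g ->
  \I (fun x => f x - g x) = \I f - \I g.
Proof. by move=> cf cg; apply: RintegralB => //; exact: integrable_cont_ext. Qed.

Lemma int_zero : \I (fun=> 0) = 0.
Proof. by rewrite /Defs.integral Rintegral_cst // mul0r. Qed.

Lemma int_cst c : \I (fun=> c) = c * volume Omega.
Proof. by rewrite /volume /Defs.integral !Rintegral_cst // mul1r. Qed.

Lemma int_sum (I : Type) (r : seq I) (P : pred I) (F : I -> V -> R) :
  (forall i, cont_ext (F i)) ->
  \I (fun x => \sum_(i <- r | P i) F i x) = \sum_(i <- r | P i) \I (F i).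
Proof.
move=> cF; elim: r => [|i r ih].
  by under eq_fun do rewrite big_nil; rewrite int_zero big_nil.
under eq_fun do rewrite big_cons.
rewrite big_cons -ih; case: (P i) => //; apply: int_add => //.
exact: cont_ext_sum.
Qed.

Lemma int_le f g : cont_ext f -> cont_ext g ->
  (forall x, Omega x -> f x <= g x) -> \I f <= \I g.
Proof.
move=> cf cg fg; apply: le_Rintegral => //; try exact: integrable_cont_ext.
by move=> t; exact: fg.
Qed.

Lemma int_ge0 f : (forall x, Omega x -> 0 <= f x) -> 0 <= \I f.
Proof. by move=> f0; apply: Rintegral_ge0 => t; exact: f0. Qed.

Lemma Linfnorm_le f M x : cont_ext f -> Linfnorm Omega f <= M -> Omega x ->
  `|f x| <= M.
Proof.
move=> [w cw fw] fM Ox; apply: le_trans fM; apply: ub_le_sup; last by exists x.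
have [C hC] := bounded_on_domain cw.
by exists C => _ [y Oy <-]; rewrite (fw y Oy); exact: hC.
Qed.

(** Otherwise, by continuity, the square would be bounded below by a positive
    constant on some box inside Omega. *)
Lemma int_sqr_eq0 f : cont_ext f -> \I (fun x => f x ^+ 2) = 0 ->
  forall x, Omega x -> f x = 0.
Proof.
move=> cf; have [w cw fw] := cf => I0 x0 Ox0; apply: contrapT => /eqP fx0.
have cv : continuous (fun x => w x * w x) by exact: continuous_mul.
set c := w x0 * w x0 / 2.
have c0 : 0 < c by rewrite divr_gt0 // -expr2 exprn_even_gt0 //= -(fw _ Ox0).
have /nbhs_ballP[e /= e0 eB] : nbhs x0 (Omega `&` [set x | c < w x * w x]).
  apply: filterI; first exact: open_nbhs_nbhs.
  have cgt : nbhs (w x0 * w x0) [set r | c < r].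
    apply: open_nbhs_nbhs; split; first exact: open_gt.
    by move: c0; rewrite /= /c; lra.
  exact: (cv x0 _ cgt).
pose B := tbox (fun i : 'I_d => x0 0 i - e) (fun i => x0 0 i + e).
have BO t : B t -> Omega (point_of t) /\ c < w (point_of t) * w (point_of t).
  move=> Bt; apply: eB; split => // i j; rewrite (ord1 i) /ball /= mxE distrC.
  by rewrite ltr_distl.
have mB : measurable B by exact: measurable_tbox.
have : (0 < c%:E * mu B)%E.
  by apply: mule_gt0; rewrite ?lte_fin //; apply: lebesgue_tbox_gt0 => i; lra.
rewrite ltNge => /negP; apply.
have := integrable_cont_ext (cont_extX 2 cf) => iF.
have <- : (\int[mu]_(t in pre) (f (point_of t) ^+ 2)%:E)%E = 0%E.
  by rewrite -[RHS](congr1 EFin I0) fineK //; exact: (integrable_fin_num mpre iF).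
rewrite -integral_cst //.
apply: (@le_trans _ _ (\int[mu]_(t in B) (f (point_of t) ^+ 2)%:E)%E).
  apply: ge0_le_integral => //.
  - by move=> t _; rewrite lee_fin ltW.
  - apply: measurable_funS (measurable_int _ iF) => //.
    by move=> t /BO[].
  - by move=> t /BO[Ot ct]; rewrite lee_fin (fw _ Ot) expr2 ltW.
apply: ge0_subset_integral => //.
- exact: (measurable_int _ iF).
- by move=> t _; rewrite lee_fin sqr_ge0.
- by move=> t /BO[].
Qed.

End domain_integral.

(** * Green's formula for the boundary conditions *)

Section green.
Variables (R : realType) (d : nat) (Omega : set 'rV[R]_d) (b : boundary_type R d).
Hypotheses (Omega_open : open Omega) (Omega_bounded : bounded_set Omega)
  (Omega_b : boundary_ok Omega b).
Local Notation V := 'rV[R]_d.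
Local Notation pt := (d.-tuple (measurableTypeR R)).
Local Notation "\I f" := (Defs.integral Omega f) (at level 10, f at level 8).
Implicit Types (p q u v : V -> R).

(** These functions form a vector space that contains the constants, and are the
    test functions of Green's formula. *)
Definition smooth_bc p : Prop := Ck 2 p /\ bc Omega b p.

Lemma partial_continuous k p i : Ck k.+1 p -> continuous (partial i p).
Proof. by move=> cp; apply: (@Ck_continuous _ _ k); exact: Ck_partial. Qed.

Lemma lap_continuous p : Ck 2 p -> continuous (lap p).
Proof. by move=> cp; apply: (@Ck_continuous _ _ 0); exact: Ck_lap. Qed.

Lemma bcD p q : Ck 1 p -> Ck 1 q -> bc Omega b p -> bc Omega b q ->
  bc Omega b (fun x => p x + q x).
Proof.
case: b => [lo hi|sigma nu] cp cq /=.
  by move=> hp hq x i; rewrite hp hq.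
apply: filterS2 => t hp hq ft; have := hp ft; have := hq ft.
under [in X in _ -> _ -> X]eq_bigr do rewrite partialD // mulrDl.
by rewrite big_split /= => -> ->; rewrite addr0.
Qed.

Lemma bcZ c p : Ck 1 p -> bc Omega b p -> bc Omega b (fun x => c * p x).
Proof.
case: b => [lo hi|sigma nu] cp /=; first by move=> hp x i; rewrite hp.
apply: filterS => t hp ft; have := hp ft.
under [in X in _ -> X]eq_bigr do rewrite partialZ // -mulrA.
by rewrite -mulr_sumr => ->; rewrite mulr0.
Qed.

Lemma bc_cst c : bc Omega b (fun=> c).
Proof.
case: b => [lo hi|sigma nu] //=.
by apply: aeW => t _; rewrite big1 // => i _; rewrite partial_cst mul0r.
Qed.

Lemma smooth_bcD p q : smooth_bc p -> smooth_bc q -> smooth_bc (fun x => p x + q x).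
Proof. by move=> [cp bp] [cq bq]; split; [exact: CkD|apply: bcD => //; exact: CkW]. Qed.

Lemma smooth_bcZ c p : smooth_bc p -> smooth_bc (fun x => c * p x).
Proof. by move=> [cp bp]; split; [exact: CkZ|apply: bcZ => //; exact: CkW]. Qed.

Lemma smooth_bc_cst c : smooth_bc (fun=> c).
Proof. by split; [exact: Ck_cst|exact: bc_cst]. Qed.

Lemma smooth_bcB p q : smooth_bc p -> smooth_bc q -> smooth_bc (fun x => p x - q x).
Proof.
move=> gp gq; have := smooth_bcD gp (smooth_bcZ (-1) gq).
by under eq_fun do rewrite mulN1r.
Qed.

Lemma smooth_bc_sum (I : Type) (r : seq I) (P : pred I) (F : I -> V -> R) :
  (forall i, smooth_bc (F i)) -> smooth_bc (fun x => \sum_(i <- r | P i) F i x).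
Proof.
move=> gF; elim: r => [|i r ih].
  by under eq_fun do rewrite big_nil; exact: smooth_bc_cst.
under eq_fun do rewrite big_cons.
by case: (P i) => //; exact: smooth_bcD.
Qed.

Lemma smooth_bc_continuous p : smooth_bc p -> continuous p.
Proof. by case=> /Ck_continuous. Qed.

Lemma periodic_integral_partial (lo hi : V) (F : V -> R) i :
  (forall j, lo 0 j < hi 0 j) -> Omega = [set x | forall j, lo 0 j < x 0 j < hi 0 j] ->
  Ck 1 F -> (forall x, F (x + (hi 0 i - lo 0 i) *: basis_vec R i) = F x) ->
  \I (partial i F) = 0.
Proof.
move=> lohi OE cF per.
have preE : @point_of R d @^-1` Omega = tbox (fun j => lo 0 j) (fun j => hi 0 j).
  by apply/seteqP; rewrite OE; split=> t /= h j; have := h j; rewrite mxE.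
have ptE (t : pt) (r : R) : point_of (tset t i r) = r *: basis_vec R i + point_of (tset t i 0).
  apply/rowP => j; rewrite !mxE !tnth_mktuple /=.
  by case: (j == i); rewrite ?mulr1 ?addr0 ?mulr0 ?add0r.
rewrite /Defs.integral /Rintegral preE.
have dF (t : pt) (r : R) : is_derive r 1 (fun h : R => (F \o @point_of R d) (tset t i h))
    ((partial i F \o @point_of R d) (tset t i r)).
  have -> : (fun h : R => (F \o @point_of R d) (tset t i h)) =
      fun h => F (h *: basis_vec R i + point_of (tset t i 0)).
    by apply/funext => h /=; rewrite ptE.
  by apply/is_derive_line; rewrite /= (ptE t r); exact: (Ck_is_derive i _ cF).
have cdF (t : pt) : continuous (fun r : R => (partial i F \o @point_of R d) (tset t i r)).
  rewrite /=; under eq_fun do rewrite ptE.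
  move=> r; apply: (@continuous_comp _ _ _
    (fun r : R => r *: basis_vec R i + point_of (tset t i 0)) (partial i F));
    last exact: (partial_continuous cF).
  by apply: cvgD; [apply: cvgZr_tmp; exact: cvg_id|exact: cvg_cst].
have perF (t : pt) : (F \o @point_of R d) (tset t i (lo 0 i)) =
    (F \o @point_of R d) (tset t i (hi 0 i)).
  rewrite /= ptE [in RHS]ptE -[LHS]per; congr F.
  by rewrite addrAC -scalerDl [lo 0 i + _]addrC subrK.
have [C hC] := bounded_on_domain Omega_bounded (partial_continuous (i := i) cF).
have bF : exists C, forall t, tbox (fun j => lo 0 j) (fun j => hi 0 j) t ->
    `|(partial i F \o @point_of R d) t| <= C.
  by exists C => t Bt; apply: hC; move: Bt; rewrite -preE.
have mF := measurable_continuous_point (partial_continuous (i := i) cF).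
by have /(congr1 fine) := tbox_integral_derivative_eq0 lohi mF bF dF cdF perF.
Qed.

(** The boundary term of the divergence theorem vanishes for both types of
    boundary conditions. *)
Lemma integral_divergence p q : smooth_bc p -> smooth_bc q ->
  \I (fun x => \sum_i partial i (fun y => p y * partial i q y) x) = 0.
Proof.
move=> [cp bp] [cq bq].
have cF i : Ck 1 (fun y => p y * partial i q y).
  by apply: Ck1M; [exact: CkW|exact: Ck_partial].
case: b Omega_b bp bq => [lo hi|sigma nu] /=.
  move=> [lohi OE] bp bq.
  rewrite int_sum // => [|i]; last first.
    by apply: cont_ext_continuous; exact: (partial_continuous (cF i)).
  rewrite big1 // => i _; apply: (periodic_integral_partial lohi OE) => // x.
  rewrite bp; congr (_ * _); apply: partial_translate => y; exact: bq.
move=> [sigoo mnu nu1 gauss] bp bq; rewrite gauss //.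
have cfr : measurable (@point_of R d @^-1` frontier Omega).
  apply: (@measurableD _ _ (@point_of R d @^-1` closure Omega)
    (@point_of R d @^-1` interior Omega)).
    have -> : @point_of R d @^-1` closure Omega = ~` (@point_of R d @^-1` ~` closure Omega).
      by rewrite preimage_setC setCK.
    apply: measurableC.
    apply: measurable_open_point; rewrite openC; exact: closed_closure.
  by apply: measurable_open_point; exact: open_interior.
rewrite /Rintegral (_ : (\int[_]_(_ in _) _)%E = 0%E) //.
rewrite -[RHS](@integral0 _ _ _ sigma (@point_of R d @^-1` frontier Omega)).
apply: ae_eq_integral => //.
  apply/measurable_EFinP; apply: measurable_sum => i.
  apply: measurable_funM; last exact: mnu.
  apply: measurable_funTS.
  exact: (measurable_continuous_point (Ck_continuous (cF i))).
apply: filterS bq => t hq ft /=; congr EFin.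
have := hq ft; under [in X in _ -> X]eq_bigr do rewrite -mulrA.
by rewrite -mulr_sumr => ->; rewrite mulr0.
Qed.

Lemma green p q : smooth_bc p -> smooth_bc q ->
  \I (fun x => p x * lap q x) =
  - \I (fun x => \sum_i partial i p x * partial i q x).
Proof.
move=> gp gq; have := integral_divergence gp gq.
case: gp gq => cp bp [cq bq].
have e : (fun x => \sum_i partial i (fun y => p y * partial i q y) x) =
    fun x => p x * lap q x + \sum_i partial i p x * partial i q x.
  apply/funext => x; rewrite /lap mulr_sumr -big_split; apply: eq_bigr => i _.
  rewrite partialM //; [by rewrite [partial i q x * _]mulrC|exact: CkW|exact: Ck_partial].
rewrite e int_add //.
- by move/eqP; rewrite addr_eq0 => /eqP.
- apply: cont_ext_continuous; apply: continuous_mul; last exact: lap_continuous.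
  exact: Ck_continuous cp.
- apply: cont_ext_sum => i; apply: cont_ext_continuous.
  apply: continuous_mul; [exact: (partial_continuous cp)|exact: (partial_continuous cq)].
Qed.

Lemma green_sym p q : smooth_bc p -> smooth_bc q ->
  \I (fun x => p x * lap q x) = \I (fun x => lap p x * q x).
Proof.
move=> gp gq; have -> : (fun x => lap p x * q x) = (fun x => q x * lap p x).
  by apply/funext => x; rewrite mulrC.
have e : (fun x => \sum_i partial i p x * partial i q x) =
    (fun x => \sum_i partial i q x * partial i p x).
  by apply/funext => x; apply: eq_bigr => i _; rewrite mulrC.
have h := congr1 (fun z => - Defs.integral Omega z) e.
exact: (etrans (green gp gq) (etrans h (esym (green gq gp)))).
Qed.

Lemma integral_lap_eq0 q : smooth_bc q -> \I (lap q) = 0.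
Proof.
move=> gq; have := green (smooth_bc_cst 1) gq.
have -> : (fun x => \sum_i partial i (fun _ : V => 1) x * partial i q x) = fun=> 0.
  by apply/funext => x; rewrite big1 // => i _; rewrite partial_cst mul0r.
by rewrite int_zero // oppr0; under eq_fun do rewrite mul1r.
Qed.

End green.

(** * Linear combinations, and extensions of admissible functions *)

Section operators.
Variables (R : realType) (d : nat).
Implicit Types (u : 'rV[R]_d -> R).

Lemma shiftE u x : shift u x = u x + lap u x. Proof. by []. Qed.

Lemma PaE a u x : Pa a u x = shift (shift u) x + a * u x. Proof. by []. Qed.

Lemma lap_cst (e : R) x : lap (fun _ : 'rV[R]_d => e) x = 0.
Proof. by rewrite /lap big1 // => i _; rewrite !partial_cst. Qed.

End operators.

(* From here on, comparing two expressions must not unfold their derivatives. *)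
Opaque Ck partial lap shift Pa.

Section linear_operators.
Variables (R : realType) (d : nat).
Local Notation V := 'rV[R]_d.
Implicit Types (u v : V -> R).

Lemma lapB u v x : Ck 2 u -> Ck 2 v ->
  lap (fun y => u y - v y) x = lap u x - lap v x.
Proof.
move=> cu cv; have -> : (fun y => u y - v y) = (fun y => u y + (-1) * v y).
  by apply/funext => y; rewrite mulN1r.
have cv' := CkZ (-1) cv.
rewrite (lapD x cu cv').
rewrite (lapZ (-1) x cv).
 by rewrite mulN1r.
Qed.

Lemma CkB k u v : Ck k u -> Ck k v -> Ck k (fun x => u x - v x).
Proof.
move=> cu cv; have := CkD cu (CkZ (-1) cv).
by under eq_fun do rewrite mulN1r.
Qed.

Lemma increments_affine n (c : 'I_n -> R) (p q r : nat -> R) a :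
  (forall j, r j = p j + a * q j) ->
  \sum_l c l * (p l.+1 - p l) + a * (\sum_l c l * (q l.+1 - q l)) =
  \sum_l c l * (r l.+1 - r l).
Proof.
move=> rE; rewrite mulr_sumr -big_split; apply: eq_bigr => l _ /=.
by rewrite !rE; ring.
Qed.

Definition combination (n : nat) (c : 'I_n -> R) (z : nat -> V -> R) : V -> R :=
  fun x => \sum_l c l * (z l.+1 x - z l x).

Lemma Ck_combination k n (c : 'I_n -> R) z :
  (forall j, Ck k (z j)) -> Ck k (combination c z).
Proof. by move=> cz; apply: Ck_sum => l; apply/CkZ/CkB. Qed.

Lemma lap_combination n (c : 'I_n -> R) z x : (forall j, Ck 2 (z j)) ->
  lap (combination c z) x = combination c (fun j => lap (z j)) x.
Proof.
move=> cz; rewrite /combination lap_sum => [|l]; last exact/CkZ/CkB.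
by apply: eq_bigr => l _; rewrite lapZ ?lapB //; exact: CkB.
Qed.

Lemma shift_combination n (c : 'I_n -> R) z x : (forall j, Ck 2 (z j)) ->
  shift (combination c z) x = combination c (fun j => shift (z j)) x.
Proof.
move=> cz; rewrite shiftE lap_combination // /combination -big_split.
apply: eq_bigr => l _ /=; rewrite !shiftE.
by generalize (lap (z l.+1) x) (lap (z l) x) (z l.+1 x) (z l x) => *; ring.
Qed.

Lemma shiftD u v x : Ck 2 u -> Ck 2 v ->
  shift (fun y => u y + v y) x = shift u x + shift v x.
Proof. move=> cu cv; rewrite !shiftE (lapD x cu cv).
by generalize (lap u x) (lap v x) (u x) (v x) => *; ring. Qed.

Lemma shiftB u v x : Ck 2 u -> Ck 2 v ->
  shift (fun y => u y - v y) x = shift u x - shift v x.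
Proof. move=> cu cv; rewrite !shiftE (lapB x cu cv).
by generalize (lap u x) (lap v x) (u x) (v x) => *; ring. Qed.

Lemma PaD a u v x : Ck 4 u -> Ck 4 v ->
  Pa a (fun y => u y + v y) x = Pa a u x + Pa a v x.
Proof.
move=> cu cv; rewrite !PaE.
have -> : shift (fun y => u y + v y) = fun y => shift u y + shift v y.
  by apply/funext => y; apply: shiftD; do 2 apply: CkW.
rewrite (shiftD x (Ck_shift cu) (Ck_shift cv)).
by generalize (shift (shift u) x) (shift (shift v) x) (u x) (v x) => *; ring.
Qed.

Lemma PaB a u v x : Ck 4 u -> Ck 4 v ->
  Pa a (fun y => u y - v y) x = Pa a u x - Pa a v x.
Proof.
move=> cu cv; rewrite !PaE.
have -> : shift (fun y => u y - v y) = fun y => shift u y - shift v y.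
  by apply/funext => y; apply: shiftB; do 2 apply: CkW.
rewrite (shiftB x (Ck_shift cu) (Ck_shift cv)).
by generalize (shift (shift u) x) (shift (shift v) x) (u x) (v x) => *; ring.
Qed.

Lemma Pa_combination a n (c : 'I_n -> R) z x : (forall j, Ck 4 (z j)) ->
  Pa a (combination c z) x = combination c (fun j => Pa a (z j)) x.
Proof.
move=> cz; rewrite PaE.
have -> : shift (combination c z) = combination c (fun j => shift (z j)).
  by apply/funext => y; apply: shift_combination => j; do 2 apply: CkW.
rewrite shift_combination => [|j]; last exact: Ck_shift.
exact: (@increments_affine _ c (fun j => shift (shift (z j)) x)
  (fun j => z j x) (fun j => Pa a (z j) x) a (fun j => PaE a (z j) x)).
Qed.

End linear_operators.

Section extension.
Variables (R : realType) (d : nat) (Omega : set 'rV[R]_d) (b : boundary_type R d).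
Hypothesis Omega_open : open Omega.
Local Notation V := 'rV[R]_d.
Local Notation smooth_bc := (smooth_bc Omega b).

(** Data on the whole space for an admissible function u: an extension w, and
    an extension q of the composed nonlinearity. *)
Definition extends (a : R) (g : R -> R) (u w q : V -> R) : Prop :=
  [/\ Ck 6 w, eq_on Omega u w, [/\ smooth_bc w, smooth_bc (lap w) & smooth_bc (Pa a w)],
      smooth_bc q & eq_on Omega q (g \o w)].

Lemma shift_translate (h : V) (u : V -> R) : (forall y, u (y + h) = u y) ->
  forall y, shift u (y + h) = shift u y.
Proof. by move=> uh y; rewrite (shiftE u (y + h)) (uh y) (lap_translate y uh). Qed.

(** The two boundary conditions on u and on its Laplacian are met by one and the
    same extension, as the derivatives up to the boundary do not depend on it. *)
Lemma extension_lap u : Ck_bc Omega b 6 u -> Ck_bc Omega b 4 (lap u) ->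
  exists w, [/\ Ck 6 w, eq_on Omega u w, smooth_bc w & smooth_bc (lap w)].
Proof.
move=> [w [cw uw bw]] [w' [cw' luw' bw']]; exists w.
have c2w : Ck 2 w by apply: Ck_le cw.
have c2l : Ck 2 (lap w) by apply: Ck_lap; apply: Ck_le cw.
have c1w' : Ck 1 w' by apply: Ck_le cw'.
have lw : eq_on Omega (lap w) w'.
  by move=> x Ox; rewrite -(luw' _ Ox) (eq_on_lap Omega_open uw Ox).
suff bl : bc Omega b (lap w) by split.
case: b bw bw' => [lo hi|sigma nu] /= bw bw'.
  by move=> x i; exact: (lap_translate x (fun y => bw y i)).
apply: filterS bw' => t h ft; rewrite -[RHS](h ft); apply: eq_bigr => i _.
congr (_ * _).
exact: (@eq_on_partial_closure _ _ _ Omega_open i _ _ (CkW c2l) c1w' lw _ ft.1).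
Qed.

(** For homogeneous Neumann conditions, the normal derivative of P u vanishes
    because those of the chemical potential P u + g(u) and of u do, by the chain
    rule up to the boundary. *)
Lemma admissible_extends a (g g' : R -> R) u :
  (forall y : R, is_derive y 1 g (g' y)) -> continuous g' ->
  admissible a Omega b g u -> exists w q, extends a g u w q.
Proof.
move=> dg cg' [u6 lu4 [m [cm um bm]]].
have [w [cw uw gw gl]] := extension_lap u6 lu4.
have [c2w bw] := gw.
have c2P : Ck 2 (Pa a w) by exact: Ck_Pa.
pose q x := m x - Pa a w x.
have c2q : Ck 2 q by exact: CkB.
have qg : eq_on Omega q (g \o w).
  move=> x Ox; rewrite /q -um // /chem (eq_on_Pa Omega_open a uw Ox) (uw _ Ox).
  by rewrite addrAC subrr add0r.
suff [bP bq] : bc Omega b (Pa a w) /\ bc Omega b q.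
  exists w, q; split; [exact: cw|exact: uw| |exact: (conj c2q bq)|exact: qg].
  by split; [exact: gw|exact: gl|exact: (conj c2P bP)].
clear gw gl u6 lu4; case: b bw bm => [lo hi|sigma nu] /= bw bm.
  have bP x i : Pa a w (x + (hi 0 i - lo 0 i) *: basis_vec R i) = Pa a w x.
    have wi y := bw y i.
    by rewrite (PaE a w (x + _)) (wi x) (shift_translate (shift_translate wi)).
  by split; [exact: bP|move=> x i; rewrite /q (bm x i) (bP x i)].
have bq : {ae sigma, forall t, frontier Omega (point_of t) ->
   \sum_i partial i q (point_of t) * nu (point_of t) 0 i = 0}.
  apply: filterS bw => t h ft.
  have e i : partial i q (point_of t) * nu (point_of t) 0 i =
      g' (w (point_of t)) * (partial i w (point_of t) * nu (point_of t) 0 i).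
    rewrite mulrA; congr (_ * _).
    exact: (@chain_rule_closure _ _ _ Omega_open _ _ _ _ i dg cg' (CkW c2w) (CkW c2q)
      qg _ ft.1).
  by rewrite (eq_bigr _ (fun i _ => e i)) -mulr_sumr (h ft) mulr0.
split; last exact: bq.
apply: filterS2 bm bq => t hm hq ft.
have -> : Pa a w = fun x => m x + (-1) * q x.
  by apply/funext => x; rewrite /q mulN1r opprB addrC subrK.
have e i : partial i (fun x => m x + (-1) * q x) (point_of t) * nu (point_of t) 0 i =
    partial i m (point_of t) * nu (point_of t) 0 i +
    (-1) * (partial i q (point_of t) * nu (point_of t) 0 i).
  rewrite (partialD i _ (CkW cm) (CkW (CkZ (-1) c2q))) (partialZ i (-1) _ (CkW c2q)).
  by rewrite mulrDl mulrA.
rewrite (eq_bigr _ (fun i _ => e i)) big_split /= -mulr_sumr.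
by rewrite (hm ft) (hq ft) mulr0 addr0.
Qed.

End extension.

(** * The energy as a form of second order *)

Section bilinear.
Variables (R : realType) (d : nat) (Omega : set 'rV[R]_d) (b : boundary_type R d).
Hypotheses (Omega_open : open Omega) (Omega_bounded : bounded_set Omega)
  (Omega_b : boundary_ok Omega b).
Local Notation V := 'rV[R]_d.
Local Notation smooth_bc := (smooth_bc Omega b).
Local Notation cont_ext := (cont_ext Omega).
Local Notation "\I f" := (Defs.integral Omega f) (at level 10, f at level 8).
Implicit Types (p q u v : V -> R).

Lemma cont_ext_Ck k p : Ck k p -> cont_ext p.
Proof. by move=> cp; exact: (cont_ext_continuous Omega (Ck_continuous cp)). Qed.

Lemma cont_ext_smooth_bc p : smooth_bc p -> cont_ext p.
Proof. by case=> cp _; exact: (cont_ext_Ck cp). Qed.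

Lemma cont_ext_lap p : Ck 2 p -> cont_ext (lap p).
Proof. by move=> cp; exact: (cont_ext_continuous Omega (lap_continuous cp)). Qed.

Lemma cont_ext_partial i p : Ck 2 p -> cont_ext (partial i p).
Proof. by move=> cp; exact: (cont_ext_continuous Omega (partial_continuous cp)). Qed.

Lemma cont_ext_shift p : Ck 2 p -> cont_ext (shift p).
Proof. by move=> cp; exact: (cont_ext_Ck (Ck_shift cp)). Qed.

Lemma smooth_bc_shift p : smooth_bc p -> smooth_bc (lap p) -> smooth_bc (shift p).
Proof. by move=> gp gl; exact: (smooth_bcD gp gl). Qed.

(** Integrating by parts twice turns the sixth-order bilinear form into one of
    second order, which makes sense pointwise. *)
Lemma integral_Pa a p q : smooth_bc p -> smooth_bc q -> smooth_bc (lap q) ->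
  \I (fun x => p x * Pa a q x) =
  \I (fun x => shift p x * shift q x + a * (p x * q x)).
Proof.
move=> gp gq gl; have gs := smooth_bc_shift gq gl.
have cp := cont_ext_smooth_bc gp; have cq := cont_ext_smooth_bc gq.
have cs := cont_ext_smooth_bc gs.
have cls := cont_ext_lap gs.1; have clp := cont_ext_lap gp.1.
have cpsq := cont_extM cp cs; have cplsq := cont_extM cp cls.
have clps := cont_extM clp cs; have cpq := cont_extZ a (cont_extM cp cq).
have eL : \I (fun x => p x * Pa a q x) =
    \I (fun x => (p x * shift q x + p x * lap (shift q) x) + a * (p x * q x)).
  congr Defs.integral; apply/funext => x; have := shiftE (shift q) x; rewrite (PaE a q x).
  generalize (shift (shift q) x) (shift q x) (lap (shift q) x) (p x) (q x).
  by move=> A B C D E ->; ring.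
have eR : \I (fun x => shift p x * shift q x + a * (p x * q x)) =
    \I (fun x => (p x * shift q x + lap p x * shift q x) + a * (p x * q x)).
  congr Defs.integral; apply/funext => x; have := shiftE p x.
  by generalize (shift p x) (shift q x) (lap p x) (p x) (q x) => A B C D E ->; ring.
rewrite [LHS]eL [RHS]eR.
rewrite [LHS](int_add Omega_open Omega_bounded (cont_extD cpsq cplsq) cpq).
rewrite [RHS](int_add Omega_open Omega_bounded (cont_extD cpsq clps) cpq).
congr (_ + _).
rewrite [LHS](int_add Omega_open Omega_bounded cpsq cplsq).
rewrite [RHS](int_add Omega_open Omega_bounded cpsq clps).
congr (_ + _); exact: (green_sym Omega_open Omega_bounded Omega_b gp gs).
Qed.

(** The density obtained from the energy by moving one factor I + Delta to the
    other side, with a potential F that also accounts for the stabilizer a. *)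
Definition energy_density (a : R) (F : R -> R) u : V -> R :=
  fun x => F (u x) + 2^-1 * (shift u x ^+ 2 + a * u x ^+ 2).

Lemma cont_ext_density a F u : continuous F -> Ck 2 u ->
  cont_ext (energy_density a F u).
Proof.
move=> cF cu; have ce := cont_ext_Ck cu; have cs := cont_ext_shift cu.
apply: cont_extD; first exact: (cont_ext_comp cF ce).
apply: cont_extZ; apply: cont_extD; first exact: (cont_extX 2 cs).
exact: (cont_extZ a (cont_extX 2 ce)).
Qed.

Lemma energyE eps a w : smooth_bc w -> smooth_bc (lap w) ->
  energy eps Omega w = \I (energy_density a
    (fun y => 4^-1 * y ^+ 4 - (eps + a) / 2 * y ^+ 2) w).
Proof.
move=> gw gl; have cw := cont_ext_smooth_bc gw; have cs := cont_ext_shift gw.1.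
pose D := fun x => 4^-1 * w x ^+ 4 - (eps + a) / 2 * w x ^+ 2.
have cD : cont_ext D.
  have -> : D = fun x => 4^-1 * w x ^+ 4 + (- ((eps + a) / 2)) * w x ^+ 2.
    by apply/funext => x; rewrite /D mulNr.
  by apply: cont_extD; apply: cont_extZ; apply: cont_extX.
have cP : cont_ext (Pa a w).
  apply: cont_extD; last exact: (cont_extZ a cw).
  exact: (cont_ext_shift (smooth_bc_shift gw gl).1).
have -> : energy eps Omega w = \I (fun x => D x + 2^-1 * (w x * Pa a w x)).
  rewrite /energy; congr Defs.integral; apply/funext => x.
  by rewrite (PaE a w x) /D; generalize (shift (shift w) x) (w x) => A B; field.
have cQ : cont_ext (fun x => shift w x * shift w x + a * (w x * w x)).
  by apply: cont_extD; [exact: (cont_extM cs cs)|exact: (cont_extZ a (cont_extM cw cw))].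
have lin G : cont_ext G -> \I (fun x => D x + 2^-1 * G x) = \I D + 2^-1 * \I G.
  move=> cG; rewrite -(int_scale Omega_open Omega_bounded 2^-1 cG).
  exact: (int_add Omega_open Omega_bounded cD (cont_extZ 2^-1 cG)).
rewrite [LHS](lin _ (cont_extM cw cP)) [X in _ + _ * X](integral_Pa a gw gw gl).
by rewrite -[LHS](lin _ cQ).
Qed.

End bilinear.

(** * Energy dissipation over one step *)

Section step_dissipation.
Variables (R : realType) (d : nat) (Omega : set 'rV[R]_d) (b : boundary_type R d).
Hypotheses (Omega_open : open Omega) (Omega_bounded : bounded_set Omega)
  (Omega_b : boundary_ok Omega b).
Local Notation V := 'rV[R]_d.
Local Notation smooth_bc := (smooth_bc Omega b).
Local Notation cont_ext := (cont_ext Omega).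
Local Notation "\I f" := (Defs.integral Omega f) (at level 10, f at level 8).

Variables (s : nat) (A Ahat : 'M[R]_s) (alpha beta L a tau : R) (F f : R -> R).
Hypotheses (tA : is_trig_mx A) (tAhat : is_trig_mx Ahat)
  (uAhat : Ahat \in unitmx)
  (row_sums : forall i, \sum_j A i j = \sum_j Ahat i j)
  (H0_pos : pos_def (sym_part (H0_mx Ahat)))
  (H1_ge0 : forall v, 0 <= qform (H1_mx A Ahat L beta) v)
  (H2_ge0 : forall v, 0 <= qform (H2_mx A Ahat alpha) v)
  (a_ge0 : 0 <= a) (tau_ge0 : 0 <= tau) (cF : continuous F)
  (FL : forall x y, F y - F x <= f x * (y - x) + L / 2 * (y - x) ^+ 2).

Variables w q : nat -> V -> R.
Hypotheses (cw : forall j, Ck 6 (w j)) (gw : forall j, smooth_bc (w j))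
  (gl : forall j, smooth_bc (lap (w j))) (gP : forall j, smooth_bc (Pa a (w j)))
  (gq : forall j, smooth_bc (q j)) (qf : forall j, eq_on Omega (q j) (f \o w j)).
Hypothesis scheme : forall (i : 'I_s) x, Omega x ->
  w i.+1 x - w 0 x = tau *
    (\sum_j A i j * ((1 + alpha) * lap (Pa a (w j.+1)) x + beta * lap (w j.+1) x) +
     \sum_j Ahat i j * (lap (q j) x - alpha * lap (Pa a (w j)) x - beta * lap (w j) x)).

Local Notation Q := (Q_mx A Ahat).
Local Notation K := (K_mx A Ahat).
Local Notation G := (invmx (H0_mx Ahat)).
(* PY j + beta QW j + q j is the discrete chemical potential m j of the stage
   following stage j; PY j is P applied to Y j. *)
Let c (j : 'I_s) : 'I_s -> R := (K + alpha *: Q) j.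
Let D (j : nat) : V -> R := fun x => w j.+1 x - w j x.
Let Y (j : 'I_s) : V -> R := fun x => w 0 x + combination (c j) w x.
Let PY (j : 'I_s) : V -> R :=
  fun x => Pa a (w 0) x + combination (c j) (fun m => Pa a (w m)) x.
Let QW (j : 'I_s) : V -> R := combination (Q j) w.
Let m (j : 'I_s) : V -> R := fun x => PY j x + (beta * QW j x + q j x).

Let c2 j : Ck 2 (w j). Proof. exact: (gw j).1. Qed.
Let c4 j : Ck 4 (w j). Proof. exact: (Ck_le (isT : (4 <= 6)%N) (cw j)). Qed.

Let smooth_bc_combination n (e : 'I_n -> R) z :
  (forall j, smooth_bc (z j)) -> smooth_bc (combination e z).
Proof. by move=> gz; apply: smooth_bc_sum => l; exact: (smooth_bcZ _ (smooth_bcB (gz _) (gz _))). Qed.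

Let gPY j : smooth_bc (PY j).
Proof. exact: (smooth_bcD (gP 0) (smooth_bc_combination _ gP)). Qed.

Let gm j : smooth_bc (m j).
Proof. exact: (smooth_bcD (gPY j) (smooth_bcD (smooth_bcZ beta (smooth_bc_combination _ gw)) (gq j))). Qed.

Let gD j : smooth_bc (D j). Proof. exact: (smooth_bcB (gw _) (gw _)). Qed.

Let gY j : smooth_bc (Y j).
Proof. exact: (smooth_bcD (gw 0) (smooth_bc_combination _ gw)). Qed.

Let PYE j : PY j = Pa a (Y j).
Proof.
apply/funext => x; rewrite /PY /Y.
rewrite (PaD a x (c4 0) (Ck_combination (c j) c4)).
by rewrite (Pa_combination a (c j) x c4).
Qed.

Let lap_mE j x : lap (m j) x = lap (Pa a (w 0)) x +
  combination (c j) (fun n => lap (Pa a (w n))) x +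
  (beta * combination (Q j) (fun n => lap (w n)) x + lap (q j) x).
Proof.
have cP n := (gP n).1.
rewrite /m (lapD x (gPY j).1 (smooth_bcD (smooth_bcZ beta (smooth_bc_combination _ gw)) (gq j)).1).
rewrite (lapD x (smooth_bcZ beta (smooth_bc_combination _ gw)).1 (gq j).1).
rewrite (lapZ beta x (smooth_bc_combination (Q j) gw).1).
rewrite /PY (lapD x (cP 0) (Ck_combination (c j) cP)).
by rewrite (lap_combination (c j) x cP) (lap_combination (Q j) x c2).
Qed.

Let mulmx_increments (N : 'M[R]_s) (z : nat -> V -> R) j x :
  (N *m increments s (fun n => z n x)) j 0 = combination (N j) z x.
Proof. by rewrite mxE; apply: eq_bigr => l _; congr (_ * _); exact: mxE. Qed.

Let increment_lap_m (j : 'I_s) x : Omega x -> D j x = tau * \sum_l G j l * lap (m l) x.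
Proof.
move=> Ox.
have := scheme_increments uAhat row_sums (y := fun n => w n x)
  (P := fun n => lap (Pa a (w n)) x) (W := fun n => lap (w n) x)
  (g := fun n => lap (q n) x) (fun i => scheme i Ox).
move=> /matrixP /(_ j 0); rewrite [X in X = _]mxE => e.
rewrite /D [LHS]e [LHS]mxE [X in tau * X]mxE; congr (_ * _); apply: eq_bigr => l _.
congr (_ * _); rewrite lap_mE.
have entry (u1 u2 u3 u4 : 'cV[R]_s) : (u1 + u2 + beta *: u3 + u4) l 0 =
    u1 l 0 + u2 l 0 + (beta * u3 l 0 + u4 l 0) by rewrite !mxE addrA.
rewrite [LHS]entry; congr (_ + _ + (_ * _ + _)).
- exact: mxE.
- exact: (mulmx_increments (K + alpha *: Q) (fun n => lap (Pa a (w n)))).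
- exact: (mulmx_increments Q (fun n => lap (w n))).
- exact: mxE.
Qed.

(** Testing the scheme with the discrete chemical potentials: the Dirichlet
    form that appears inherits its sign from H0. *)
Let sum_integral_D_m_le0 k : (k <= s)%N ->
  \sum_(j < s | (j < k)%N) \I (fun x => D j x * m j x) <= 0.
Proof.
move=> ks; pose Gm (j : 'I_s) : V -> R := fun x => \sum_l G j l * m l x.
have gGm j : smooth_bc (Gm j) by apply: smooth_bc_sum => l; exact: (smooth_bcZ _ (gm l)).
have eGm i j x : partial i (Gm j) x = \sum_l G j l * partial i (m l) x.
  rewrite /Gm; elim: (index_enum 'I_s) => [|l r ih].
    under eq_fun do rewrite big_nil.
    by rewrite big_nil partial_cst.
  under eq_fun do rewrite big_cons.
  have gr : smooth_bc (fun y => \sum_(l <- r) G j l * m l y).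
    by apply: smooth_bc_sum => n; exact: (smooth_bcZ _ (gm n)).
  rewrite big_cons (partialD i x (CkW (smooth_bcZ (G j l) (gm l)).1) (CkW gr.1)) ih.
  by rewrite (partialZ i _ x (CkW (gm l).1)).
have lGm j x : lap (Gm j) x = \sum_l G j l * lap (m l) x.
  rewrite /Gm (lap_sum _ x (fun l => (smooth_bcZ (G j l) (gm l)).1)).
  by apply: eq_bigr => l _; rewrite (lapZ _ x (gm l).1).
pose B (j : 'I_s) : V -> R := fun x => \sum_i partial i (m j) x * partial i (Gm j) x.
have cB j : cont_ext (B j).
  apply: cont_ext_sum => i.
  exact: (cont_extM (cont_ext_partial Omega i (gm j).1) (cont_ext_partial Omega i (gGm j).1)).
have e (j : 'I_s) : \I (fun x => D j x * m j x) = - tau * \I (B j).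
  transitivity (\I (fun x => tau * (m j x * lap (Gm j) x))).
    apply: int_eq_on => x Ox; rewrite (increment_lap_m j Ox) lGm.
    by rewrite -mulrA; congr (_ * _); exact: mulrC.
  have cml := cont_extM (cont_ext_smooth_bc (gm j)) (cont_ext_lap Omega (gGm j).1).
  rewrite (int_scale Omega_open Omega_bounded tau cml).
  by rewrite (green Omega_open Omega_bounded Omega_b (gm j) (gGm j)) mulrN mulNr.
rewrite (eq_bigr _ (fun j _ => e j)) -mulr_sumr -(int_sum Omega_open Omega_bounded _ _ cB).
rewrite mulNr oppr_le0 mulr_ge0 //; apply: int_ge0 => x _.
rewrite exchange_big sumr_ge0 // => i _ /=.
have tG : is_trig_mx G by exact: (trig_invmx (trig_H0 tAhat uAhat) (unitmx_H0 uAhat)).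
pose v : 'cV[R]_s := \col_j partial i (m j) x.
suff -> : \sum_(j < s | (j < k)%N) partial i (m j) x * partial i (Gm j) x =
    \sum_(j < s | (j < k)%N) v j 0 * (G *m v) j 0.
  by rewrite qform_trunc //; apply: qform_H0_inv_ge0.
apply: eq_bigr => j _; rewrite eGm /v !mxE; congr (_ * _).
by apply: eq_bigr => l _; rewrite mxE.
Qed.

(* The product of D j and m j after the integrations by parts in P. *)
Let M (j : 'I_s) : V -> R := fun x =>
  (shift (D j) x * shift (Y j) x + a * (D j x * Y j x)) +
  (D j x * (beta * QW j x) + D j x * q j x).

Let cDshift (j : 'I_s) : cont_ext (fun x => shift (D j) x * shift (Y j) x + a * (D j x * Y j x)).
Proof.
apply: cont_extD.
  exact: (cont_extM (cont_ext_shift Omega (gD j).1) (cont_ext_shift Omega (gY j).1)).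
exact: (cont_extZ a (cont_extM (cont_ext_smooth_bc (gD j)) (cont_ext_smooth_bc (gY j)))).
Qed.

Let cDrest (j : 'I_s) : cont_ext (fun x => D j x * (beta * QW j x) + D j x * q j x).
Proof.
have cD := cont_ext_smooth_bc (gD j).
apply: cont_extD; last exact: (cont_extM cD (cont_ext_smooth_bc (gq j))).
exact: (cont_extM cD (cont_extZ beta (cont_ext_smooth_bc (smooth_bc_combination _ gw)))).
Qed.

Let cM j : cont_ext (M j). Proof. exact: (cont_extD (cDshift j) (cDrest j)). Qed.

Let integral_D_m (j : 'I_s) : \I (fun x => D j x * m j x) = \I (M j).
Proof.
have cD := cont_ext_smooth_bc (gD j).
have -> : \I (fun x => D j x * m j x) =
    \I (fun x => D j x * PY j x + (D j x * (beta * QW j x) + D j x * q j x)).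
  congr Defs.integral; apply/funext => x.
  by rewrite /m; generalize (D j x) (PY j x) (QW j x) (q j x) => *; ring.
rewrite [LHS](int_add Omega_open Omega_bounded (cont_extM cD (cont_ext_smooth_bc (gPY j))) (cDrest j)).
rewrite [RHS](int_add Omega_open Omega_bounded (cDshift j) (cDrest j)); congr (_ + _).
rewrite PYE; apply: (integral_Pa Omega_open Omega_bounded Omega_b a (gD j) (gY j)).
have glY := smooth_bcD (gl 0) (smooth_bc_combination (c j) gl).
suff -> : lap (Y j) = fun x => lap (w 0) x + combination (c j) (fun n => lap (w n)) x by [].
apply/funext => x; rewrite /Y (lapD x (c2 0) (Ck_combination (c j) c2)).
by rewrite (lap_combination (c j) x c2).
Qed.

Lemma step_dissipation k : (k <= s)%N ->
  \I (energy_density a F (w k)) <= \I (energy_density a F (w 0)).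
Proof.
move=> ks; have ce j := cont_ext_density Omega a cF (c2 j).
rewrite -subr_le0 -(int_sub Omega_open Omega_bounded (ce k) (ce 0)).
apply: le_trans (sum_integral_D_m_le0 ks).
rewrite (eq_bigr _ (fun j _ => integral_D_m j)) -(int_sum Omega_open Omega_bounded _ _ cM).
have csum : cont_ext (fun x => \sum_(j < s | (j < k)%N) M j x) by exact: cont_ext_sum.
have cdif : cont_ext (fun x => energy_density a F (w k) x - energy_density a F (w 0) x).
  have -> : (fun x => energy_density a F (w k) x - energy_density a F (w 0) x) =
      fun x => energy_density a F (w k) x + (-1) * energy_density a F (w 0) x.
    by apply/funext => x; rewrite mulN1r.
  exact: (cont_extD (ce k) (cont_extZ (-1) (ce 0))).
apply: (int_le Omega_open Omega_bounded cdif csum) => x Ox.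
have := energy_density_increment tA tAhat uAhat FL H1_ge0 H2_ge0 a_ge0
  (fun n => w n x) (fun n => shift (w n) x) ks.
suff e (j : 'I_s) : M j x =
    ((w j.+1 x - w j x) * f (w j x) + beta * ((w j.+1 x - w j x) * (Q *m increments s (fun n => w n x)) j 0) +
     ((shift (w j.+1) x - shift (w j) x) * shift (w 0) x + a * ((w j.+1 x - w j x) * w 0 x)) +
     ((shift (w j.+1) x - shift (w j) x) * ((K + alpha *: Q) *m increments s (fun n => shift (w n) x)) j 0 +
      a * ((w j.+1 x - w j x) * ((K + alpha *: Q) *m increments s (fun n => w n x)) j 0))).
  by rewrite (eq_bigr _ (fun j _ => e j)).
rewrite (mulmx_increments Q w) (mulmx_increments (K + alpha *: Q) w).
rewrite (mulmx_increments (K + alpha *: Q) (fun n => shift (w n))).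
rewrite -[(K + alpha *: Q) j]/(c j) /M (shiftB x (c2 j.+1) (c2 j)) (shiftD x (c2 0) (Ck_combination (c j) c2)).
rewrite (shift_combination (c j) x c2) (qf j Ox) /= /D /Y /QW.
generalize (shift (w j.+1) x) (shift (w j) x) (shift (w 0) x) (w j.+1 x) (w j x) (w 0 x).
generalize (combination (c j) (fun n => shift (w n)) x) (combination (c j) w x).
generalize (combination (Q j) w x) (f (w j x)) => *; ring.
Qed.

(** The increments are combinations of Laplacians, which have mean zero. *)
Lemma step_mass k : (k <= s)%N -> \I (w k) = \I (w 0).
Proof.
elim: k => // k ih ks; rewrite -(ih (ltnW ks)).
pose j := Ordinal ks; have cl l : cont_ext (lap (m l)) by exact: (cont_ext_lap Omega (gm l).1).
have cD := cont_ext_smooth_bc (gD j); have cwk := cont_ext_smooth_bc (gw k).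
have e : eq_on Omega (w k.+1) (fun x => w k x + D j x).
  by move=> x _; rewrite /D addrC subrK.
rewrite (int_eq_on e) (int_add Omega_open Omega_bounded cwk cD).
rewrite (int_eq_on (fun x Ox => increment_lap_m j Ox)).
have cGl l : cont_ext (fun x => G j l * lap (m l) x) by exact: (cont_extZ _ (cl l)).
rewrite (int_scale Omega_open Omega_bounded tau (cont_ext_sum _ _ cGl)).
rewrite (int_sum Omega_open Omega_bounded _ _ cGl) big1 ?mulr0 ?addr0 // => l _.
rewrite (int_scale Omega_open Omega_bounded _ (cl l)).
by rewrite (integral_lap_eq0 Omega_open Omega_bounded Omega_b (gm l)) mulr0.
Qed.

End step_dissipation.

(** * A priori bounds and uniqueness of a stage *)

Section a_priori.
Variables (R : realType) (d : nat) (Omega : set 'rV[R]_d) (b : boundary_type R d).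
Hypotheses (Omega_open : open Omega) (Omega_bounded : bounded_set Omega)
  (Omega_neq0 : Omega !=set0) (Omega_b : boundary_ok Omega b).
Local Notation V := 'rV[R]_d.
Local Notation smooth_bc := (smooth_bc Omega b).
Local Notation cont_ext := (cont_ext Omega).
Local Notation "\I f" := (Defs.integral Omega f) (at level 10, f at level 8).
Local Notation vol := (volume Omega).

Lemma smooth_bc_Ck_bc p : smooth_bc p -> Ck_bc Omega b 2 p.
Proof. by move=> [cp bp]; exists p; split. Qed.

Lemma L2norm_sqr (u : V -> R) : L2norm Omega u ^+ 2 = \I (fun x => u x ^+ 2).
Proof. by rewrite sqr_sqrtr //; apply: int_ge0 => x _; exact: sqr_ge0. Qed.

Lemma L2norm_grad_sqr (u : V -> R) :
  L2norm_grad Omega u ^+ 2 = \I (fun x => \sum_i partial i u x ^+ 2).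
Proof.
rewrite sqr_sqrtr //; apply: int_ge0 => x _.
by apply: sumr_ge0 => i _; exact: sqr_ge0.
Qed.

(** Testing the homogeneous stage equation with the expression under the
    Laplacian gives a positive definite form of e on the left and minus a
    Dirichlet form on the right. *)
Lemma implicit_stage_unique (a alpha beta kappa : R) (e : V -> R) :
  0 < a -> 0 < 1 + alpha -> 0 <= beta -> 0 <= kappa ->
  smooth_bc e -> smooth_bc (lap e) -> smooth_bc (Pa a e) ->
  (forall x, Omega x -> e x = kappa * ((1 + alpha) * lap (Pa a e) x + beta * lap e x)) ->
  forall x, Omega x -> e x = 0.
Proof.
move=> a0 al0 be0 k0 ge gl gP he.
pose eta x := (1 + alpha) * Pa a e x + beta * e x.
have geta : smooth_bc eta by exact: (smooth_bcD (smooth_bcZ _ gP) (smooth_bcZ _ ge)).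
have leta x : lap eta x = (1 + alpha) * lap (Pa a e) x + beta * lap e x.
  rewrite /eta (lapD x (smooth_bcZ _ gP).1 (smooth_bcZ _ ge).1).
  by rewrite (lapZ _ x gP.1) (lapZ _ x ge.1).
have ce := cont_ext_smooth_bc ge; have cs := cont_ext_shift Omega ge.1.
have cee := cont_extM ce ce; have cP := cont_ext_smooth_bc gP.
have ceta := cont_ext_smooth_bc geta; have cl := cont_ext_lap Omega geta.1.
have e1 : \I (fun x => e x * eta x) = - (kappa * \I (fun x => \sum_i partial i eta x * partial i eta x)).
  transitivity (\I (fun x => kappa * (eta x * lap eta x))).
    apply: int_eq_on => x Ox; have := he x Ox; rewrite -(leta x).
    by generalize (e x) (lap eta x) (eta x) => A B C ->; ring.
  rewrite (int_scale Omega_open Omega_bounded kappa (cont_extM ceta cl)).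
  by rewrite (green Omega_open Omega_bounded Omega_b geta geta) mulrN.
have e2 : \I (fun x => e x * eta x) =
    (1 + alpha) * \I (fun x => shift e x * shift e x + a * (e x * e x)) +
    beta * \I (fun x => e x * e x).
  transitivity (\I (fun x => (1 + alpha) * (e x * Pa a e x) + beta * (e x * e x))).
    by apply: int_eq_on => x _; rewrite /eta; generalize (e x) (Pa a e x) => *; ring.
  have ceP := cont_extM ce cP.
  rewrite (int_add Omega_open Omega_bounded (cont_extZ _ ceP) (cont_extZ _ cee)).
  rewrite (int_scale Omega_open Omega_bounded _ ceP) (int_scale Omega_open Omega_bounded _ cee).
  by rewrite (integral_Pa Omega_open Omega_bounded Omega_b a ge ge gl).
have css := cont_extM cs cs.
rewrite (int_add Omega_open Omega_bounded css (cont_extZ a cee)) in e2.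
rewrite (int_scale Omega_open Omega_bounded a cee) in e2.
have i0 : 0 <= \I (fun x => \sum_i partial i eta x * partial i eta x).
  by apply: int_ge0 => x _; apply: sumr_ge0 => i _; exact: sqr_ge0.
have i1 : 0 <= \I (fun x => shift e x * shift e x).
  by apply: int_ge0 => x _; exact: sqr_ge0.
have i2 : 0 <= \I (fun x => e x * e x) by apply: int_ge0 => x _; exact: sqr_ge0.
apply: (int_sqr_eq0 Omega_open Omega_bounded ce).
rewrite -[LHS]/(\I (fun x => e x * e x)).
move: e1 e2 i0 i1 i2.
generalize (\I (fun x => e x * eta x)) (\I (fun x => shift e x * shift e x)).
generalize (\I (fun x => e x * e x)) (\I (fun x => \sum_i partial i eta x * partial i eta x)).
move=> I2 I0 Ie I1 -> e2 i0 i1 i2; apply/eqP; rewrite eq_le i2 andbT.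
have h0 : 0 <= kappa * I0 by rewrite mulr_ge0.
have h1 : 0 <= (1 + alpha) * I1 by rewrite mulr_ge0 // ltW.
have h2 : 0 <= beta * I2 by rewrite mulr_ge0.
have h3 : (1 + alpha) * a * I2 <= 0 by lra.
by move: h3; rewrite pmulr_rle0 // mulr_gt0.
Qed.

Variables (COm Cp delta eps a : R).
Hypotheses (COm_gt0 : 0 < COm) (Cp_gt0 : 0 < Cp)
  (sobolev : forall u, Ck_bc Omega b 2 u ->
     Linfnorm Omega u <=
     COm * Num.sqrt (L2norm Omega u ^+ 2 + L2norm_grad Omega u ^+ 2 +
                     L2norm Omega (lap u) ^+ 2))
  (poincare : forall u, Ck_bc Omega b 2 u ->
     L2norm Omega (fun x => u x - mean Omega u) <= Cp * L2norm_grad Omega u)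
  (eps_le1 : eps <= 1) (a_ge0 : 0 <= a)
  (delta_gt0 : 0 < delta) (delta_Cp : delta / 2 * Cp <= 2^-1).

(** The Sobolev inequality for the constant function 1. *)
Lemma volume_sobolev : 1 <= COm ^+ 2 * vol.
Proof.
have h1 : Linfnorm Omega (fun=> 1) = 1.
  rewrite /Linfnorm (_ : [set _ | _ in Omega] = [set 1]) ?sup1 //.
  apply/seteqP; split=> [_ [x _ <-]|r ->]; first by rewrite /= normr1.
  by have [x Ox] := Omega_neq0; exists x => //; rewrite normr1.
have := sobolev (smooth_bc_Ck_bc (smooth_bc_cst Omega b 1)); rewrite h1 !L2norm_sqr L2norm_grad_sqr.
have -> : \I (fun x : V => lap (fun _ : V => 1) x ^+ 2) = 0.
  under eq_fun do rewrite lap_cst expr0n.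
  exact: (int_zero Omega_open).
have -> : \I (fun x : V => \sum_i partial i (fun _ : V => 1) x ^+ 2) = 0.
  have -> : (fun x : V => \sum_i partial i (fun _ : V => 1) x ^+ 2) = fun=> 0.
    by apply/funext => x; rewrite big1 // => i _; rewrite partial_cst expr0n.
  exact: (int_zero Omega_open).
rewrite !addr0; under eq_fun do rewrite expr1n.
rewrite -/vol => h; have : 1 <= (COm * Num.sqrt vol) ^+ 2 by exact: exprn_ege1.
rewrite exprMn sqr_sqrtr //; apply: int_ge0 => x _; exact: ler01.
Qed.

Lemma volume_gt0 : 0 < vol.
Proof.
have := volume_sobolev => h; rewrite -(pmulr_rgt0 _ (_ : 0 < COm ^+ 2)).
  exact: lt_le_trans h.
by rewrite exprn_gt0.
Qed.

(** The density is at least - 1/4, by completing the square in u^2. *)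
Lemma energy_lower_bound w : smooth_bc w -> smooth_bc (lap w) ->
  3 / 4 * vol <= energy eps Omega w + vol.
Proof.
move=> gw gl; rewrite (energyE Omega_open Omega_bounded Omega_b eps 0 gw gl).
pose F y := 4^-1 * y ^+ 4 - (eps + 0) / 2 * y ^+ 2.
have cF : continuous F by exact: continuous_quartic.
have cd := cont_ext_density Omega 0 cF gw.1.
have e1 := eps_le1.
have : \I (fun=> - 4^-1) <= \I (energy_density 0 F w).
  apply: (int_le Omega_open Omega_bounded (cont_ext_cst Omega _) cd) => x _.
  rewrite /energy_density /F; generalize (shift w x) (w x) => S y.
  have : 0 <= S ^+ 2 by exact: sqr_ge0.
  have : 0 <= (y ^+ 2 - 1) ^+ 2 by exact: sqr_ge0.
  have : 0 <= (1 - eps) * y ^+ 2 by rewrite mulr_ge0 ?sqr_ge0 // subr_ge0.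
  by lra.
by rewrite (int_cst Omega_open); rewrite -/F; lra.
Qed.

(** M1 alone contributes 4 COm^2 (E + |Omega|), which is at least
    3 COm^2 |Omega|, so that the Sobolev constant cancels. *)
Lemma Mbound_sqr_ge (u : V -> R) : 3 / 4 * vol <= energy eps Omega u + vol ->
  0 < Mbound eps Omega COm Cp delta u /\
  3 <= Mbound eps Omega COm Cp delta u ^+ 2.
Proof.
move=> hE; set M := Mbound _ _ _ _ _ _.
have v0 := volume_gt0.
have E0 : 0 <= energy eps Omega u + vol by lra.
have M3 : 3 <= M ^+ 2.
  rewrite /M /Mbound exprMn; set M1 := 2 * Num.sqrt _.
  set M2 := _ + 2 * _; set M3 := _ + _ * M1.
  have sq : 0 <= M2 ^+ 2 + M3 ^+ 2 by rewrite addr_ge0 ?sqr_ge0.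
  have M1E : M1 ^+ 2 = 4 * (energy eps Omega u + vol).
    by rewrite /M1 exprMn sqr_sqrtr //; ring.
  rewrite sqr_sqrtr; last by rewrite -addrA addr_ge0 ?sqr_ge0.
  have C2 : 0 < COm ^+ 2 by rewrite exprn_gt0.
  have hv := volume_sobolev.
  have : COm ^+ 2 * (3 * vol) <= COm ^+ 2 * (M1 ^+ 2 + M2 ^+ 2 + M3 ^+ 2).
    by rewrite ler_wpM2l ?(ltW C2) //; clearbody M1 M2 M3; lra.
  by lra.
split=> //; rewrite lt_neqAle; apply/andP; split.
  by apply/eqP => M0; move: M3; rewrite -M0; lra.
by rewrite /M /Mbound mulr_ge0 ?sqrtr_ge0 // ltW.
Qed.

(** The truncated energy controls the Laplacian; the gradient and the function
    itself are then recovered from the Poincare inequality and the mean. *)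
Lemma Linfnorm_bound (u w : V -> R) :
  let M := Mbound eps Omega COm Cp delta u in
  0 < M -> 2 <= M ^+ 2 -> smooth_bc w -> smooth_bc (lap w) ->
  \I (energy_density a (F_trunc eps a M) w) <= energy eps Omega u ->
  \I w = \I u -> Linfnorm Omega w <= M.
Proof.
move=> M M0 M2 gw gl hE hmean.
apply: (le_trans (sobolev (smooth_bc_Ck_bc gw))); rewrite /M /Mbound.
rewrite ler_wpM2l ?(ltW COm_gt0) // ler_wsqrtr //.
have v0 := volume_gt0.
have cw := cont_ext_smooth_bc gw; have cl := cont_ext_smooth_bc gl.
have cd := cont_ext_density Omega a (@continuous_F_trunc R eps a M M0) gw.1.
have cl2 := cont_extX 2 cl.
set K := energy eps Omega u + vol.
have lap_le : \I (fun x => lap w x ^+ 2) <= 4 * K.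
  have -> : 4 * K = 4 * energy eps Omega u + 4 * vol by rewrite /K; ring.
  apply: (@le_trans _ _ (\I (fun x => 4 * energy_density a (F_trunc eps a M) w x + 4))).
    apply: (int_le Omega_open Omega_bounded cl2 (cont_extD (cont_extZ 4 cd) (cont_ext_cst Omega 4))) => x _.
    have := F_trunc_coercive a M0 (w x) M2 eps_le1; have := shiftE w x.
    rewrite /energy_density; generalize (shift w x) (lap w x) (w x) => S l y -> h.
    by have : 0 <= (2 * y + l) ^+ 2 := sqr_ge0 _; lra.
  rewrite (int_add Omega_open Omega_bounded (cont_extZ 4 cd) (cont_ext_cst Omega 4)).
  rewrite (int_scale Omega_open Omega_bounded 4 cd) (int_cst Omega_open); lra.
have K0 : 0 <= K.
  have : 0 <= \I (fun x => lap w x ^+ 2) by apply: int_ge0 => x _; exact: sqr_ge0.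
  by lra.
set mu := mean Omega w.
have muE : mean Omega u = mu by rewrite /mu /mean hmean.
have gwm : smooth_bc (fun x => w x - mu) by exact: (smooth_bcB gw (smooth_bc_cst Omega b mu)).
have cwm := cont_ext_smooth_bc gwm; have cwm2 := cont_extX 2 cwm.
have cgrad : cont_ext (fun x => \sum_i partial i w x ^+ 2).
  by apply: cont_ext_sum => i; exact: (cont_extX 2 (cont_ext_partial Omega i gw.1)).
have gradE : \I (fun x => \sum_i partial i w x ^+ 2) = - \I (fun x => (w x - mu) * lap w x).
  rewrite (green Omega_open Omega_bounded Omega_b gwm gw) opprK.
  congr Defs.integral; apply/funext => x; apply: eq_bigr => i _.
  rewrite expr2; congr (_ * _).
  by rewrite (partialD i x (CkW gw.1) (Ck_cst d 1 (- mu))) partial_cst addr0.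
have poin : \I (fun x => (w x - mu) ^+ 2) <= Cp ^+ 2 * \I (fun x => \sum_i partial i w x ^+ 2).
  rewrite -L2norm_sqr -L2norm_grad_sqr -exprMn.
  rewrite ler_sqr ?nnegrE ?sqrtr_ge0 ?mulr_ge0 ?sqrtr_ge0 //; last exact: ltW.
  exact: (poincare (smooth_bc_Ck_bc gw)).
have C2 : 0 < Cp ^+ 2 by rewrite exprn_gt0.
have grad_le : \I (fun x => \sum_i partial i w x ^+ 2) <= Cp ^+ 2 * (4 * K).
  (* with these weights the Poincare inequality absorbs half of the gradient norm *)
  have young : - \I (fun x => (w x - mu) * lap w x) <=
      (2 * Cp ^+ 2)^-1 * \I (fun x => (w x - mu) ^+ 2) +
      Cp ^+ 2 / 2 * \I (fun x => lap w x ^+ 2).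
    have cprod := cont_extM cwm cl.
    rewrite -mulN1r -(int_scale Omega_open Omega_bounded (-1) cprod).
    rewrite -(int_scale Omega_open Omega_bounded _ cwm2) -(int_scale Omega_open Omega_bounded _ cl2).
    rewrite -(int_add Omega_open Omega_bounded (cont_extZ _ cwm2) (cont_extZ _ cl2)).
    apply: (int_le Omega_open Omega_bounded (cont_extZ (-1) cprod)
      (cont_extD (cont_extZ _ cwm2) (cont_extZ _ cl2))) => x _.
    generalize (w x - mu) (lap w x) => y l.
    suff : 0 <= (2 * Cp ^+ 2)^-1 * (y + Cp ^+ 2 * l) ^+ 2.
      have -> : (2 * Cp ^+ 2)^-1 * (y + Cp ^+ 2 * l) ^+ 2 =
         (2 * Cp ^+ 2)^-1 * y ^+ 2 + Cp ^+ 2 / 2 * l ^+ 2 - -1 * (y * l).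
        by field; rewrite gt_eqF.
      by rewrite subr_ge0.
    by rewrite mulr_ge0 ?sqr_ge0 // invr_ge0 mulr_ge0 // ltW.
  have : (2 * Cp ^+ 2)^-1 * \I (fun x => (w x - mu) ^+ 2) <=
      2^-1 * \I (fun x => \sum_i partial i w x ^+ 2).
    rewrite invfM -mulrA ler_wpM2l // ?invr_ge0 //.
    by rewrite ler_pdivrMl.
  have : Cp ^+ 2 / 2 * \I (fun x => lap w x ^+ 2) <= Cp ^+ 2 / 2 * (4 * K).
    by rewrite ler_wpM2l // divr_ge0 // ltW.
  by move: young; rewrite -gradE; lra.
have l2E : \I (fun x => w x ^+ 2) = \I (fun x => (w x - mu) ^+ 2) + mu ^+ 2 * vol.
  have Iw : \I w = mu * vol by rewrite /mu /mean divfK // gt_eqF.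
  have cc := cont_ext_cst Omega (- mu ^+ 2).
  transitivity (\I (fun x => (w x - mu) ^+ 2 + (2 * mu * w x + (- mu ^+ 2)))).
    by apply: int_eq_on => x _; generalize (w x) => y; ring.
  rewrite (int_add Omega_open Omega_bounded cwm2 (cont_extD (cont_extZ (2 * mu) cw) cc)).
  rewrite (int_add Omega_open Omega_bounded (cont_extZ (2 * mu) cw) cc).
  rewrite (int_scale Omega_open Omega_bounded _ cw) (int_cst Omega_open) Iw; ring.
rewrite !L2norm_sqr L2norm_grad_sqr muE.
set nbar := L2norm Omega (fun=> mu).
have nb0 : 0 <= nbar by exact: sqrtr_ge0.
have nb2 : nbar ^+ 2 = mu ^+ 2 * vol by rewrite /nbar L2norm_sqr (int_cst Omega_open).
set M1 := 2 * Num.sqrt K.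
have M10 : 0 <= M1 by rewrite mulr_ge0 // sqrtr_ge0.
have M1E : M1 ^+ 2 = 4 * K by rewrite /M1 exprMn sqr_sqrtr //; ring.
have dC : Cp <= delta^-1.
  by have := delta_Cp; rewrite -[delta^-1]mul1r ler_pdivlMr //; lra.
have b2 : (Cp ^+ 2 * M1) ^+ 2 + nbar ^+ 2 <= (Cp / delta * M1 + 2 * nbar) ^+ 2.
  have x0 : 0 <= Cp ^+ 2 * M1 by rewrite mulr_ge0 // ltW.
  have xy : Cp ^+ 2 * M1 <= Cp / delta * M1.
    by rewrite ler_wpM2r // expr2 ler_wpM2l // ltW.
  move: x0 xy nb0; generalize (Cp ^+ 2 * M1) (Cp / delta * M1) nbar => X Y N x0 xy n0.
  by nra.
have b3 : (Cp * M1) ^+ 2 <= (delta * nbar + (Cp / 2 + (2 * delta)^-1) * M1) ^+ 2.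
  have h : Cp * M1 <= delta * nbar + (Cp / 2 + (2 * delta)^-1) * M1.
    have : 0 <= delta * nbar by rewrite mulr_ge0 // ltW.
    have : Cp * M1 <= (Cp / 2 + (2 * delta)^-1) * M1.
      have e : (2 * delta)^-1 = 2^-1 * delta^-1 by rewrite invfM.
      by rewrite ler_wpM2r // e; lra.
    by lra.
  have h0 : 0 <= Cp * M1 by rewrite mulr_ge0 // ltW.
  by rewrite ler_sqr // nnegrE // (le_trans h0 h).
have c4 : Cp ^+ 2 * \I (fun x => \sum_i partial i w x ^+ 2) <= Cp ^+ 2 * (Cp ^+ 2 * (4 * K)).
  by rewrite ler_wpM2l // ltW.
rewrite exprMn M1E in b2; rewrite exprMn M1E in b3.
rewrite M1E l2E -nb2; move: poin lap_le grad_le c4 b2 b3.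
generalize (\I (fun x => (w x - mu) ^+ 2)) (\I (fun x => \sum_i partial i w x ^+ 2)).
generalize (\I (fun x => lap w x ^+ 2)); move=> X1 X2 X3; lra.
Qed.

End a_priori.

(** * The scheme in terms of extensions *)

Section scheme.
Variables (R : realType) (d : nat) (Omega : set 'rV[R]_d) (b : boundary_type R d).
Hypotheses (Omega_open : open Omega) (Omega_b : boundary_ok Omega b).
Local Notation V := 'rV[R]_d.
Local Notation "\I f" := (Defs.integral Omega f) (at level 10, f at level 8).
Variables (a alpha beta tau : R) (s : nat) (A Ahat : 'M[R]_s).
Hypotheses (tA : is_trig_mx A) (tAhat : is_trig_mx Ahat).

Lemma Lop_extends g u w q x : extends Omega b a g u w q -> Omega x ->
  Lop a alpha beta u x = (1 + alpha) * lap (Pa a w) x + beta * lap w x.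
Proof.
move=> [_ uw [gw _ gP] _ _] Ox.
have e : eq_on Omega (fun y => (1 + alpha) * Pa a u y + beta * u y)
    (fun y => (1 + alpha) * Pa a w y + beta * w y).
  by move=> y Oy; rewrite (uw y Oy) (eq_on_Pa Omega_open a uw Oy).
rewrite /Lop (eq_on_lap Omega_open e Ox).
rewrite (lapD x (CkZ (1 + alpha) gP.1) (CkZ beta gw.1)).
by rewrite (lapZ (1 + alpha) x gP.1) (lapZ beta x gw.1).
Qed.

Lemma Nop_extends g u w q x : extends Omega b a g u w q -> Omega x ->
  Nop a alpha beta g u x = lap q x - alpha * lap (Pa a w) x - beta * lap w x.
Proof.
move=> [_ uw [gw _ gP] gq qg] Ox.
have e : eq_on Omega (fun y => - g (u y) + alpha * Pa a u y + beta * u y)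
    (fun y => ((-1) * q y + alpha * Pa a w y) + beta * w y).
  move=> y Oy; rewrite (uw y Oy) (eq_on_Pa Omega_open a uw Oy).
  by rewrite (qg y Oy) mulN1r.
rewrite /Nop (eq_on_lap Omega_open e Ox).
have c1 := CkZ (-1) gq.1; have c2 := CkZ alpha gP.1.
rewrite (lapD x (CkD c1 c2) (CkZ beta gw.1)) (lapD x c1 c2).
rewrite (lapZ (-1) x gq.1) (lapZ alpha x gP.1) (lapZ beta x gw.1).
by generalize (lap q x) (lap (Pa a w) x) (lap w x) => *; ring.
Qed.

Lemma Lop_eq_on u v : eq_on Omega u v -> eq_on Omega (Lop a alpha beta u) (Lop a alpha beta v).
Proof.
move=> uv; apply: (eq_on_lap Omega_open) => y Oy.
by rewrite (uv y Oy) (eq_on_Pa Omega_open a uv Oy).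
Qed.

Lemma Nop_eq_on g h u v : eq_on Omega u v -> eq_on Omega (g \o v) (h \o v) ->
  eq_on Omega (Nop a alpha beta g u) (Nop a alpha beta h v).
Proof.
move=> uv gh x Ox.
suff e : eq_on Omega (fun y => - g (u y) + alpha * Pa a u y + beta * u y)
    (fun y => - h (v y) + alpha * Pa a v y + beta * v y).
  exact: (congr1 (fun z => - z) (eq_on_lap Omega_open e Ox)).
move=> y Oy.
have eg : g (u y) = h (v y) by rewrite (uv y Oy); exact: (gh y Oy).
move: eg (eq_on_Pa Omega_open a uv Oy) (uv y Oy).
by generalize (Pa a u y) (Pa a v y) (g (u y)) (h (v y)) (u y) (v y) => P P' G H U W -> -> ->.
Qed.

Lemma Ck_bc_eq_on k u v : eq_on Omega u v -> Ck_bc Omega b k v -> Ck_bc Omega b k u.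
Proof.
move=> uv [w [cw vw bw]]; exists w; split=> //.
by move=> x Ox; rewrite (uv x Ox) (vw x Ox).
Qed.

Lemma admissible_nonlinearity g h u : eq_on Omega (g \o u) (h \o u) ->
  admissible a Omega b g u -> admissible a Omega b h u.
Proof.
move=> gh [h1 h2 h3]; split=> //; apply: Ck_bc_eq_on h3 => x Ox.
by rewrite /chem -[h (u x)](gh x Ox).
Qed.

Lemma density_eq_on F u v : eq_on Omega u v ->
  \I (energy_density a F u) = \I (energy_density a F v).
Proof.
move=> uv; apply: int_eq_on => x Ox.
rewrite /energy_density; move: (eq_on_shift Omega_open uv Ox) (uv x Ox).
by generalize (shift u x) (shift v x) (u x) (v x) => S S' U W -> ->.
Qed.

Lemma energy_eq_on eps u v : eq_on Omega u v -> energy eps Omega u = energy eps Omega v.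
Proof.
move=> uv; apply: int_eq_on => x Ox.
move: (eq_on_shift Omega_open (eq_on_shift Omega_open uv) Ox) (uv x Ox).
by generalize (shift (shift u) x) (shift (shift v) x) (u x) (v x) => S S' U W -> ->.
Qed.

Lemma Linfnorm_eq_on u v : eq_on Omega u v -> Linfnorm Omega u = Linfnorm Omega v.
Proof.
move=> uv; suff e : [set `|u x| | x in Omega] = [set `|v x| | x in Omega].
  exact: (congr1 sup e).
apply/seteqP; split=> r [x Ox <-]; exists x; rewrite ?(uv x Ox) //; exact: Ox.
Qed.

Lemma triangular_sum (N : 'M[R]_s) (i : 'I_s) (z : 'I_s -> R) : is_trig_mx N ->
  \sum_(j < s | (j <= i)%N) N i j * z j = \sum_j N i j * z j.
Proof.
move=> /is_trig_mxP tN; rewrite big_mkcond; apply: eq_bigr => j _.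
by case: leqP => // ij; rewrite tN // mul0r.
Qed.

Definition stage_equations (g : R -> R) (u : nat -> V -> R) : Prop :=
  forall (i : 'I_s) x, Omega x ->
    u i.+1 x = u 0 x +
      tau * (\sum_(j < s | (j <= i)%N) A i j * Lop a alpha beta (u j.+1) x +
             \sum_(j < s | (j <= i)%N) Ahat i j * Nop a alpha beta g (u j) x).

(** The index is capped at s so that the extensions are defined, and regular,
    for every natural number. *)
Lemma step_extension (g g' : R -> R) (u : nat -> V -> R) :
  (forall y : R, is_derive y 1 g (g' y)) -> continuous g' ->
  (forall i, (i <= s)%N -> admissible a Omega b g (u i)) ->
  stage_equations g u ->
  exists w q : nat -> V -> R,
    (forall j, extends Omega b a g (u (minn j s)) (w j) (q j)) /\
    (forall (i : 'I_s) x, Omega x -> w i.+1 x - w 0 x = tau *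
      (\sum_j A i j * ((1 + alpha) * lap (Pa a (w j.+1)) x + beta * lap (w j.+1) x) +
       \sum_j Ahat i j *
         (lap (q j) x - alpha * lap (Pa a (w j)) x - beta * lap (w j) x))).
Proof.
move=> dg cg' adm eqs.
have ex j : exists wq : (V -> R) * (V -> R), extends Omega b a g (u (minn j s)) wq.1 wq.2.
  have [w [q h]] := admissible_extends Omega_open dg cg' (adm _ (geq_minr j s)).
  by exists (w, q).
have [wq hwq] := choice ex; exists (fun j => (wq j).1), (fun j => (wq j).2).
split=> // i x Ox.
have uE j : (j <= s)%N -> extends Omega b a g (u j) (wq j).1 (wq j).2.
  by move=> js; have := hwq j; rewrite (minn_idPl js).
have [_ e1 _ _ _] := uE i.+1 (ltn_ord i); have [_ e0 _ _ _] := uE 0 (leq0n s).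
rewrite -(e1 x Ox) -(e0 x Ox) (eqs i x Ox) [X in X - _]addrC addrK.
congr (_ * (_ + _)).
  rewrite triangular_sum //; apply: eq_bigr => j _; congr (_ * _).
  exact: (Lop_extends (uE j.+1 (ltn_ord j)) Ox).
rewrite triangular_sum //; apply: eq_bigr => j _; congr (_ * _).
exact: (Nop_extends (uE j (ltnW (ltn_ord j))) Ox).
Qed.

Lemma stage_difference (i : 'I_s) (u0 u1 v1 : R) (LU LV NU NV : nat -> R) :
  u1 = u0 + tau * (\sum_(j < s | (j <= i)%N) A i j * LU j.+1 +
                   \sum_(j < s | (j <= i)%N) Ahat i j * NU j) ->
  v1 = u0 + tau * (\sum_(j < s | (j <= i)%N) A i j * LV j.+1 +
                   \sum_(j < s | (j <= i)%N) Ahat i j * NV j) ->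
  (forall j, (j <= i)%N -> NU j = NV j) -> (forall j, (j < i)%N -> LU j.+1 = LV j.+1) ->
  u1 - v1 = tau * A i i * (LU i.+1 - LV i.+1).
Proof.
move=> -> -> hN hL.
have -> : \sum_(j < s | (j <= i)%N) Ahat i j * NU j =
    \sum_(j < s | (j <= i)%N) Ahat i j * NV j.
  by apply: eq_bigr => j ji; rewrite hN.
rewrite (bigD1 i (leqnn i)) [in X in _ - X](bigD1 i (leqnn i)) /=.
have -> : \sum_(j < s | (j <= i)%N && (j != i)) A i j * LU j.+1 =
    \sum_(j < s | (j <= i)%N && (j != i)) A i j * LV j.+1.
  apply: eq_bigr => j /andP[ji jI]; rewrite hL //.
  by rewrite ltn_neqAle ji andbT; move: jI; rewrite -val_eqE.
ring.
Qed.

(** A scheme that is implicit only through its diagonal is solved stage by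
    stage, and each stage determines the next one. *)
Lemma stages_unique (g g' : R -> R) (u v : nat -> V -> R) :
  bounded_set Omega -> 0 < a -> 0 < 1 + alpha -> 0 <= beta -> 0 <= tau ->
  (forall i, 0 <= A i i) ->
  (forall y : R, is_derive y 1 g (g' y)) -> continuous g' ->
  (forall i, (i <= s)%N -> admissible a Omega b g (u i)) ->
  (forall i, (i <= s)%N -> admissible a Omega b g (v i)) ->
  stage_equations g u -> stage_equations g v ->
  eq_on Omega (u 0) (v 0) ->
  forall i, (i <= s)%N -> eq_on Omega (u i) (v i).
Proof.
move=> bO a0 al0 be0 tau0 Aii dg cg' au av eu ev uv0 i.
elim: {i}_.+1 {-2}i (ltnSn i) => // m ih [//|i] im i_s.
have prev j : (j <= i)%N -> eq_on Omega (u j) (v j).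
  by move=> ji; apply: ih; [exact: leq_ltn_trans ji im|exact: leq_trans ji (ltnW i_s)].
have [w [q hw]] := admissible_extends Omega_open dg cg' (au _ i_s).
have [w' [q' hw']] := admissible_extends Omega_open dg cg' (av _ i_s).
have [cw uw [gw gl gP] _ _] := hw; have [cw' vw' [gw' gl' gP'] _ _] := hw'.
pose I := Ordinal i_s; pose e x := w x - w' x.
have c4w := Ck_le (isT : (4 <= 6)%N) cw; have c4w' := Ck_le (isT : (4 <= 6)%N) cw'.
have le : lap e = fun x => lap w x - lap w' x.
  by apply/funext => x; exact: (lapB x gw.1 gw'.1).
have Pe : Pa a e = fun x => Pa a w x - Pa a w' x.
  by apply/funext => x; exact: (PaB a x c4w c4w').
have ge : smooth_bc Omega b e by exact: (smooth_bcB gw gw').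
have gle : smooth_bc Omega b (lap e) by rewrite le; exact: (smooth_bcB gl gl').
have gPe : smooth_bc Omega b (Pa a e) by rewrite Pe; exact: (smooth_bcB gP gP').
have k0 : 0 <= tau * A I I by rewrite mulr_ge0.
suff he x : Omega x -> e x = tau * A I I * ((1 + alpha) * lap (Pa a e) x + beta * lap e x).
  move=> x Ox; have := implicit_stage_unique Omega_open bO Omega_b a0 al0 be0 k0 ge gle gPe he Ox.
  by rewrite /e -(uw x Ox) -(vw' x Ox) => /eqP; rewrite subr_eq0 => /eqP.
move=> Ox.
have eL : Lop a alpha beta (u i.+1) x - Lop a alpha beta (v i.+1) x =
    (1 + alpha) * lap (Pa a e) x + beta * lap e x.
  rewrite (Lop_extends hw Ox) (Lop_extends hw' Ox) Pe (lapB x gP.1 gP'.1) le.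
  generalize (lap (Pa a w) x) (lap (Pa a w') x) (lap w x) (lap w' x) => *; ring.
rewrite -eL -[LHS]/(w x - w' x) -(uw x Ox) -(vw' x Ox).
have ev' := ev I x Ox; rewrite -(uv0 x Ox) in ev'.
apply: (@stage_difference I _ _ _
  (fun j => Lop a alpha beta (u j) x) (fun j => Lop a alpha beta (v j) x)
  (fun j => Nop a alpha beta g (u j) x) (fun j => Nop a alpha beta g (v j) x)
  (eu I x Ox) ev').
  by move=> j ji; exact: (Nop_eq_on (prev j ji) (fun _ _ => erefl) Ox).
by move=> j ji; exact: (Lop_eq_on (prev j.+1 ji) Ox).
Qed.

End scheme.

(** * The theorem *)

Theorem theorem1 (R : realType) (d : nat) (hd : d = 2%N \/ d = 3%N)
  (Omega : set 'rV[R]_d) (Omega_open : open Omega)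
  (Omega_connected : connected Omega) (Omega_neq0 : Omega !=set0)
  (Omega_bounded : bounded_set Omega)
  (b : boundary_type R d) (Omega_b : boundary_ok Omega b)
  (COm Cp : R) (COm_gt0 : 0 < COm) (Cp_gt0 : 0 < Cp)
  (sobolev : forall u, Ck_bc Omega b 2 u ->
     Linfnorm Omega u <=
     COm * Num.sqrt (L2norm Omega u ^+ 2 + L2norm_grad Omega u ^+ 2 +
                     L2norm Omega (lap u) ^+ 2))
  (poincare : forall u, Ck_bc Omega b 2 u ->
     L2norm Omega (fun x => u x - mean Omega u) <= Cp * L2norm_grad Omega u)
  (eps : R) (eps01 : 0 < eps < 1)
  (delta : R) (delta_gt0 : 0 < delta) (delta_Cp : delta / 2 * Cp <= 2^-1)
  (a alpha beta : R) (a_gt0 : 0 < a)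
  (s : nat) (s_gt0 : (0 < s)%N) (A Ahat : 'M[R]_s)
  (A_lower : is_trig_mx A) (Ahat_lower : is_trig_mx Ahat)
  (row_sums : forall i, \sum_j A i j = \sum_j Ahat i j)
  (Ahat_unit : Ahat \in unitmx)
  (tau T : R) (tau_gt0 : 0 < tau) (T_gt0 : 0 < T)
  (phi0 : 'rV[R]_d -> R)
  (L : R) :
  let M0 := Mbound eps Omega COm Cp delta phi0 in
  let f := f_pfc eps a in
  let ftilde := f_trunc eps a M0 in
  let lamQ := lambda_min (sym_part (Q_mx A Ahat)) in
  (forall x y, `|ftilde x - ftilde y| <= L * `|x - y|) ->
  pos_def (sym_part (Q_mx A Ahat)) ->
  pos_def (sym_part (H0_mx Ahat)) ->
  (2 * lamQ)^-1 - 1 <= alpha ->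
  L / (2 * lamQ) <= beta ->
  [/\ [/\ pos_semidef (sym_part (H1_mx A Ahat L beta)),
          pos_semidef (sym_part (H2_mx A Ahat alpha)),
          L / (2 * lamQ) < beta -> pos_def (sym_part (H1_mx A Ahat L beta))
        & (2 * lamQ)^-1 - 1 < alpha -> pos_def (sym_part (H2_mx A Ahat alpha))]
    & forall phit ut,
        imex_rk a alpha beta Omega b A Ahat tau T ftilde phi0 phit ut ->
        [/\ forall n : nat, n%:R <= T / tau ->
              energy eps Omega (phit n.+1) - energy eps Omega (phit n) <= 0,
            forall n i : nat, n%:R <= T / tau -> (i <= s)%N ->
              Linfnorm Omega (ut n i) <= M0
          & imex_rk a alpha beta Omega b A Ahat tau T f phi0 phit ut /\
            forall phi u,
              imex_rk a alpha beta Omega b A Ahat tau T f phi0 phi u ->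
              forall n i : nat, n%:R <= T / tau -> (i <= s)%N ->
              forall x, Omega x -> u n i x = ut n i x]].
Proof.
move=> M0 f ftilde lamQ Llip Qpos H0pos hal hbe.
have L0 : 0 <= L.
  by have := Llip 1 0; rewrite subr0 normr1 mulr1; apply: le_trans; exact: normr_ge0.
have H1_ge0 v := H1_semidef s_gt0 Qpos v L0 hbe.
have H2_ge0 v := H2_semidef s_gt0 Qpos v hal.
have v1_gt0 (v : 'cV[R]_s) : v != 0 -> 0 < qform 1%:M v := @qform1_gt0 R s v.
split.
  split=> [v|v|hb v v0|hb v v0]; rewrite -/(qform _ _) qform_sym_part //.
    apply: lt_le_trans (H1_ge s_gt0 Qpos v L0 hbe).
    by rewrite mulr_gt0 ?v1_gt0 // H1_coef_gt0.
  apply: lt_le_trans (H2_ge s_gt0 Qpos v hal).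
  by rewrite mulr_gt0 ?v1_gt0 // H2_coef_gt0.
move=> phit ut sch; have [phit0 step] := sch.
have lam0 : 0 < lamQ := lambda_Q_gt0 s_gt0 Qpos.
have al0 : 0 < 1 + alpha.
  have : 0 < (2 * lamQ)^-1 by rewrite invr_gt0 mulr_gt0.
  by lra.
have be0 : 0 <= beta by apply: le_trans hbe; rewrite divr_ge0 // mulr_ge0 // ltW.
have [eps_gt0 eps_lt1] := andP eps01.
have eps_le1 := ltW eps_lt1.
have nT0 : 0%:R <= T / tau by rewrite divr_ge0 // ltW.
have [adm0 u00 _ _] := step 0 nT0.
have u0phi0 : eq_on Omega (ut 0 0) phi0 by move=> x Ox; rewrite (u00 x Ox) (phit0 x Ox).
have [ub6 lb4 _] := adm0 0 (leq0n s).
have [w0 [cw0 uw0 gw0 gl0]] := extension_lap Omega_open ub6 lb4.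
have phi0w : eq_on Omega phi0 w0 by move=> x Ox; rewrite -(u0phi0 x Ox) (uw0 x Ox).
have E0E : energy eps Omega phi0 = energy eps Omega w0 := energy_eq_on Omega_open eps phi0w.
have E0_ge : 3 / 4 * volume Omega <= energy eps Omega phi0 + volume Omega.
  by rewrite E0E; exact: (energy_lower_bound Omega_open Omega_bounded Omega_b eps_le1 gw0 gl0).
have [M0_gt0 M0sq] : 0 < M0 /\ 3 <= M0 ^+ 2.
  exact: (Mbound_sqr_ge Omega_open Omega_neq0 Cp delta COm_gt0 sobolev E0_ge).
have M0sq2 : 2 <= M0 ^+ 2 by apply: le_trans M0sq; rewrite ler_nat.
pose F := F_trunc eps a M0.
have kL := f_trunc_lipschitz_ge M0_gt0 Llip.
have FL x y : F y - F x <= ftilde x * (y - x) + L / 2 * (y - x) ^+ 2.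
  exact: F_trunc_taylor.
have cF : continuous F := @continuous_F_trunc R eps a M0 M0_gt0.
have dft y := is_derive_f_trunc eps a y M0_gt0.
have cft : continuous (f_trunc_slope eps a M0) := @continuous_f_trunc_slope R eps a M0 M0_gt0.
(* the truncated energy, which decreases along all stages of all steps *)
pose Et u := Defs.integral Omega (energy_density a F u).
have stage n : n%:R <= T / tau -> forall i, (i <= s)%N ->
    [/\ Et (ut n i) <= Et (ut n 0), Defs.integral Omega (ut n i) = Defs.integral Omega (ut n 0)
      & exists w, [/\ eq_on Omega (ut n i) w, smooth_bc Omega b w & smooth_bc Omega b (lap w)]].
  move=> nT; have [adm _ eqs _] := step n nT.
  have [w [q [ext eqw]]] := step_extension Omega_open A_lower Ahat_lower dft cft adm eqs.
  have cw j : Ck 6 (w j) by have [] := ext j.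
  have gw j : smooth_bc Omega b (w j) by have [_ _ []] := ext j.
  have gl j : smooth_bc Omega b (lap (w j)) by have [_ _ []] := ext j.
  have gP j : smooth_bc Omega b (Pa a (w j)) by have [_ _ []] := ext j.
  have gq j : smooth_bc Omega b (q j) by have [_ _ _] := ext j.
  have qf j : eq_on Omega (q j) (ftilde \o w j) by have [_ _ _ _] := ext j.
  have uw j : (j <= s)%N -> eq_on Omega (ut n j) (w j).
    by move=> js; have [_ + _ _ _] := ext j; rewrite (minn_idPl js).
  have uw0n := uw 0 (leq0n s).
  have dis k := step_dissipation Omega_open Omega_bounded Omega_b A_lower Ahat_lower
    Ahat_unit row_sums H0pos H1_ge0 H2_ge0 (ltW a_gt0) (ltW tau_gt0) cF FL
    cw gw gl gP gq qf eqw (k := k).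
  have mass k := step_mass Omega_open Omega_bounded Omega_b Ahat_unit row_sums
    gw gP gq eqw (k := k).
  move=> i i_s; have uwi := uw i i_s; split.
  - rewrite /Et (density_eq_on Omega_open a F uwi) (density_eq_on Omega_open a F uw0n).
    exact: dis.
  - by rewrite (int_eq_on uwi) (int_eq_on uw0n) mass.
  - by exists (w i); split; [exact: uwi|exact: gw|exact: gl].
have start n : n%:R <= T / tau -> Et (ut n 0) <= energy eps Omega phi0 /\
    Defs.integral Omega (ut n 0) = Defs.integral Omega phi0.
  elim: n => [|n ih] nT.
    split; last exact: (int_eq_on u0phi0).
    rewrite /Et (density_eq_on Omega_open a F uw0) E0E.
    rewrite (energyE Omega_open Omega_bounded Omega_b eps a gw0 gl0).
    apply: (int_le Omega_open Omega_bounded (cont_ext_density Omega a cF gw0.1)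
      (cont_ext_density Omega a (@continuous_quartic R _ _) gw0.1)).
    by move=> x _; rewrite /energy_density lerD2r; exact: F_trunc_le.
  have nT' : n%:R <= T / tau by apply: le_trans nT; rewrite ler_nat.
  have [_ _ _ un] := step n nT'; have [_ un1 _ _] := step n.+1 nT.
  have e : eq_on Omega (ut n.+1 0) (ut n s) by move=> x Ox; rewrite (un1 x Ox) (un x Ox).
  have [h1 h2] := ih nT'; have [h3 h4 _] := stage n nT' s (leqnn s).
  split; last by rewrite (int_eq_on e) h4.
  by rewrite /Et (density_eq_on Omega_open a F e); exact: le_trans h3 h1.
have bound n i : n%:R <= T / tau -> (i <= s)%N -> Linfnorm Omega (ut n i) <= M0.
  move=> nT i_s; have [h1 h2 [w [uw gw gl]]] := stage n nT i i_s.
  have [h3 h4] := start n nT.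
  rewrite (Linfnorm_eq_on uw).
  apply: (Linfnorm_bound Omega_open Omega_bounded Omega_neq0 Omega_b COm_gt0 Cp_gt0
    sobolev poincare eps_le1 delta_gt0 delta_Cp M0_gt0 M0sq2 gw gl (a := a)).
    rewrite -(density_eq_on Omega_open a F uw); exact: le_trans h1 h3.
  by rewrite -(int_eq_on uw) h2 h4.
have pbound n i x : n%:R <= T / tau -> (i <= s)%N -> Omega x -> `|ut n i x| <= M0.
  move=> nT i_s Ox; have [_ _ [w [uw gw _]]] := stage n nT i i_s.
  apply: (Linfnorm_le Omega_bounded _ (bound n i nT i_s) Ox).
  by exists w; [exact: (smooth_bc_continuous gw)|exact: uw].
have sameE n i : n%:R <= T / tau -> (i <= s)%N -> energy eps Omega (ut n i) = Et (ut n i).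
  move=> nT i_s; have [_ _ [w [uw gw gl]]] := stage n nT i i_s.
  rewrite (energy_eq_on Omega_open eps uw) /Et (density_eq_on Omega_open a F uw).
  rewrite (energyE Omega_open Omega_bounded Omega_b eps a gw gl).
  apply: int_eq_on => x Ox; rewrite /energy_density; congr (_ + _).
  have wx : `|w x| <= M0 by have := pbound n i x nT i_s Ox; rewrite (uw x Ox).
  by symmetry; apply: F_trunc_id.
(* the truncation is inactive *)
have fE n i : n%:R <= T / tau -> (i <= s)%N -> eq_on Omega (ftilde \o ut n i) (f \o ut n i).
  by move=> nT i_s x Ox /=; apply: f_trunc_id; exact: pbound.
have schf : imex_rk a alpha beta Omega b A Ahat tau T f phi0 phit ut.
  split; first exact: phit0.
  move=> n nT; have [adm un0 eqs uns] := step n nT.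
  split; [|exact: un0| |exact: uns].
    by move=> i i_s; exact: (admissible_nonlinearity (fE n i nT i_s) (adm i i_s)).
  move=> i x Ox; rewrite [LHS](eqs i x Ox).
  have e (j : 'I_s) : Nop a alpha beta ftilde (ut n j) x = Nop a alpha beta f (ut n j) x.
    exact: (Nop_eq_on Omega_open a alpha beta (fun _ _ => erefl) (fE n j nT (ltnW (ltn_ord j))) Ox).
  have eS : \sum_(j < s | (j <= i)%N) Ahat i j * Nop a alpha beta ftilde (ut n j) x =
      \sum_(j < s | (j <= i)%N) Ahat i j * Nop a alpha beta f (ut n j) x.
    by apply: eq_bigr => j _; exact: (congr1 ( *%R (Ahat i j)) (e j)).
  exact: (congr1 (fun S => ut n 0 x + tau * (_ + S)) eS).
split.
- move=> n nT; have [_ un0 _ uns] := step n nT.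
  have e1 : eq_on Omega (phit n.+1) (ut n s) := uns.
  have e0 : eq_on Omega (phit n) (ut n 0) by move=> x Ox; rewrite (un0 x Ox).
  rewrite (energy_eq_on Omega_open eps e1) (energy_eq_on Omega_open eps e0).
  rewrite (sameE n s nT (leqnn s)) (sameE n 0 nT (leq0n s)) subr_le0.
  by have [] := stage n nT s (leqnn s).
- exact: bound.
split; first exact: schf.
move=> phi u [phi_0 stepu].
have [_ stepf] := schf.
have dfp y := is_derive_f_pfc eps a y.
have cfp := @continuous_f_pfc_slope R (eps + a).
have Aii i : 0 <= A i i by apply: ltW; exact: (A_diag_gt0 A_lower Ahat_lower Ahat_unit Qpos).
have same n : n%:R <= T / tau -> eq_on Omega (phi n) (phit n) ->
    forall i, (i <= s)%N -> eq_on Omega (u n i) (ut n i).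
  move=> nT en; have [admu un0 equ _] := stepu n nT; have [admt tn0 eqt _] := stepf n nT.
  apply: (stages_unique Omega_open Omega_b Omega_bounded a_gt0 al0 be0 (ltW tau_gt0) Aii
    dfp cfp admu admt equ eqt).
  by move=> x Ox; rewrite (un0 x Ox) (tn0 x Ox) (en x Ox).
have samephi n : n%:R <= T / tau -> eq_on Omega (phi n) (phit n).
  elim: n => [|n ih] nT.
    by move=> x Ox; rewrite (phi_0 x Ox) (phit0 x Ox).
  have nT' : n%:R <= T / tau by apply: le_trans nT; rewrite ler_nat.
  have [_ _ _ ue] := stepu n nT'; have [_ _ _ te] := step n nT'.
  by move=> x Ox; rewrite (ue x Ox) (te x Ox) (same n nT' (ih nT') s (leqnn s) x Ox).
by move=> n i nT i_s x Ox; exact: (same n nT (samephi n nT) i i_s x Ox).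
Qed.
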